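(* Let $\big((V_{cl},\mathbb Y,\iota_{cl}),(V_{op},Y_{op},\iota_{op}),\mathbb Y_{cl-op}\big)$ be an open-closed field algebra over $V$ such that $V_{op}$ and $V_{cl}$ are equipped with nondegenerate invariant bilinear forms $(\cdot,\cdot)_{op}$ and $(\cdot,\cdot)_{cl}$. For $u\in V_{op}$ and $z_0\in\mathbb H$ let $$B_{z_0}(u)=\Big(e^{L(-1)}(\bar z_0-z_0)^{L(0)}\otimes e^{L(-1)}\,\overline{\bar z_0-z_0}^{\,L(0)}\Big)\iota_{cl-op}^*(z_0,\bar z_0)(u)\in\overline{V_{cl}}.$$ If $u\in V_{op}$ is a vacuum-like vector, i.e. $L(-1)u=0$, then for every $z_0\in\mathbb H$ the vector $B_{z_0}(u)$ is an Ishibashi state, i.e. $$(L^L(n)-L^R(-n))B_{z_0}(u)=0\qquad\text{for all }n\in\mathbb Z.$$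
   Context: **The map $\iota^*_{cl-op}$.** For $z\in\mathbb H$, $\iota_{cl-op}(z,\bar z):V_{cl}\to\overline V_{op}$ is $u\mapsto\mathbb Y_{cl-op}(u;z,\bar z)\mathbf 1_{op}$, and $\iota_{cl-op}^*(z,\bar z):V_{op}\to\overline{V_{cl}}$ is its adjoint: $(\iota_{cl-op}^*(z,\bar z)(w),u)_{cl}=(w,\iota_{cl-op}(z,\bar z)(u))_{op}$ for $u\in V_{cl},w\in V_{op}$. **Conventions.** $\mathbb H$ is the open upper half plane; $\log z=\log|z|+i\arg z$, $0\le\arg z<2\pi$; $z^s=e^{s\log z}$, $\bar z^s=e^{s\overline{\log z}}$. For a graded space $W$, $\overline W$ is the product of its homogeneous components. **Assumption on $V$.** $V$ is a simple vertex operator algebra of central charge $c$ which is $C_2$-cofinite, $V_{(n)}=0$ for $n<0$, $V_{(0)}=\mathbb C\mathbf 1$, $V'\cong V$ as $V$-modules, and every $\mathbb N$-gradable weak $V$-module is completely reducible. **Open sector.** $(V_{op},Y_{op},\iota_{op})$ is an open-string vertex operator algebra over $V$: $V_{op}$ is a $V$-module with real weights, finite-dimensional weight spaces and weights bounded below, $\iota_{op}:V\to V_{op}$ is a $V$-module map, $\mathbf 1_{op}=\iota_{op}(\mathbf 1)$, $\omega_{op}=\iota_{op}(\omega)$, and there is a $V$-intertwining operator $Y_{op}^f$ of type $\binom{V_{op}}{V_{op}V_{op}}$ with $Y_{op}(u,r)=Y^f_{op}(u,x)|_{x=r}$ for $r>0$ (with $\log r\in\mathbb R$), such that $Y_{op}^f(\iota_{op}(v),x)$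 is the module vertex operator of $v\in V$, $\lim_{r\to0}Y_{op}(u,r)\mathbf 1_{op}=u$, products converge absolutely for $r_1>\dots>r_n>0$, iterates for $r_2>r_1-r_2>0$, and $Y_{op}(u,r_1)Y_{op}(v,r_2)=Y_{op}(Y_{op}(u,r_1-r_2)v,r_2)$ for $r_1>r_2>r_1-r_2>0$. For $r>0$, $Y_{op}(v_1,-r)v_2:=e^{-rL(-1)}Y_{op}(v_2,r)v_1$. A form $(\cdot,\cdot)_{op}$ is invariant if, for $r>0$, $(v_3,Y_{op}(v_1,r)v_2)_{op}=(Y_{op}(e^{-rL(1)}r^{-2L(0)}v_1,-r^{-1})v_3,v_2)_{op}$ and $(Y_{op}(v_1,r)v_3,v_2)_{op}=(v_3,Y_{op}(e^{-rL(1)}r^{-2L(0)}v_1,-r^{-1})v_2)_{op}$. **Closed sector.** $(V_{cl},\mathbb Y,\iota_{cl})$ is a conformal full field algebra over $V\otimes V$: a $V\otimes V$-module $V_{cl}$ (finite direct sum of irreducibles; $L^L(n)=L(n)\otimes1$, $L^R(n)=1\otimes L(n)$), an injective module map $\iota_{cl}:V\otimes V\to V_{cl}$ with $\mathbf 1_{cl}=\iota_{cl}(\mathbf 1\otimes\mathbf 1)$, and an intertwining operator of $V\otimes V$ of type $\binom{V_{cl}}{V_{cl}V_{cl}}$, written with separate variables $\mathbb Y(u;x,\bar x)$ for the two chiral factors, with $\mathbb Y(\mathbf 1_{cl};x,\bar x)=\mathrm{id}$, $\lim_{z\to0}\mathbb Y(u;z,\bar z)\mathbf 1_{cl}=u$,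 $e^{2\pi i(L^L(0)-L^R(0))}=\mathrm{id}$, skew-symmetry $\mathbb Y(u;z,\bar z)v=e^{zL^L(-1)+\bar zL^R(-1)}\mathbb Y(v;e^{\pi i}z,e^{-\pi i}\bar z)u$, and (with absolute convergence) $\mathbb Y(u;z_1,\bar z_1)\mathbb Y(v;z_2,\bar z_2)=\mathbb Y(\mathbb Y(u;z_1-z_2,\bar z_1-\bar z_2)v;z_2,\bar z_2)$ for $|z_1|>|z_2|>|z_1-z_2|>0$. A form $(\cdot,\cdot)_{cl}$ is invariant if $(w_2,\mathbb Y(u;x,\bar x)w_1)_{cl}=(\mathbb Y(e^{-xL^L(1)}x^{-2L^L(0)}\otimes e^{-\bar xL^R(1)}\bar x^{-2L^R(0)}u;e^{\pi i}x^{-1},e^{-\pi i}\bar x^{-1})w_2,w_1)_{cl}$. **Open-closed field algebra over $V$.** In addition there are linear maps $\mathbb Y_{cl-op}(u;z,\bar z):V_{op}\to\overline V_{op}$, $u\in V_{cl}$, $z\in\mathbb H$, obtained by setting $\zeta=\bar z$ in maps $\mathbb Y_{cl-op}(u;z,\zeta)$ analytic in $z\in\mathbb H$ and $\zeta$ in the lower half plane, with $\mathbb Y_{cl-op}(\mathbf 1_{cl};z,\bar z)=\mathrm{id}$, the $L(-1)$-derivative properties ($\partial_z,\partial_{\bar z}$ correspond to $L^L(-1)u$, $L^R(-1)u$, and $(\partial_z+\partial_{\bar z})\mathbb Y_{cl-op}=[L(-1),\mathbb Y_{cl-op}]$) and corresponding $L(0)$-bracket property, absolutely convergent products (in order of decreasing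 modulus) and iterates, and: (i) $\mathbb Y_{cl-op}(u;z,\bar z)Y_{op}(v,r)=Y_{op}(\mathbb Y_{cl-op}(u;z-r,\bar z-r)v,r)$ for $|z|>r>|z-r|>0$; (ii) $\mathbb Y_{cl-op}(u_1;z_1,\bar z_1)\mathbb Y_{cl-op}(u_2;z_2,\bar z_2)=\mathbb Y_{cl-op}(\mathbb Y(u_1;z_1-z_2,\bar z_1-\bar z_2)u_2;z_2,\bar z_2)$ for $|z_1|>|z_2|$, $\mathrm{Im}\,z_2>|z_1-z_2|>0$; (iii) for fixed $z\in\mathbb H$, $\mathbb Y_{cl-op}(u;z,\bar z)Y_{op}(v,r)$ ($|z|>r$) and $Y_{op}(v,r)\mathbb Y_{cl-op}(u;z,\bar z)$ ($r>|z|$) are analytic continuations of each other along $r\in\mathbb R_+$; (iv) ($V$-invariant boundary condition) for $v\in V$, $\mathbb Y_{cl-op}(\iota_{cl}(v\otimes\mathbf 1);z,\bar z)$ is holomorphic in $z$, $\mathbb Y_{cl-op}(\iota_{cl}(\mathbf 1\otimes v);z,\bar z)$ is antiholomorphic, and both have the limit $Y_{op}(\iota_{op}(v),r)$ as $z\to r\in\mathbb R_+$; and $\mathbb Y_{cl-op}$ splits chirally, i.e. is given by compositions of $V$-intertwining operators in the variables $z$ and $\zeta$. *)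

(* Defs.v *)
From HB Require Import structures.
From mathcomp Require Import all_boot all_order all_algebra.
From mathcomp Require Import complex.
From mathcomp Require Import all_classical all_reals all_analysis.
Set Implicit Arguments.
Unset Strict Implicit.
Unset Printing Implicit Defensive.
Import Order.TTheory GRing.Theory Num.Theory.
Import numFieldNormedType.Exports.
Local Open Scope classical_set_scope.
Local Open Scope complex_scope.
Local Open Scope ring_scope.

Section ComplexAnalysis.
Variable R : realType.
Local Notation C := R[i].

Definition Cnorm (z : C) : R := complex.Re `|z|.

Definition Cexp (z : C) : C :=
  (expR (complex.Re z) * cos (complex.Im z)) +i*
  (expR (complex.Re z) * sin (complex.Im z)).

(* the argument in [0, 2 pi[ *)
Definition Carg (z : C) : R :=
  let t := acos (complex.Re z / Cnorm z) in
  if 0 <= complex.Im z then t else 2 * pi - t.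

Definition Clog (z : C) : C := ln (Cnorm z) +i* Carg z.

(* For zbar the branch is e^(s * conj (log z)); in terms of zeta = zbar: *)
Definition Clogbar (zeta : C) : C := (Clog zeta^*)^*.

Definition upper_half : set C := [set z | 0 < complex.Im z].
Definition lower_half : set C := [set z | complex.Im z < 0].

Definition abs_summable (I : choiceType) (f : I -> C) : Prop :=
  summable [set: I] (fun i => (Cnorm (f i))%:E).

(* [f] is absolutely summable and the net of its finite partial sums tends
   to [l] *)
Definition abs_sum (I : choiceType) (f : I -> C) (l : C) : Prop :=
  abs_summable f /\
  forall e : R, 0 < e -> exists s0 : seq I, forall s : seq I,
    uniq s -> {subset s0 <= s} -> Cnorm (\sum_(i <- s) f i - l) < e.

Definition analytic2 (D1 D2 : set C) (F : C -> C -> C) : Prop :=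
  forall z0 w0, D1 z0 -> D2 w0 ->
  exists (a : nat -> nat -> C) (rho : R), 0 < rho /\
    forall z w, Cnorm (z - z0) < rho -> Cnorm (w - w0) < rho ->
      abs_sum (fun jk : nat * nat =>
                 a jk.1 jk.2 * (z - z0) ^+ jk.1 * (w - w0) ^+ jk.2) (F z w).

Definition analytic_pos (G : R -> C) : Prop :=
  forall r0 : R, 0 < r0 -> exists (a : nat -> C) (rho : R), 0 < rho /\
    forall r, `|r - r0| < rho ->
      abs_sum (fun k : nat => a k * ((r - r0) ^+ k)%:C) (G r).

Definition holomorphic_on (D : set C) (F : C -> C) : Prop :=
  forall z : C^o, D z -> derivable (F : C^o -> C^o) z 1.

End ComplexAnalysis.

Section Gradings.
Variable R : realType.
Local Notation C := R[i].

Definition bilin (A B D : lmodType C) (f : A -> B -> D) : Prop :=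
  (forall y, linear (f^~ y)) /\ (forall x, linear (f x)).

Definition eigenvectors (W : lmodType C) (D : W -> W) (h : C) : set W :=
  [set w | D w = h *: w].

Definition finite_dim (W : lmodType C) (S : set W) : Prop :=
  exists s : seq W, forall w, S w ->
    exists c : nat -> C, w = \sum_(i < size s) c i *: s`_i.

Definition subspace (W : lmodType C) (S : set W) : Prop :=
  S 0 /\ forall (a : C) x y, S x -> S y -> S (a *: x + y).

(* W is the direct sum of the E i, with projections pr i *)
Record is_grading (I : choiceType) (W : lmodType C)
    (E : I -> set W) (pr : I -> W -> W) : Prop := {
  grad_lin : forall i, linear (pr i) ;
  grad_in : forall i w, E i (pr i w) ;
  grad_id : forall i w, E i w -> pr i w = w ;
  grad_0 : forall i j w, i != j -> E j w -> pr i w = 0 ;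
  grad_sum : forall w, exists s : seq I, uniq s /\ w = \sum_(i <- s) pr i w }.

(* The completion of W is the set of families x : I -> W with x i in the
   i-th homogeneous component. *)
Definition in_completion (I : Type) (W : lmodType C) (pr : I -> W -> W)
  (x : I -> W) : Prop := forall i, pr i (x i) = x i.

(* Extensions of a bilinear form, orthogonal with respect to the grading, to
   pairs consisting of a vector and an element of the completion. *)
Definition pair_right (I : choiceType) (W : lmodType C) (B : W -> W -> C)
  (v : W) (x : I -> W) : C := \sum_(p \in [set: I]) B v (x p).
Definition pair_left (I : choiceType) (W : lmodType C) (B : W -> W -> C)
  (x : I -> W) (v : W) : C := \sum_(p \in [set: I]) B (x p) v.

Record graded_nondegenerate_form (I : choiceType) (W : lmodType C)
    (pr : I -> W -> W) (B : W -> W -> C) : Prop := {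
  form_linl : forall y, scalar (B^~ y) ;
  form_linr : forall x, scalar (B x) ;
  form_graded : forall p q x y, p != q -> B (pr p x) (pr q y) = 0 ;
  form_ndl : forall x, (forall y, B x y = 0) -> x = 0 ;
  form_ndr : forall y, (forall x, B x y = 0) -> y = 0 }.

(* The component of T_1 T_2 ... T_n w obtained by projecting to weight
   q_i after applying T_i, where each T_i maps W to its completion. *)
Fixpoint chain (I : Type) (W : Type) (Ts : seq (W -> I -> W)) (qs : seq I)
    (w : W) : W :=
  match Ts, qs with
  | T :: Ts', q :: qs' => T (chain Ts' qs' w) q
  | _, _ => w
  end.

Definition product_converges (I : choiceType) (W : lmodType C)
    (Ts : seq (W -> I -> W)) : Prop :=
  forall (f : {scalar W}) (p : I) (w : W),
    abs_summable (fun qs : (size Ts).-1.-tuple I => f (chain Ts (p :: qs) w)).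

End Gradings.

Section VertexAlgebras.
Variable R : realType.
Local Notation C := R[i].

Definition gbinom (m : int) (i : nat) : C :=
  (\prod_(j < i) (m%:~R - j%:R)) / (i`!)%:R.

(* The Jacobi identity in component form.  [K] is the index set of the modes:
   Y w1 s w2 is the coefficient of x^(-s-1) in Y(w1, x) w2, with K = int for
   vertex operators and K = R for intertwining operators. *)
Definition jacobi (V W1 W2 W3 : lmodType C) (K : pzRingType)
    (a1 : V -> int -> W1 -> W1) (a2 : V -> int -> W2 -> W2)
    (a3 : V -> int -> W3 -> W3) (Y : W1 -> K -> W2 -> W3) : Prop :=
  forall (v : V) (w1 : W1) (w2 : W2) (l m : int) (s : K),
    \sum_(i \in [set: nat])
       gbinom m i *: Y (a1 v (l + i%:Z) w1) (m%:~R + s - i%:R) w2 =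
    \sum_(i \in [set: nat]) ((-1) ^+ i * gbinom l i) *:
      (a3 v (m + l - i%:Z) (Y w1 (s + i%:R) w2)
       - (-1) ^ l *: Y w1 (s + l%:~R - i%:R) (a2 v (m + i%:Z) w2)).

(* vmode a n b is a_n b, where Y(a, x) = \sum_n a_n x^(-n-1) *)
Record VOA := MkVOA {
  vcar :> lmodType C ;
  vmode : vcar -> int -> vcar -> vcar ;
  vac : vcar ;
  conf : vcar ;
  ccharge : C ;
  vL := fun (n : int) (a : vcar) => vmode conf (n + 1) a ;
  vmode_bilin : forall n, bilin (fun a b => vmode a n b) ;
  vmode_trunc : forall a b, exists N : int, forall n, N <= n -> vmode a n b = 0 ;
  vmode_vac : forall n b, vmode vac n b = if n == -1 then b else 0 ;
  vmode_creation0 : forall a (n : int), 0 <= n -> vmode a n vac = 0 ;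
  vmode_creation : forall a, vmode a (-1) vac = a ;
  vmode_jacobi : jacobi vmode vmode vmode vmode ;
  vmode_virasoro : forall (m n : int) (a : vcar),
    vL m (vL n a) - vL n (vL m a) =
    (m - n)%:~R *: vL (m + n) a +
    (if m + n == 0 then (m ^+ 3 - m)%:~R / 12%:R * ccharge else 0) *: a ;
  vmode_deriv : forall a (n : int) b,
    vmode (vL (-1) a) n b = - n%:~R *: vmode a (n - 1) b ;
  vmode_graded : forall a, exists s : seq vcar, a = \sum_(x <- s) x /\
    forall x, x \in s -> exists h : int, eigenvectors (vL 0) h%:~R x ;
  vmode_findim : forall h : int, finite_dim (eigenvectors (vL 0) h%:~R) ;
  vmode_bounded : exists N : int, forall (h : int) a,
    h < N -> eigenvectors (vL 0) h%:~R a -> a = 0 }.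

Record is_weak_module (V : VOA) (W : lmodType C) (act : V -> int -> W -> W)
    : Prop := {
  wm_bilin : forall n, bilin (fun v w => act v n w) ;
  wm_trunc : forall v w, exists N : int, forall n, N <= n -> act v n w = 0 ;
  wm_vac : forall n w, act (vac V) n w = if n == -1 then w else 0 ;
  wm_jacobi : jacobi (@vmode V) act act act }.

Definition submodule (V W : lmodType C) (act : V -> int -> W -> W)
    (S : set W) : Prop :=
  subspace S /\ forall v n w, S w -> S (act v n w).

Definition irreducible_submodule (V W : lmodType C) (act : V -> int -> W -> W)
    (S : set W) : Prop :=
  [/\ submodule act S, S <> [set 0]
    & forall S' : set W, submodule act S' -> S' `<=` S ->
        S' = [set 0] \/ S' = S].

Definition completely_reducible (V W : lmodType C) (act : V -> int -> W -> W)
    : Prop :=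
  exists (I : choiceType) (S : I -> set W) (pr : I -> W -> W),
    is_grading S pr /\ forall i, irreducible_submodule act (S i).

Definition finite_sum_of_irreducibles (V W : lmodType C)
    (act : V -> int -> W -> W) : Prop :=
  exists (k : nat) (S : 'I_k -> set W) (pr : 'I_k -> W -> W),
    is_grading S pr /\ forall i, irreducible_submodule act (S i).

Definition N_gradable (V : VOA) (W : lmodType C) (act : V -> int -> W -> W)
    : Prop :=
  exists (E : nat -> set W) (pr : nat -> W -> W), is_grading E pr /\
    forall (v : V) (h m : int) (k : nat) (w : W),
      eigenvectors (vL (v:=V) 0) h%:~R v -> E k w ->
      (k%:Z + h - m - 1 < 0 -> act v m w = 0) /\
      (forall k' : nat, k%:Z + h - m - 1 = k'%:Z -> E k' (act v m w)).

(* The graded dual V' consists of the linear forms vanishing on all but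
   finitely many V_(n). *)
Definition in_graded_dual (V : VOA) (f : V -> C) : Prop :=
  scalar f /\ exists s : seq int, forall (h : int) (x : V),
    h \notin s -> eigenvectors (vL (v:=V) 0) h%:~R x -> f x = 0.

(* For v of weight h, the coefficient of x^(-n-1) in the contragredient action
   <Y'(v, x) f, w> = <f, Y(e^(x L(1)) (-x^(-2))^L(0) v, x^(-1)) w>. *)
Definition contragredient (V : VOA) (h : int) (v : V) (n : int) (f : V -> C)
    (w : V) : C :=
  (-1) ^ h * \sum_(k \in [set: nat])
    ((k`!)%:R^-1 * f (vmode (iter k (vL (v:=V) 1) v) (2 * h - n - 2 - k%:Z) w)).

Definition isomorphic_to_contragredient (V : VOA) : Prop :=
  exists theta : V -> V -> C,
  [/\ forall x, scalar (theta^~ x),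
      forall a, in_graded_dual (theta a),
      forall a, (forall x, theta a x = 0) -> a = 0,
      forall f : V -> C, in_graded_dual f -> exists a, theta a = f
    & forall (h : int) (v : V) (n : int) (a x : V),
        eigenvectors (vL (v:=V) 0) h%:~R v ->
        theta (vmode v n a) x = contragredient h v n (theta a) x].

Definition C2_cofinite (V : VOA) : Prop :=
  exists s : seq V, forall a : V, exists (c : nat -> C) (t : seq (V * V)),
    a = \sum_(i < size s) c i *: s`_i + \sum_(x <- t) vmode x.1 (-2) x.2.

Record standing_assumption (V : VOA) : Prop := {
  V_simple : irreducible_submodule (@vmode V) [set: V] ;
  V_C2 : C2_cofinite V ;
  V_nonneg : forall (h : int) (a : V),
    h < 0 -> eigenvectors (vL (v:=V) 0) h%:~R a -> a = 0 ;
  V_weight0 : forall a : V, vL (v:=V) 0 a = 0 <-> exists c : C, a = c *: vac V ;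
  V_selfdual : isomorphic_to_contragredient V ;
  V_rational : forall (W : lmodType C) (act : V -> int -> W -> W),
    is_weak_module act -> N_gradable act -> completely_reducible act }.

Record vmodule (V : VOA) := MkModule {
  mcar :> lmodType C ;
  mact : V -> int -> mcar -> mcar ;
  mL := fun (n : int) (w : mcar) => mact (conf V) (n + 1) w ;
  mpr : R -> mcar -> mcar ;
  m_weak : is_weak_module mact ;
  m_deriv : forall v (n : int) w,
    mact (vL (v:=V) (-1) v) n w = - n%:~R *: mact v (n - 1) w ;
  m_grading : is_grading (fun h : R => eigenvectors (mL 0) h%:C) mpr ;
  m_findim : forall h : R, finite_dim (eigenvectors (mL 0) h%:C) ;
  m_bounded : exists N : R, forall h w, h < N -> mpr h w = 0 }.

(* Y w1 s w2 is the coefficient of x^(-s-1) in Y(w1, x) w2 *)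
Record is_intertwining (V : VOA) (W1 W2 W3 : vmodule V)
    (Y : W1 -> R -> W2 -> W3) : Prop := {
  io_bilin : forall s, bilin (fun w1 w2 => Y w1 s w2) ;
  io_trunc : forall w1 w2 s, exists N : nat, forall n : nat,
    (N <= n)%N -> Y w1 (s + n%:R) w2 = 0 ;
  io_jacobi : jacobi (@mact V W1) (@mact V W2) (@mact V W3) Y ;
  io_deriv : forall w1 s w2,
    Y (mL (-1) w1) s w2 = - s%:C *: Y w1 (s - 1) w2 }.

(* Y(w1, x) w2 at log x = l, as an element of the completion of W3 *)
Definition io_eval (I : Type) (W1 W2 W3 : lmodType C) (pr : I -> W3 -> W3)
    (Y : W1 -> R -> W2 -> W3) (w1 : W1) (l : C) (w2 : W2) : I -> W3 :=
  fun p => \sum_(s \in [set: R]) Cexp ((- s - 1)%:C * l) *: pr p (Y w1 s w2).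

(* T with tau : V x V -> T is the tensor product vertex operator algebra of
   V with itself; tau a b stands for the tensor of a and b. *)
Record is_tensor_square (V T : VOA) (tau : V -> V -> T) : Prop := {
  ts_bilin : bilin tau ;
  ts_univ : forall (X : lmodType C) (g : V -> V -> X), bilin g ->
    exists2 h : {linear T -> X}, forall a b, h (tau a b) = g a b
      & forall h' : {linear T -> X},
          (forall a b, h' (tau a b) = g a b) -> h' =1 h ;
  ts_mode : forall a b (n : int) a' b',
    vmode (tau a b) n (tau a' b') =
    \sum_(i \in [set: int]) tau (vmode a i a') (vmode b (n - 1 - i) b') ;
  ts_vac : vac T = tau (vac V) (vac V) ;
  ts_conf : conf T = tau (conf V) (vac V) + tau (vac V) (conf V) ;
  ts_charge : ccharge T = ccharge V + ccharge V }.

(* On the completion; L(-1) raises weights by 1, and each sum is finite since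
   the weights are bounded below. *)
Definition exp_Lm1 (V : VOA) (W : vmodule V) (a : C) (x : R -> W) : R -> W :=
  fun p => \sum_(k \in [set: nat])
    (a ^+ k / (k`!)%:R) *: iter k (mL (-1)) (x (p - k%:R)).

Definition exp_L1 (V : VOA) (W : vmodule V) (a : C) (w : W) : W :=
  \sum_(k \in [set: nat]) (a ^+ k / (k`!)%:R) *: iter k (mL 1) w.

Definition exp_L0 (V : VOA) (W : vmodule V) (l : C) (w : W) : W :=
  \sum_(h \in [set: R]) Cexp (h%:C * l) *: mpr h w.

(* Y_op(u, r) w for r > 0 *)
Definition Yop_of (V : VOA) (W : vmodule V) (Yf : W -> R -> W -> W)
    (u : W) (r : R) (w : W) : R -> W :=
  io_eval (@mpr V W) Yf u (ln r)%:C w.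

(* Y_op(u, -r) w for r > 0 *)
Definition Yopneg_of (V : VOA) (W : vmodule V) (Yf : W -> R -> W -> W)
    (u : W) (r : R) (w : W) : R -> W :=
  exp_Lm1 (- r)%:C (Yop_of Yf w r u).

Record open_string_VOA (V : VOA) := MkOpen {
  op :> vmodule V ;
  op_iota : V -> op ;
  op_Yf : op -> R -> op -> op ;
  op_one := op_iota (vac V) ;
  op_omega := op_iota (conf V) ;
  Yop := Yop_of op_Yf ;
  op_iota_lin : linear op_iota ;
  op_iota_mod : forall v n w, op_iota (vmode v n w) = mact v n (op_iota w) ;
  op_io : is_intertwining op_Yf ;
  op_Yf_iota_int : forall v (n : int) w,
    op_Yf (op_iota v) n%:~R w = mact v n w ;
  op_Yf_iota_nonint : forall v (s : R) w,
    (forall n : int, s <> n%:~R) -> op_Yf (op_iota v) s w = 0 ;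
  op_creation : forall (u : op) (f : {scalar op}) (p : R),
    (fun r : R => f (Yop u r op_one p) : C^o) @ 0^'+ --> (f (mpr p u) : C^o) ;
  op_products : forall us : seq (op * R),
    all (fun x => 0 < x.2) us -> sorted (fun x y => y.2 < x.2) us ->
    product_converges [seq Yop x.1 x.2 | x <- us] ;
  op_iterates : forall (u v w : op) (r0 r2 : R) (f : {scalar op}) (p : R),
    0 < r0 -> r0 < r2 ->
    abs_summable (fun q : R => f (Yop (Yop u r0 v q) r2 w p)) ;
  op_assoc : forall (u v w : op) (r1 r2 : R) (f : {scalar op}) (p : R),
    0 < r1 - r2 -> r1 - r2 < r2 -> r2 < r1 ->
    exists l : C,
      abs_sum (fun q : R => f (Yop u r1 (Yop v r2 w q) p)) l /\
      abs_sum (fun q : R => f (Yop (Yop u (r1 - r2) v q) r2 w p)) l }.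

(* e^(-r L(1)) r^(-2 L(0)) u *)
Definition op_flip (V : VOA) (W : vmodule V) (r : R) (u : W) : W :=
  exp_L1 (- r)%:C (exp_L0 (- 2 * ln r)%:C u).

Record invariant_form_op (V : VOA) (A : open_string_VOA V)
    (B : A -> A -> C) : Prop := {
  opf_form : graded_nondegenerate_form (@mpr V A) B ;
  opf_inv1 : forall (r : R) (v1 v2 v3 : A), 0 < r ->
    pair_right B v3 (Yop v1 r v2) =
    pair_left B (Yopneg_of (@op_Yf V A) (op_flip r v1) r^-1 v3) v2 ;
  opf_inv2 : forall (r : R) (v1 v2 v3 : A), 0 < r ->
    pair_left B (Yop v1 r v3) v2 =
    pair_right B v3 (Yopneg_of (@op_Yf V A) (op_flip r v1) r^-1 v2) }.

Section Closed.
Variables (V T : VOA) (tau : V -> V -> T).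

Definition LL (W : vmodule T) (n : int) (w : W) : W :=
  mact (tau (conf V) (vac V)) (n + 1) w.
Definition LR (W : vmodule T) (n : int) (w : W) : W :=
  mact (tau (vac V) (conf V)) (n + 1) w.

Definition biweight (W : vmodule T) (p : R * R) : set W :=
  eigenvectors (@LL W 0) p.1%:C `&` eigenvectors (@LR W 0) p.2%:C.

(* e^(l L^L(0) + l' L^R(0)) *)
Definition exp_LL0_LR0 (W : vmodule T) (pr : R * R -> W -> W) (l l' : C) (w : W)
    : W :=
  \sum_(p \in [set: R * R]) Cexp (p.1%:C * l + p.2%:C * l') *: pr p w.

(* e^(a L^L(1)) e^(a' L^R(1)) *)
Definition exp_LL1_LR1 (W : vmodule T) (a a' : C) (w : W) : W :=
  \sum_(jk \in [set: nat * nat])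
    (a ^+ jk.1 / (jk.1`!)%:R * (a' ^+ jk.2 / (jk.2`!)%:R)) *:
    iter jk.1 (@LL W 1) (iter jk.2 (@LR W 1) w).

(* e^(a L^L(-1)) e^(a' L^R(-1)) on the completion *)
Definition exp_LLm1_LRm1 (W : vmodule T) (a a' : C) (x : R * R -> W)
    : R * R -> W :=
  fun p => \sum_(jk \in [set: nat * nat])
    (a ^+ jk.1 / (jk.1`!)%:R * (a' ^+ jk.2 / (jk.2`!)%:R)) *:
    iter jk.1 (@LL W (-1)) (iter jk.2 (@LR W (-1))
      (x (p.1 - jk.1%:R, p.2 - jk.2%:R))).

(* L^L(n) and L^R(n) lower the first, resp. the second, weight by n. *)
Definition LLhat (W : vmodule T) (n : int) (x : R * R -> W) : R * R -> W :=
  fun p => LL n (x (p.1 + n%:~R, p.2)).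
Definition LRhat (W : vmodule T) (n : int) (x : R * R -> W) : R * R -> W :=
  fun p => LR n (x (p.1, p.2 + n%:~R)).

(* The operator with separated variables, at log x = l and log xbar = l', given by
     x^(L^L(0)) xbar^(L^R(0)) Y(x^(-L^L(0)) xbar^(-L^R(0)) u, 1)
       x^(-L^L(0)) xbar^(-L^R(0)). *)
Definition YY_of (W : vmodule T) (pr : R * R -> W -> W) (Y : W -> R -> W -> W)
    (u : W) (l l' : C) (w : W) : R * R -> W :=
  fun p => Cexp (p.1%:C * l + p.2%:C * l') *:
    io_eval pr Y (exp_LL0_LR0 pr (- l) (- l') u) 0
      (exp_LL0_LR0 pr (- l) (- l') w) p.

Definition pi_i : C := 0 +i* pi.

Record full_field_algebra := MkClosed {
  cl :> vmodule T ;
  cl_irr : finite_sum_of_irreducibles (@mact T cl) ;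
  cl_pr : R * R -> cl -> cl ;
  cl_grading : is_grading (@biweight cl) cl_pr ;
  cl_bounded : exists N : R, forall p w,
    p.1 < N \/ p.2 < N -> cl_pr p w = 0 ;
  cl_iota : T -> cl ;
  cl_one := cl_iota (vac T) ;
  cl_Y : cl -> R -> cl -> cl ;
  YYlog := YY_of cl_pr cl_Y ;
  (* the value at (z, zbar) *)
  YY := fun (u : cl) (z : C) (w : cl) => YYlog u (Clog z) (Clog z)^* w ;
  cl_iota_lin : linear cl_iota ;
  cl_iota_inj : injective cl_iota ;
  cl_iota_mod : forall v n w, cl_iota (vmode v n w) = mact v n (cl_iota w) ;
  cl_io : is_intertwining cl_Y ;
  cl_identity : forall l l' w p, YYlog cl_one l l' w p = cl_pr p w ;
  cl_creation : forall (u : cl) (f : {scalar cl}) (p : R * R),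
    (fun z : C^o => f (YY u z cl_one p) : C^o) @ 0^' --> (f (cl_pr p u) : C^o) ;
  cl_single_valued : forall w,
    exp_LL0_LR0 cl_pr (2 * pi_i) (- (2 * pi_i)) w = w ;
  cl_skew : forall (u v : cl) (z : C) (p : R * R), z != 0 ->
    YY u z v p =
    exp_LLm1_LRm1 z z^* (YYlog v (Clog z + pi_i) ((Clog z)^* - pi_i) u) p ;
  cl_assoc : forall (u v w : cl) (z1 z2 : C) (f : {scalar cl}) (p : R * R),
    0 < Cnorm (z1 - z2) -> Cnorm (z1 - z2) < Cnorm z2 ->
    Cnorm z2 < Cnorm z1 ->
    exists l : C,
      abs_sum (fun q : R * R => f (YY u z1 (YY v z2 w q) p)) l /\
      abs_sum (fun q : R * R => f (YY (YY u (z1 - z2) v q) z2 w p)) l }.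

(* e^(-x L^L(1)) x^(-2 L^L(0)) (x) e^(-xbar L^R(1)) xbar^(-2 L^R(0)) u,
   at log x = l and log xbar = l' *)
Definition cl_flip (A : full_field_algebra) (l l' : C) (u : A) : A :=
  exp_LL1_LR1 (- Cexp l) (- Cexp l')
    (exp_LL0_LR0 (@cl_pr A) (- 2 * l) (- 2 * l') u).

Record invariant_form_cl (A : full_field_algebra) (B : A -> A -> C)
    : Prop := {
  clf_form : graded_nondegenerate_form (@cl_pr A) B ;
  clf_inv : forall (l l' : C) (u w1 w2 : A),
    pair_right B w2 (YYlog u l l' w1) =
    pair_left B (YYlog (cl_flip l l' u) (pi_i - l) (- pi_i - l') w2) w1 }.

(* Yco u z zeta is given, for u running over tensors of vectors in V-modules
   that span V_cl, by compositions of V-intertwining operators: the composition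
   converges for |z| > |zeta|, and Yco is its analytic continuation. *)
Definition splits_chirally (A : open_string_VOA V) (D : full_field_algebra)
    (Yco : D -> C -> C -> A -> R -> A) : Prop :=
  exists (k : nat) (WL WR M : 'I_k -> vmodule V)
    (t : forall i, WL i -> WR i -> D)
    (Y1 : forall i, WL i -> R -> M i -> A)
    (Y2 : forall i, WR i -> R -> A -> M i),
  [/\ forall i, bilin (@t i),
      forall i v n a b,
        mact (tau v (vac V)) n (t i a b) = t i (mact v n a) b /\
        mact (tau (vac V) v) n (t i a b) = t i a (mact v n b),
      forall u : D, exists s : seq {i : 'I_k & (WL i * WR i)%type},
        u = \sum_(x <- s) t (tag x) (tagged x).1 (tagged x).2,
      forall i, is_intertwining (@Y1 i) /\ is_intertwining (@Y2 i)
    & forall i a b (w : A) (z zeta : C) (f : {scalar A}) (p : R),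
        upper_half z -> lower_half zeta -> Cnorm zeta < Cnorm z ->
        abs_sum (fun q : R =>
            f (io_eval (@mpr V A) (@Y1 i) a (Clog z)
                 (io_eval (@mpr V (M i)) (@Y2 i) b (Clogbar zeta) w q) p))
          (f (Yco (t i a b) z zeta w p))].

Record open_closed_field_algebra := MkOC {
  oc_op : open_string_VOA V ;
  oc_cl : full_field_algebra ;
  Yco : oc_cl -> C -> C -> oc_op -> R -> oc_op ;
  (* the value at (z, zbar) *)
  Yclop := fun (u : oc_cl) (z : C) => Yco u z z^* ;
  oc_compl : forall u z zeta w,
    upper_half z -> lower_half zeta ->
    in_completion (@mpr V oc_op) (Yco u z zeta w) ;
  oc_bilin : forall z zeta p, upper_half z -> lower_half zeta ->
    bilin (fun u w => Yco u z zeta w p) ;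
  oc_analytic : forall u w (f : {scalar oc_op}) p,
    analytic2 (@upper_half R) (@lower_half R)
      (fun z zeta => f (Yco u z zeta w p)) ;
  oc_identity : forall z w p, upper_half z ->
    Yclop (cl_one oc_cl) z w p = mpr p w ;
  oc_deriv_z : forall u (z zeta : C^o) w (f : {scalar oc_op}) p,
    upper_half z -> lower_half zeta ->
    is_derive z 1 (fun y : C^o => f (Yco u y zeta w p) : C^o)
      (f (Yco (LL (-1) u) z zeta w p)) ;
  oc_deriv_zeta : forall u (z zeta : C^o) w (f : {scalar oc_op}) p,
    upper_half z -> lower_half zeta ->
    is_derive zeta 1 (fun y : C^o => f (Yco u z y w p) : C^o)
      (f (Yco (LR (-1) u) z zeta w p)) ;
  (* the L(-1)- and L(0)-brackets, with the z- and zeta-derivatives expressed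
     through L^L(-1) and L^R(-1) *)
  oc_Lm1_bracket : forall u z zeta w p, upper_half z -> lower_half zeta ->
    mL (-1) (Yco u z zeta w (p - 1)) - Yco u z zeta (mL (-1) w) p =
    Yco (LL (-1) u) z zeta w p + Yco (LR (-1) u) z zeta w p ;
  oc_L0_bracket : forall u z zeta w p, upper_half z -> lower_half zeta ->
    mL 0 (Yco u z zeta w p) - Yco u z zeta (mL 0 w) p =
    Yco (LL 0 u + LR 0 u + z *: LL (-1) u + zeta *: LR (-1) u) z zeta w p ;
  oc_products : forall us : seq ((oc_op * R) + (oc_cl * C)),
    let modulus (x : (oc_op * R) + (oc_cl * C)) :=
      match x with inl y => y.2 | inr y => Cnorm y.2 end in
    let operator (x : (oc_op * R) + (oc_cl * C)) :=
      match x with inl y => Yop y.1 y.2 | inr y => Yclop y.1 y.2 end in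
    all (fun x => match x with
                  | inl y => 0 < y.2
                  | inr y => 0 < complex.Im y.2 end) us ->
    sorted (fun x y => modulus y < modulus x) us ->
    product_converges (map operator us) ;
  oc_iterates_op : forall (u : oc_cl) (v w : oc_op) (z : C) (r : R)
      (f : {scalar oc_op}) (p : R),
    upper_half z -> 0 < Cnorm z -> Cnorm z < r ->
    abs_summable (fun q : R => f (Yop (Yclop u z v q) r w p)) ;
  oc_iterates_cl : forall (u1 u2 : oc_cl) (w : oc_op) (z0 z2 : C)
      (f : {scalar oc_op}) (p : R),
    0 < Cnorm z0 -> Cnorm z0 < complex.Im z2 ->
    abs_summable (fun q : R * R => f (Yclop (YY u1 z0 u2 q) z2 w p)) ;
  oc_assoc_op : forall (u : oc_cl) (v w : oc_op) (z : C) (r : R)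
      (f : {scalar oc_op}) (p : R),
    upper_half z -> 0 < Cnorm (z - r%:C) -> Cnorm (z - r%:C) < r ->
    r < Cnorm z ->
    exists l : C,
      abs_sum (fun q : R => f (Yclop u z (Yop v r w q) p)) l /\
      abs_sum (fun q : R => f (Yop (Yclop u (z - r%:C) v q) r w p)) l ;
  oc_assoc_cl : forall (u1 u2 : oc_cl) (w : oc_op) (z1 z2 : C)
      (f : {scalar oc_op}) (p : R),
    upper_half z1 -> upper_half z2 -> Cnorm z2 < Cnorm z1 ->
    0 < Cnorm (z1 - z2) -> Cnorm (z1 - z2) < complex.Im z2 ->
    exists l : C,
      abs_sum (fun q : R => f (Yclop u1 z1 (Yclop u2 z2 w q) p)) l /\
      abs_sum (fun q : R * R => f (Yclop (YY u1 (z1 - z2) u2 q) z2 w p)) l ;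
  oc_commut : forall (u : oc_cl) (v w : oc_op) (z : C)
      (f : {scalar oc_op}) (p : R),
    upper_half z ->
    exists G : R -> C,
    [/\ analytic_pos G,
        forall r : R, 0 < r -> r < Cnorm z ->
          abs_sum (fun q : R => f (Yclop u z (Yop v r w q) p)) (G r)
      & forall r : R, Cnorm z < r ->
          abs_sum (fun q : R => f (Yop v r (Yclop u z w q) p)) (G r)] ;
  oc_bdry_hol : forall (v : V) (w : oc_op) (f : {scalar oc_op}) (p : R),
    holomorphic_on (@upper_half R)
      (fun z => f (Yclop (cl_iota oc_cl (tau v (vac V))) z w p)) ;
  (* antiholomorphic: the complex conjugate is holomorphic *)
  oc_bdry_antihol : forall (v : V) (w : oc_op) (f : {scalar oc_op}) (p : R),
    holomorphic_on (@upper_half R)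
      (fun z => (f (Yclop (cl_iota oc_cl (tau (vac V) v)) z w p))^*) ;
  oc_bdry_lim_L : forall (v : V) (w : oc_op) (f : {scalar oc_op}) (p r : R),
    0 < r ->
    (fun z : C^o => f (Yclop (cl_iota oc_cl (tau v (vac V))) z w p) : C^o)
      @ within (@upper_half R) (nbhs (r%:C : C^o))
      --> (f (Yop (op_iota oc_op v) r w p) : C^o) ;
  oc_bdry_lim_R : forall (v : V) (w : oc_op) (f : {scalar oc_op}) (p r : R),
    0 < r ->
    (fun z : C^o => f (Yclop (cl_iota oc_cl (tau (vac V) v)) z w p) : C^o)
      @ within (@upper_half R) (nbhs (r%:C : C^o))
      --> (f (Yop (op_iota oc_op v) r w p) : C^o) ;
  oc_chiral : splits_chirally Yco }.

Definition iota_clop (A : open_closed_field_algebra) (z : C) (u : oc_cl A)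
    : R -> oc_op A := Yclop u z (op_one (oc_op A)).

(* istar z is the adjoint of iota_clop z, with values in the completion *)
Definition is_iota_clop_adjoint (A : open_closed_field_algebra)
    (Bop : oc_op A -> oc_op A -> C) (Bcl : oc_cl A -> oc_cl A -> C)
    (istar : C -> oc_op A -> R * R -> oc_cl A) : Prop :=
  forall (z : C) (w : oc_op A), upper_half z ->
    in_completion (@cl_pr (oc_cl A)) (istar z w) /\
    forall u : oc_cl A,
      pair_left Bcl (istar z w) u = pair_right Bop w (iota_clop z u).

(* e^(L(-1)) (zbar0 - z0)^(L(0)) (x) e^(L(-1)) conj(zbar0 - z0)^(L(0))
   applied to b in the completion of V_cl *)
Definition boundary_transport (A : open_closed_field_algebra) (z0 : C)
    (b : R * R -> oc_cl A) : R * R -> oc_cl A :=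
  let l := Clog (z0^* - z0) in
  exp_LLm1_LRm1 1 1 (fun p => Cexp (p.1%:C * l + p.2%:C * l^*) *: b p).

Definition ishibashi (A : open_closed_field_algebra) (b : R * R -> oc_cl A)
    : Prop :=
  forall (n : int) (p : R * R), LLhat n b p - LRhat (- n) b p = 0.

End Closed.
End VertexAlgebras.

(* Main.v *)
Require Import Defs.
From HB Require Import structures.
From mathcomp Require Import all_boot all_order all_algebra.
From mathcomp Require Import complex ring lra zify.
From mathcomp Require Import all_classical all_reals all_analysis.
Set Implicit Arguments.
Unset Strict Implicit.
Unset Printing Implicit Defensive.
Import Order.TTheory GRing.Theory Num.Theory.
Import numFieldNormedType.Exports.
Local Open Scope classical_set_scope.
Local Open Scope complex_scope.
Local Open Scope ring_scope.

(** A vacuum-like vector [u] satisfies [v_n u = 0] for all [v] and [n >= 0]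
    (lemma [vacuum_like]).  In particular it has weight 0, and by invariance of
    the form [(u, L(n) x) = 0] for all [n <= 1] (lemma [vacuum_like_orth]).  So in
    the correlator [phi(w) = (u, Y(w; z0, zeta) 1)], with [zeta] the conjugate of
    [z0], the stress tensor is a meromorphic quadratic differential on the whole
    sphere: it is regular at infinity because of [u], at the origin because of
    the vacuum, and its poles are at [z0], where its modes act on [w] through
    [L^L], and at [zeta], where they act through [L^R].  By the residue theorem
    every rational vector field with poles at [z0] and [zeta] only, and growth at
    most [x^2] at infinity, gives a linear relation (a Ward identity) between the
    values of [phi] on [L^L(m) w] and [L^R(n) w].  The Ishibashi condition of index
    [n] is, by adjunction, the Ward identity of the field
    [(x - z0)^(1 - n) (x - zeta)^(1 + n)], up to a factor.

    Five fields suffice.  The Ishibashi operators [L^L(n) - L^R(-n)] span a Lie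
    algebra without central term, generated by the indices 1, 2 and -2
    ([balanced_all]).  These three cases only involve [1], [x] and [x^2], and
    the fields [1 / (x - z0)] and [1 / (x - zeta)] with a simple pole
    ([glued_1] and [glued_m2]).

    The relations of [1] and [x] are the [L(-1)]- and [L(0)]-brackets.  The three
    others come from the chiral splitting: for [|z| > |zeta|] the correlator is a
    sum, over intermediate weights, of products of two intertwining operators,
    whose Jacobi identities give the relation of [x^2] weight by weight.  For the
    fields with a pole the Jacobi identities produce a double sum, over the
    weights and over the powers of [zeta / z], which is the product of the
    correlator with the binomial series of [(z - zeta)^(- k - 1)]
    ([net_sum_conv]).  The case [|z| = |zeta|] follows by continuity in [z].

    On the closed side, [Y(iota(v), x)] is computed from the field of the vacuum
    ([cl_Y_one]), so that invariance makes [(-1)^n L(-n)] the adjoint of [L(n)]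
    for both chiralities ([Bcl_adjoint]).  The exponentials of [L(-1)] in the
    boundary state become exponentials of [- L(1)], which conjugate each
    [L(m)] into a binomial combination of the modes [L(m + k)] ([exp_conj]), and
    the powers [(zeta - z0)^L(0)] rescale the Ward identities to a form that is
    symmetric in the two chiralities ([glued]). *)

(** * Linear maps and finitely supported sums *)

Section LinearMaps.
Variables (K : nzRingType) (U W : lmodType K) (f : U -> W).
Hypothesis hf : linear f.

Lemma lin0 : f 0 = 0.
Proof. by have := hf (-1) 0 0; rewrite scaler0 addr0 scaleN1r addNr. Qed.

Lemma linD x y : f (x + y) = f x + f y.
Proof. by have := hf 1 x y; rewrite !scale1r. Qed.

Lemma linZ a x : f (a *: x) = a *: f x.
Proof. by have := hf a x 0; rewrite !addr0 lin0 addr0. Qed.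

Lemma linN x : f (- x) = - f x.
Proof. by rewrite -scaleN1r linZ scaleN1r. Qed.

Lemma linB x y : f (x - y) = f x - f y.
Proof. by rewrite linD linN. Qed.

Lemma lin_sum (I : Type) (r : seq I) (P : pred I) (F : I -> U) :
  f (\sum_(i <- r | P i) F i) = \sum_(i <- r | P i) f (F i).
Proof. exact: (big_morph f linD lin0). Qed.
End LinearMaps.

Lemma iter_lin0 (K : nzRingType) (U : lmodType K) (f : U -> U) (k : nat) :
  linear f -> iter k f 0 = 0.
Proof. by move=> hf; elim: k => //= k ->; exact: lin0. Qed.

Lemma iter_lin (K : nzRingType) (U : lmodType K) (f : U -> U) (k : nat) :
  linear f -> linear (iter k f).
Proof. by move=> hf a x y; elim: k => //= k ->; exact: hf. Qed.

Section FiniteSupport.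
Variables (I : choiceType) (W : nmodType).
Implicit Types F : I -> W.

Lemma fsum_seq F (s : seq I) : uniq s -> (forall i, i \notin s -> F i = 0) ->
  \sum_(i \in [set: I]) F i = \sum_(i <- s) F i.
Proof.
move=> us F0; rewrite (fsbig_seq _ _ us); apply: esym.
apply: fsbig_widen => // i [_]; rewrite /preimage /= => /negP si.
exact: F0.
Qed.

Lemma fsum_one F i0 : (forall i, i != i0 -> F i = 0) ->
  \sum_(i \in [set: I]) F i = F i0.
Proof.
move=> F0; rewrite (@fsum_seq _ [:: i0]) ?big_seq1// => i.
by rewrite inE => /F0.
Qed.

Lemma fsum_zero F : (forall i, F i = 0) -> \sum_(i \in [set: I]) F i = 0.
Proof. by move=> F0; rewrite fsbig1// => i _; apply: F0. Qed.
End FiniteSupport.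

Lemma sum_iota (W : nmodType) (F : nat -> W) (N : nat) :
  \sum_(i <- iota 0 N) F i = \sum_(i < N) F i.
Proof. by rewrite -(big_mkord xpredT F) /index_iota subn0. Qed.

Lemma fsum_nat (W : nmodType) (F : nat -> W) (N : nat) :
  (forall i, (N <= i)%N -> F i = 0) ->
  \sum_(i \in [set: nat]) F i = \sum_(i < N) F i.
Proof.
move=> F0; rewrite (@fsum_seq _ _ F (iota 0 N)) ?iota_uniq ?sum_iota// => i.
by rewrite mem_iota add0n/= -leqNgt; exact: F0.
Qed.

Lemma fsum_nat2 (W : nmodType) (F : nat * nat -> W) (N : nat) :
  (forall j k, (N <= j)%N \/ (N <= k)%N -> F (j, k) = 0) ->
  \sum_(jk \in [set: nat * nat]) F jk =
  \sum_(j < N) \sum_(k < N) F (nat_of_ord j, nat_of_ord k).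
Proof.
move=> F0; rewrite (@fsum_seq _ _ F [seq (j, k) | j <- iota 0 N, k <- iota 0 N]).
- rewrite big_allpairs sum_iota; apply: eq_bigr => j _.
  exact: (sum_iota (fun k => F (nat_of_ord j, k))).
- by apply: allpairs_uniq; rewrite ?iota_uniq// => -[? ?] [? ?] _ _ [-> ->].
- move=> [j k] jk; apply: F0; apply/orP; apply: contraR jk.
  rewrite negb_or -!ltnNge => /andP[jN kN].
  by apply/allpairsP; exists (j, k); rewrite !mem_iota/= !add0n jN kN.
Qed.

Lemma sum_ord_widen (W : nmodType) (F : nat -> W) (M N : nat) :
  (M <= N)%N -> (forall i, (M <= i)%N -> F i = 0) ->
  \sum_(i < N) F i = \sum_(i < M) F i.
Proof.
move=> MN F0; rewrite -!(big_mkord xpredT F) (big_cat_nat (leq0n M) MN)/=.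
rewrite [X in _ + X]big_nat_cond [X in _ + X]big1 ?addr0// => i.
by rewrite andbT => /andP[/F0].
Qed.

Lemma sum_ord_drop (W : nmodType) (F : nat -> W) (k N : nat) :
  (forall i, (i < k)%N -> F i = 0) ->
  \sum_(i < k + N) F i = \sum_(j < N) F (j + k)%N.
Proof.
move=> F0; rewrite big_split_ord/= big1 ?add0r; last by move=> i _; exact: F0.
by apply: eq_bigr => j _; rewrite addnC.
Qed.

(** * Properties of all large integers *)

Lemma near_and (P Q : nat -> Prop) : (exists N0, forall N, (N0 <= N)%N -> P N) ->
  (exists N0, forall N, (N0 <= N)%N -> Q N) ->
  exists N0, forall N, (N0 <= N)%N -> P N /\ Q N.
Proof.
move=> [N1 h1] [N2 h2]; exists (maxn N1 N2) => N.
by rewrite geq_max => /andP[/h1 a /h2 b].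
Qed.

Lemma unif_bound (P : nat -> nat -> Prop) (K : nat) :
  (forall k, exists N, forall n, (N <= n)%N -> P k n) ->
  exists N, forall k, (k < K)%N -> forall n, (N <= n)%N -> P k n.
Proof.
move=> hP; elim: K => [|K [N1 h1]]; first by exists 0%N.
have [N2 h2] := hP K; exists (maxn N1 N2) => k; rewrite ltnS leq_eqVlt.
case/predU1P => [->|kK] n; rewrite geq_max => /andP[a b]; first exact: h2.
exact: h1.
Qed.

(** * Gradings *)

Section Gradings.
Variables (R : realType) (I : choiceType) (W : lmodType R[i]).
Variables (E : I -> set W) (pr : I -> W -> W).
Hypothesis hE : is_grading E pr.

Lemma gradE_pr i w : E i w <-> pr i w = w.
Proof. by split=> [/(grad_id hE)//|<-]; exact: (grad_in hE). Qed.

Lemma grad_pr i j w : E j w -> pr i w = if i == j then w else 0.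
Proof.
by move=> Ew; case: (eqVneq i j) => [->|ij]; [apply: (grad_id hE)|apply: (grad_0 hE) ij Ew].
Qed.

Lemma grad_prpr i j w : pr i (pr j w) = if i == j then pr j w else 0.
Proof. exact: grad_pr (grad_in hE _ _). Qed.

Lemma grad_eq0 w : (forall i, pr i w = 0) -> w = 0.
Proof. by move=> w0; have [s [_ ->]] := grad_sum hE w; apply: big1 => i _. Qed.

Lemma grad_eq x y : (forall i, pr i x = pr i y) -> x = y.
Proof.
move=> xy; apply/eqP; rewrite -subr_eq0; apply/eqP/grad_eq0 => i.
by rewrite (linB (grad_lin hE i)) xy subrr.
Qed.

Lemma grad_ind (P : W -> Prop) : P 0 -> (forall x y, P x -> P y -> P (x + y)) ->
  (forall i x, E i x -> P x) -> forall x, P x.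
Proof.
move=> P0 PD PE x; have [s [_ ->]] := grad_sum hE x.
by apply: (big_ind P) => // i _; apply: PE; exact: (grad_in hE).
Qed.

Lemma grad_supp w (s : seq I) i :
  w = \sum_(j <- s) pr j w -> i \notin s -> pr i w = 0.
Proof.
move=> -> si; rewrite (lin_sum (grad_lin hE i)) big_seq big1// => j js.
by rewrite grad_prpr ifF//; apply: contraNF si => /eqP ->.
Qed.

(** A vector is a finite sum of homogeneous ones, so a threshold beyond which
    the maps vanish on it is the maximum of finitely many thresholds. *)
Lemma grad_near (J : Type) (size : J -> nat) (G : J -> W -> W) :
  (forall j, linear (G j)) ->
  (forall i x, E i x -> exists N, forall j, (N <= size j)%N -> G j x = 0) ->
  forall x, exists N, forall j, (N <= size j)%N -> G j x = 0.
Proof.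
move=> hG h; apply: grad_ind => [|x y [Nx hx] [Ny hy]|]; last exact: h.
  by exists 0%N => j _; exact: lin0.
exists (maxn Nx Ny) => j; rewrite geq_max => /andP[/hx ex /hy ey].
by rewrite (linD (hG j)) ex ey addr0.
Qed.

Lemma grad_eig (D : W -> W) (chi : I -> R[i]) :
  linear D -> (forall i, E i `<=` eigenvectors D (chi i)) ->
  forall i x, pr i (D x) = chi i *: pr i x.
Proof.
move=> linD_ ED i; apply: grad_ind => [|x y hx hy|j x Ejx].
- by rewrite (lin0 linD_) (lin0 (grad_lin hE i)) scaler0.
- by rewrite (linD linD_) !(linD (grad_lin hE i)) hx hy scalerDr.
- have /= -> : D x = chi j *: x by exact: ED Ejx.
  rewrite (linZ (grad_lin hE i)) (grad_pr i Ejx).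
  by case: eqVneq => [->//|]; rewrite !scaler0.
Qed.

Lemma grad_eig_pr0 (D : W -> W) (chi : I -> R[i]) (mu : R[i]) i x :
  linear D -> (forall i, E i `<=` eigenvectors D (chi i)) ->
  D x = mu *: x -> chi i != mu -> pr i x = 0.
Proof.
move=> linD_ ED Dx imu; have := grad_eig linD_ ED i x.
rewrite Dx (linZ (grad_lin hE i)) => /eqP; rewrite -subr_eq0 -scalerBl.
by rewrite scaler_eq0 subr_eq0 eq_sym (negPf imu) => /eqP.
Qed.
End Gradings.

(** * The complex exponential and logarithm *)

Section ComplexExp.
Variable R : realType.
Local Notation C := R[i].
Implicit Types z w l : C.

Lemma CexpD l l' : Cexp (l + l') = Cexp l * Cexp l'.
Proof.
case: l l' => [a b] [c d]; rewrite /Cexp /=; simpc.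
by rewrite expRD cosD sinD; congr (_ +i* _); ring.
Qed.

Lemma Cexp0 : Cexp (0 : C) = 1.
Proof. by rewrite /Cexp/= expR0 cos0 sin0 mulr1 mulr0. Qed.

Lemma Cexp_neq0 l : Cexp l != 0.
Proof.
apply/eqP => l0; have := CexpD l (- l); rewrite subrr Cexp0 l0 mul0r.
by move=> /eqP; rewrite oner_eq0.
Qed.

Lemma CexpN l : Cexp (- l) = (Cexp l)^-1.
Proof.
apply: (mulfI (Cexp_neq0 l)); rewrite -CexpD subrr Cexp0 mulfV//.
exact: Cexp_neq0.
Qed.

Lemma Cexp_nat (n : nat) l : Cexp (n%:R * l) = Cexp l ^+ n.
Proof.
elim: n => [|n IHn]; first by rewrite mul0r Cexp0.
by rewrite -natr1 mulrDl mul1r CexpD IHn exprSr.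
Qed.

Lemma Cexp_int (n : int) l : Cexp (n%:~R * l) = Cexp l ^ n.
Proof.
case: n => n; first by rewrite -[_%:~R]/(n%:R) Cexp_nat.
by rewrite NegzE mulrNz mulNr CexpN -[_%:~R]/(n.+1%:R) Cexp_nat.
Qed.

Lemma Cexp_conj l : Cexp l^* = (Cexp l)^*.
Proof. by case: l => a b; rewrite /Cexp/= cosN sinN mulrN. Qed.

Lemma normCE z : `|z| = (Cnorm z)%:C.
Proof. by rewrite /Cnorm normc_def. Qed.

Lemma Cnorm_sqr z : Cnorm z ^+ 2 = complex.Re z ^+ 2 + complex.Im z ^+ 2.
Proof. by rewrite /Cnorm normc_def/= sqr_sqrtr// addr_ge0// sqr_ge0. Qed.

Lemma Cnorm_ge0 z : 0 <= Cnorm z.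
Proof. by rewrite -ler0c -normCE. Qed.

Lemma Cnorm0 : Cnorm (0 : C) = 0.
Proof. by rewrite /Cnorm normr0. Qed.

Lemma Cnorm_eq0 z : (Cnorm z == 0) = (z == 0).
Proof. by rewrite -[RHS]normr_eq0 normCE -(inj_eq (@complexI R)). Qed.

Lemma Cnorm_gt0 z : (0 < Cnorm z) = (z != 0).
Proof. by rewrite lt_neqAle Cnorm_ge0 andbT eq_sym Cnorm_eq0. Qed.

Lemma CnormM z w : Cnorm (z * w) = Cnorm z * Cnorm w.
Proof. by apply: (@complexI R); rewrite rmorphM/= -!normCE normrM. Qed.

Lemma CnormD z w : Cnorm (z + w) <= Cnorm z + Cnorm w.
Proof. by rewrite -lecR rmorphD/= -!normCE ler_normD. Qed.

Lemma CnormN z : Cnorm (- z) = Cnorm z.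
Proof. by rewrite /Cnorm normrN. Qed.

Lemma CnormX z n : Cnorm (z ^+ n) = Cnorm z ^+ n.
Proof. by apply: (@complexI R); rewrite rmorphXn/= -!normCE normrX. Qed.

Lemma Cnorm_nat n : Cnorm (n%:R : C) = n%:R.
Proof. by apply: (@complexI R); rewrite rmorph_nat -normCE normr_nat. Qed.

Lemma CnormJ z : Cnorm z^* = Cnorm z.
Proof. by rewrite /Cnorm !normc_def; case: z => a b/=; rewrite sqrrN. Qed.

Lemma Cnorm_sum (I : Type) (r : seq I) (F : I -> C) :
  Cnorm (\sum_(i <- r) F i) <= \sum_(i <- r) Cnorm (F i).
Proof.
elim: r => [|i r IHr]; first by rewrite !big_nil Cnorm0.
by rewrite !big_cons (le_trans (CnormD _ _))// lerD2l.
Qed.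

Lemma Cexp_Clog z : z != 0 -> Cexp (Clog z) = z.
Proof.
move=> z0; have n0 : 0 < Cnorm z by rewrite Cnorm_gt0.
set x := complex.Re z / Cnorm z.
have xx : x ^+ 2 + (complex.Im z / Cnorm z) ^+ 2 = 1.
  by rewrite !expr_div_n -mulrDl -Cnorm_sqr mulfV// expf_neq0// gt_eqF.
have x1 : x \in `[-1, 1].
  rewrite in_itv/= -ler_norml -[leRHS]sqrtr1 -sqrtr_sqr ler_wsqrtr//.
  by rewrite -xx lerDl sqr_ge0.
have sinx : sin (acos x) = `|complex.Im z| / Cnorm z.
  rewrite sin_acos; last by move: x1; rewrite in_itv.
  rewrite (_ : 1 - x ^+ 2 = (complex.Im z / Cnorm z) ^+ 2); last by lra.
  by rewrite sqrtr_sqr normrM normfV (ger0_norm (ltW n0)).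
rewrite /Clog /Cexp /= lnK ?posrE// /Carg -/x.
case: ifPn => [im|]; last rewrite -ltNge => im.
  rewrite acosK//; rewrite sinx ger0_norm// /x.
  by case: z z0 n0 {x xx x1 sinx im} => a b z0 n0; congr (_ +i* _); rewrite /= mulrC divfK// gt_eqF.
have -> : 2 * pi - acos x = - acos x + 2 * pi by rewrite addrC.
rewrite mulr_natl cosD2pi sinD2pi cosN sinN sinx acosK// ltr0_norm// mulNr opprK /x.
by case: z z0 n0 {x xx x1 sinx im} => a b z0 n0; congr (_ +i* _); rewrite /= mulrC divfK// gt_eqF.
Qed.
End ComplexExp.

(** * Unordered sums and the binomial series *)

Section NetSums.
Variable R : realType.
Local Notation C := R[i].

(** The convergence clause of [abs_sum]; it alone determines the sum. *)
Definition net_sum (I : choiceType) (f : I -> C) (l : C) : Prop :=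
  forall e : R, 0 < e -> exists s0 : seq I, forall s : seq I,
    uniq s -> {subset s0 <= s} -> Cnorm (\sum_(i <- s) f i - l) < e.

Definition seq_lim (u : nat -> C) (l : C) : Prop :=
  forall e : R, 0 < e -> exists N0 : nat, forall N, (N0 <= N)%N ->
    Cnorm (u N - l) < e.

Section OneIndex.
Variable I : choiceType.
Implicit Types f g : I -> C.

Lemma net_sum_uniq f l l' : net_sum f l -> net_sum f l' -> l = l'.
Proof.
move=> fl fl'; apply/eqP; rewrite -subr_eq0 -Cnorm_eq0 eq_le Cnorm_ge0 andbT.
rewrite leNgt; apply/negP => d0; set d := Cnorm _ in d0.
have d2 : 0 < d / 2 by rewrite divr_gt0.
have [s0 hs0] := fl _ d2; have [s1 hs1] := fl' _ d2.
have us := undup_uniq (s0 ++ s1).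
have h0 : Cnorm (\sum_(i <- undup (s0 ++ s1)) f i - l) < d / 2.
  by apply: hs0 => // x xs; rewrite mem_undup mem_cat xs.
have h1 : Cnorm (\sum_(i <- undup (s0 ++ s1)) f i - l') < d / 2.
  by apply: hs1 => // x xs; rewrite mem_undup mem_cat xs orbT.
set S := \sum_(i <- _) _ in h0 h1.
have : d <= Cnorm (S - l) + Cnorm (S - l').
  rewrite /d (_ : l - l' = - (S - l) + (S - l')); last by ring.
  by rewrite (le_trans (CnormD _ _))// CnormN.
by apply/negP; rewrite -ltNge; lra.
Qed.

Lemma net_sumD f g l l' :
  net_sum f l -> net_sum g l' -> net_sum (fun i => f i + g i) (l + l').
Proof.
move=> fl gl' e e0.
have e2 : 0 < e / 2 by rewrite divr_gt0.
have [s0 hs0] := fl _ e2; have [s1 hs1] := gl' _ e2.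
exists (s0 ++ s1) => s us ss; rewrite big_split/=.
have h1 : Cnorm (\sum_(i <- s) f i - l) < e / 2.
  by apply: hs0 => // x xs; apply: ss; rewrite mem_cat xs.
have h2 : Cnorm (\sum_(i <- s) g i - l') < e / 2.
  by apply: hs1 => // x xs; apply: ss; rewrite mem_cat xs orbT.
move: h1 h2; set A := \sum_(i <- s) f i; set B := \sum_(i <- s) g i => h1 h2.
rewrite (_ : A + B - (l + l') = (A - l) + (B - l')); last by ring.
by rewrite (le_lt_trans (CnormD _ _))//; lra.
Qed.

Lemma net_sumZ c f l : net_sum f l -> net_sum (fun i => c * f i) (c * l).
Proof.
move=> fl e e0; have d0 : 0 < Cnorm c + 1 by rewrite ltr_wpDl// Cnorm_ge0.
have [s0 hs0] := fl (e / (Cnorm c + 1)) (divr_gt0 e0 d0).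
exists s0 => s us ss; rewrite -mulr_sumr -mulrBr CnormM.
have := hs0 s us ss; rewrite ltr_pdivlMr// => h.
rewrite (le_lt_trans _ h)// mulrC ler_wpM2l ?Cnorm_ge0//; lra.
Qed.

Lemma net_sum0 : net_sum (fun _ : I => 0) 0.
Proof.
by move=> e e0; exists [::] => s _ _; rewrite big1_eq subr0 Cnorm0.
Qed.

Lemma net_sum_sum (J : Type) (r : seq J) (f : J -> I -> C) (l : J -> C) :
  (forall j, net_sum (f j) (l j)) ->
  net_sum (fun i => \sum_(j <- r) f j i) (\sum_(j <- r) l j).
Proof.
move=> fl; elim: r => [|j r IHr].
  rewrite big_nil; under [X in net_sum X]eq_fun do rewrite big_nil.
  exact: net_sum0.
rewrite big_cons; under [X in net_sum X]eq_fun do rewrite big_cons.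
exact: net_sumD.
Qed.

(** Any finite set differs from one containing the set of threshold 1 by a
    subset of the latter. *)
Lemma net_sum_bound f l : net_sum f l ->
  exists2 B : R, 0 < B & forall s, uniq s -> Cnorm (\sum_(i <- s) f i - l) <= B.
Proof.
move=> fl; have [s0 hs0] := fl 1 ltr01.
exists (1 + \sum_(i <- s0) Cnorm (f i)).
  by rewrite ltr_wpDr// sumr_ge0// => i _; exact: Cnorm_ge0.
move=> s us; set r := [seq i <- undup s0 | i \notin s].
have ur : uniq (s ++ r).
  rewrite cat_uniq us filter_uniq ?undup_uniq// andbT.
  by apply/hasPn => i; rewrite mem_filter => /andP[].
have /hs0/(_ _)h := ur.
have {}h : Cnorm (\sum_(i <- s ++ r) f i - l) < 1.
  by apply: h => i i0; rewrite mem_cat mem_filter mem_undup i0 andbT orbN.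
rewrite big_cat/= in h; set A := \sum_(i <- s) _ in h *.
rewrite (_ : A - l = (A + \sum_(i <- r) f i - l) + - \sum_(i <- r) f i); last by ring.
rewrite (le_trans (CnormD _ _))// lerD ?(ltW h)// CnormN.
rewrite (le_trans (Cnorm_sum _ _))// /r big_filter.
rewrite (@le_trans _ _ (\sum_(i <- undup s0) Cnorm (f i)))//.
  by rewrite big_mkcond ler_sum// => i _; case: ifP => // _; exact: Cnorm_ge0.
elim: (s0) => [|i t IHt]; first by rewrite big_nil.
rewrite /= big_cons; case: ifP => _; first by rewrite ler_wpDl// Cnorm_ge0.
by rewrite big_cons lerD2l.
Qed.
End OneIndex.

Lemma net_sum_shift (f : R -> C) l c : net_sum f l -> net_sum (fun q => f (q + c)) l.
Proof.
move=> fl e e0; have [s0 hs0] := fl e e0.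
exists [seq q - c | q <- s0] => s us ss.
have -> : \sum_(i <- s) f (i + c) = \sum_(i <- [seq q + c | q <- s]) f i.
  by rewrite big_map.
apply: hs0; first by rewrite map_inj_uniq//; exact: addIr.
move=> q qs; apply/mapP; exists (q - c); last by rewrite subrK.
by apply: ss; exact: map_f.
Qed.

Lemma tail_small (a : nat -> R) (M : R) : (forall j, 0 <= a j) ->
  (forall N, \sum_(j < N) a j <= M) -> forall e, 0 < e ->
  exists J : nat, forall N, (J <= N)%N -> \sum_(J <= j < N) a j < e.
Proof.
move=> a0 aM e e0; set A := [set x | exists N, x = \sum_(j < N) a j].
have hA : has_sup A.
  split; first by exists 0, 0%N; rewrite big_ord0.
  by exists M => _ [N ->].
have [_ [J ->] hJ] := sup_adherent e0 hA.
exists J => N JN; have : \sum_(j < N) a j <= sup A by apply: ub_le_sup; [exact: hA.2|exists N].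
rewrite -(big_mkord xpredT a) (big_cat_nat (leq0n J) JN)/=.
by rewrite -(big_mkord xpredT a) in hJ; lra.
Qed.

(** The Cauchy product of an unordered sum over weights with a power series.
    Only finitely many terms of the product contribute to each weight.  A large
    finite set of weights contains the translates, by the exponents of the first
    terms of the series, of a finite set that nearly exhausts [h]; the other
    terms are controlled by the tail of [g] and a bound for all partial sums of
    [h]. *)
Lemma net_sum_conv (g : nat -> C) (G : C) (h : R -> C) (H : C) (al : R -> C)
    (c M : R) :
  (forall N, \sum_(j < N) Cnorm (g j) <= M) ->
  seq_lim (fun N => \sum_(j < N) g j) G -> net_sum h H ->
  (forall q, exists N0 : nat, forall N, (N0 <= N)%N ->
     al q = \sum_(j < N) g j * h (q + c - j%:R)) ->
  net_sum al (G * H).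
Proof.
move=> gM gG hH alE e e0.
have M0 : 0 <= M by have := gM 0%N; rewrite big_ord0.
have [B B0 hB] := net_sum_bound hH.
have e3 : 0 < e / 3 by rewrite divr_gt0.
have M1 : 0 < M + 1 by lra.
have H1 : 0 < Cnorm H + 1 by rewrite ltr_wpDl// Cnorm_ge0.
have [s1 hs1] := hH (e / 3 / (M + 1)) (divr_gt0 e3 M1).
have [J hJ1] := tail_small (fun j => Cnorm_ge0 (g j)) gM (divr_gt0 e3 B0).
have [J2 hJ2] := gG (e / 3 / (Cnorm H + 1)) (divr_gt0 e3 H1).
exists [seq q - c + j%:R | j <- iota 0 J, q <- s1] => s us ss.
have [N [JN J2N hN]] : exists N, [/\ (J <= N)%N, (J2 <= N)%N &
    {in s, forall q, al q = \sum_(j < N) g j * h (q + c - j%:R)}].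
  have : exists N0 : nat, {in s, forall q, forall N, (N0 <= N)%N ->
     al q = \sum_(j < N) g j * h (q + c - j%:R)}.
    elim: (s) => [|q t [N1 h1]]; first by exists 0%N.
    have [N2 h2] := alE q; exists (maxn N1 N2) => p; rewrite inE.
    case/predU1P => [->|pt] N; rewrite geq_max => /andP[a b]; first exact: h2.
    exact: h1.
  move=> [N0 h0]; exists (maxn N0 (maxn J J2)); split.
  - by rewrite (leq_trans (leq_maxl J J2))// leq_maxr.
  - by rewrite (leq_trans (leq_maxr J J2))// leq_maxr.
  - by move=> q qs; apply: h0 => //; exact: leq_maxl.
pose S j := \sum_(q <- s) h (q + c - j%:R).
have SE j : S j = \sum_(q <- [seq q + c - j%:R | q <- s]) h q by rewrite /S big_map.
have Su j : uniq [seq q + c - j%:R | q <- s].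
  by rewrite map_inj_uniq// => x y /addIr/addIr.
have SB j : Cnorm (S j - H) <= B by rewrite SE; exact: hB.
have SJ j : (j < J)%N -> Cnorm (S j - H) < e / 3 / (M + 1).
  move=> jJ; rewrite SE; apply: hs1 => // q qs1.
  apply/mapP; exists (q - c + j%:R); last by ring.
  by apply: ss; apply/allpairsP; exists (j, q); rewrite mem_iota/= add0n jJ.
have -> : \sum_(i <- s) al i - G * H =
    \sum_(j < N) g j * (S j - H) + (\sum_(j < N) g j - G) * H.
  rewrite (eq_big_seq _ hN) exchange_big/=.
  under eq_bigr do rewrite -mulr_sumr.
  under [X in _ = X + _]eq_bigr do rewrite mulrBr.
  rewrite sumrB -mulr_suml /S; ring.
have h1 : Cnorm (\sum_(j < N) g j * (S j - H)) <= e / 3 / (M + 1) * M + e / 3.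
  rewrite (le_trans (Cnorm_sum _ _))//.
  under eq_bigr do rewrite CnormM.
  rewrite -(big_mkord xpredT (fun j => Cnorm (g j) * Cnorm (S j - H))).
  rewrite (big_cat_nat (leq0n J) JN)/= lerD//.
    rewrite big_mkord (le_trans _ (ler_wpM2l _ (gM J)))//; last first.
      by rewrite divr_ge0// ltW.
    rewrite mulr_sumr ler_sum// => j _.
    by rewrite mulrC ler_wpM2r ?Cnorm_ge0// ltW// SJ.
  rewrite (@le_trans _ _ (B * \sum_(J <= j < N) Cnorm (g j)))//.
    by rewrite mulr_sumr ler_sum// => j _; rewrite mulrC ler_wpM2r// Cnorm_ge0.
  have := hJ1 N JN; rewrite ltr_pdivlMr// => /ltW; by rewrite mulrC.
have h2 : Cnorm ((\sum_(j < N) g j - G) * H) < e / 3.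
  rewrite CnormM; have := hJ2 N J2N; rewrite ltr_pdivlMr// => h2.
  rewrite (le_lt_trans _ h2)// ler_wpM2l ?Cnorm_ge0//; lra.
have h3 : e / 3 / (M + 1) * M <= e / 3.
  by rewrite -mulrA ler_piMr ?(ltW e3)// mulrC ler_pdivrMr//; lra.
by rewrite (le_lt_trans (CnormD _ _))//; lra.
Qed.

Section BinomialSeries.

(** Pascal's rule makes the product by [1 - t] telescope to the series of the
    previous order. *)
Lemma binom_partial (K : comRingType) (t : K) (k N : nat) :
  (1 - t) * \sum_(j < N.+1) 'C(j + k.+1, k.+1)%:R * t ^+ j =
  \sum_(j < N.+1) 'C(j + k, k)%:R * t ^+ j - 'C(N + k.+1, k.+1)%:R * t ^+ N.+1.
Proof.
elim: N => [|N IHN].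
  by rewrite !big_ord_recr !big_ord0/= !add0n !binn expr0 expr1; ring.
rewrite big_ord_recr mulrDr IHN [in RHS]big_ord_recr/=.
have -> : 'C(N.+1 + k.+1, k.+1)%:R = 'C(N + k.+1, k.+1)%:R + 'C(N.+1 + k, k)%:R :> K.
  by rewrite addSn binS natrD addnS.
by rewrite !exprS; ring.
Qed.

Lemma geom_partial (K : comRingType) (t : K) (N : nat) :
  (1 - t) * \sum_(j < N) 'C(j + 0, 0)%:R * t ^+ j = 1 - t ^+ N.
Proof.
elim: N => [|N IHN]; first by rewrite big_ord0 expr0; ring.
by rewrite big_ord_recr mulrDr IHN/= bin0 exprS; ring.
Qed.

Lemma binom_bounded (x : R) (k : nat) : 0 <= x -> x < 1 ->
  exists M, forall N, \sum_(j < N) 'C(j + k, k)%:R * x ^+ j <= M.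
Proof.
move=> x0 x1; have y0 : 0 < 1 - x by lra.
elim: k => [|k [M hM]].
  exists (1 / (1 - x)) => N; rewrite ler_pdivlMr// mulrC geom_partial.
  by rewrite lerBlDr lerDl exprn_ge0.
exists (M / (1 - x)) => N.
have h : \sum_(j < N) 'C(j + k.+1, k.+1)%:R * x ^+ j <=
         \sum_(j < N.+1) 'C(j + k.+1, k.+1)%:R * x ^+ j.
  by rewrite big_ord_recr/= lerDl mulr_ge0 ?ler0n// exprn_ge0.
rewrite (le_trans h)// ler_pdivlMr// mulrC binom_partial.
rewrite (le_trans _ (hM N.+1))// gerBl mulr_ge0 ?ler0n// exprn_ge0//.
Qed.

Lemma binom_terms (t : C) (k : nat) : Cnorm t < 1 ->
  seq_lim (fun N => 'C(N + k, k)%:R * t ^+ N) 0.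
Proof.
move=> t1 e e0; have [M hM] := binom_bounded k (Cnorm_ge0 t) t1.
have [|J hJ] := tail_small (a := fun j => 'C(j + k, k)%:R * Cnorm t ^+ j) _ hM e0.
  by move=> j; rewrite mulr_ge0 ?ler0n// exprn_ge0// Cnorm_ge0.
exists J => N JN; have := hJ N.+1 (leqW JN).
rewrite subr0 CnormM Cnorm_nat CnormX big_nat_recr//=; apply: le_lt_trans.
rewrite lerDr sumr_ge0// => j _.
by rewrite mulr_ge0 ?ler0n// exprn_ge0// Cnorm_ge0.
Qed.

Lemma seq_limZ (c : C) u l : seq_lim u l -> seq_lim (fun N => c * u N) (c * l).
Proof.
move=> ul e e0; have d0 : 0 < Cnorm c + 1 by rewrite ltr_wpDl// Cnorm_ge0.
have [N0 h0] := ul (e / (Cnorm c + 1)) (divr_gt0 e0 d0).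
exists N0 => N /h0; rewrite -mulrBr CnormM ltr_pdivlMr// => h.
rewrite (le_lt_trans _ h)// mulrC ler_wpM2l ?Cnorm_ge0//; lra.
Qed.

Lemma seq_limD u l u' l' : seq_lim u l -> seq_lim u' l' ->
  seq_lim (fun N => u N + u' N) (l + l').
Proof.
move=> ul ul' e e0; have e2 : 0 < e / 2 by rewrite divr_gt0.
have [N0 h0] := ul _ e2; have [N1 h1] := ul' _ e2.
exists (maxn N0 N1) => N; rewrite geq_max => /andP[/h0 a /h1 b].
rewrite (_ : _ - _ = (u N - l) + (u' N - l')); last by ring.
by rewrite (le_lt_trans (CnormD _ _))//; lra.
Qed.

Lemma seq_limS u l : seq_lim (fun N => u N.+1) l -> seq_lim u l.
Proof.
move=> ul e e0; have [N0 h0] := ul e e0.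
by exists N0.+1 => -[//|N] /h0.
Qed.

Lemma binom_sum (t : C) (k : nat) : Cnorm t < 1 ->
  seq_lim (fun N => \sum_(j < N) 'C(j + k, k)%:R * t ^+ j) ((1 - t) ^- k.+1).
Proof.
move=> t1; have t0 : 1 - t != 0.
  by rewrite subr_eq0; apply/eqP => tE; move: t1; rewrite -tE -[1]/(1%:R) Cnorm_nat ltxx.
elim: k => [|k IHk].
  have -> : (fun N => \sum_(j < N) 'C(j + 0, 0)%:R * t ^+ j) =
      (fun N => (1 - t)^-1 * (1 + (-1) * ('C(N + 0, 0)%:R * t ^+ N))).
    apply/funext => N; apply: (mulfI t0).
    by rewrite geom_partial mulVKf// bin0; ring.
  have one : seq_lim (fun=> 1) (1 : C).
    by move=> e e0; exists 0%N => N _; rewrite subrr Cnorm0.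
  have := seq_limZ (1 - t)^-1 (seq_limD one (seq_limZ (-1) (binom_terms 0 t1))).
  by rewrite mulr0 addr0 mulr1 expr1.
apply: seq_limS.
have -> : (fun N => \sum_(j < N.+1) 'C(j + k.+1, k.+1)%:R * t ^+ j) =
    (fun N => (1 - t)^-1 * (\sum_(j < N.+1) 'C(j + k, k)%:R * t ^+ j +
       (- t) * ('C(N + k.+1, k.+1)%:R * t ^+ N))).
  apply/funext => N; apply: (mulfI t0).
  by rewrite binom_partial mulVKf// exprS; ring.
have IH : seq_lim (fun N => \sum_(j < N.+1) 'C(j + k, k)%:R * t ^+ j) ((1 - t) ^- k.+1).
  by move=> e e0; have [N0 h0] := IHk e e0; exists N0 => N h; apply: h0; exact: leqW.
have := seq_limZ (1 - t)^-1 (seq_limD IH (seq_limZ (- t) (binom_terms k.+1 t1))).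
by rewrite mulr0 addr0 -invfM -exprS.
Qed.

(** Convolution with the expansion of [(z - zeta)^(- k - 1)] in powers of
    [zeta / z]. *)
Lemma net_sum_binom (z zeta : C) (k : nat) (h : R -> C) (H : C) (al : R -> C)
    (c : R) :
  Cnorm zeta < Cnorm z -> net_sum h H ->
  (forall q, exists N0 : nat, forall N, (N0 <= N)%N ->
     al q = \sum_(j < N) ('C(j + k, k)%:R * zeta ^+ j * z ^- (j + k).+1) *
              h (q + c - j%:R)) ->
  net_sum al ((z - zeta) ^- k.+1 * H).
Proof.
move=> zz hH alE.
have nz0 : 0 < Cnorm z by rewrite (le_lt_trans (Cnorm_ge0 zeta)).
have z0 : z != 0 by rewrite -Cnorm_gt0.
pose t := zeta / z.
have zt : zeta = t * z by rewrite /t divfK.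
have t1 : Cnorm t < 1 by move: zz; rewrite zt CnormM gtr_pMl.
have [M hM] := binom_bounded k (Cnorm_ge0 t) t1.
have gE j : 'C(j + k, k)%:R * zeta ^+ j * z ^- (j + k).+1 =
            z ^- k.+1 * ('C(j + k, k)%:R * t ^+ j).
  rewrite zt exprMn -addnS exprD invfM; field.
  by rewrite expf_neq0// expf_neq0.
have -> : (z - zeta) ^- k.+1 = z ^- k.+1 * (1 - t) ^- k.+1.
  by rewrite -invfM -exprMn mulrBr mulr1 [z * t]mulrC -zt.
apply: (@net_sum_conv (fun j => z ^- k.+1 * ('C(j + k, k)%:R * t ^+ j)) _
          h H al c (Cnorm (z ^- k.+1) * M)) => //.
- move=> N; under eq_bigr do rewrite CnormM.
  rewrite -mulr_sumr ler_wpM2l ?Cnorm_ge0//.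
  by under eq_bigr do rewrite CnormM Cnorm_nat CnormX; exact: hM.
- under [X in seq_lim X]eq_fun do rewrite -mulr_sumr.
  by apply: seq_limZ; exact: binom_sum.
- move=> q; have [N0 h0] := alE q; exists N0 => N /h0 ->.
  by apply: eq_bigr => j _; rewrite gE.
Qed.
End BinomialSeries.
End NetSums.

(** * Consequences of the Jacobi identity *)

Section GeneralizedBinomials.
Variable R : realType.
Local Notation C := R[i].
Local Notation gbinom := (@gbinom R).

Lemma gbinom0 m : gbinom m 0 = 1.
Proof. by rewrite /Defs.gbinom big_ord0 fact0 divr1. Qed.

Lemma gbinomS m i : gbinom m i.+1 = gbinom m i * ((m%:~R - i%:R) / i.+1%:R).
Proof.
rewrite /Defs.gbinom big_ord_recr/= factS natrM.
have h1 : i.+1%:R != 0 :> C by rewrite pnatr_eq0.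
have h2 : i`!%:R != 0 :> C by rewrite pnatr_eq0 -lt0n fact_gt0.
by rewrite invfM; ring.
Qed.

Lemma gbinom_nat (n i : nat) : gbinom n i = 'C(n, i)%:R.
Proof.
elim: i => [|i IHi]; first by rewrite gbinom0 bin0.
rewrite gbinomS IHi -[_%:~R]/(n%:R).
have h1 : i.+1%:R != 0 :> C by rewrite pnatr_eq0.
apply: (mulIf h1); rewrite mulrA divfK//.
have [ni|ni] := ltnP n i; first by rewrite !bin_small ?mul0r//; exact: ltn_trans ni _.
by rewrite -natrB// -!natrM mulnC -mul_bin_left mulnC.
Qed.

Lemma gbinom_neg (j k : nat) :
  gbinom (- j.+1%:Z) k = (-1) ^+ k * 'C(j + k, k)%:R.
Proof.
elim: k => [|k IHk]; first by rewrite gbinom0 bin0 mul1r.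
rewrite gbinomS IHk mulrNz -[_%:~R]/(j.+1%:R).
have h1 : k.+1%:R != 0 :> C by rewrite pnatr_eq0.
apply: (mulIf h1); rewrite mulrA divfK// exprS.
have E : ('C(j + k.+1, k.+1)%:R * k.+1%:R = 'C(j + k, k)%:R * (j.+1%:R + k%:R) :> C)%R.
  rewrite -natrD -!natrM addnS; congr (_%:R).
  by rewrite mulnC -mul_bin_diag mulnC addSn.
by rewrite -[RHS]mulrA E; ring.
Qed.

Lemma gbinom_m1 k : gbinom (-1) k = (-1) ^+ k.
Proof. by rewrite (gbinom_neg 0 k) add0n binn mulr1. Qed.
End GeneralizedBinomials.

Section Jacobi.
Variable R : realType.
Local Notation C := R[i].
Variables (V W1 W2 W3 : lmodType C) (K : pzRingType).
Variables (a1 : V -> int -> W1 -> W1) (a2 : V -> int -> W2 -> W2).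
Variables (a3 : V -> int -> W3 -> W3) (Y : W1 -> K -> W2 -> W3).
Hypothesis jac : jacobi a1 a2 a3 Y.
Hypothesis Y0 : forall s w2, Y 0 s w2 = 0.

(** The commutator formula is the case [l = 0]. *)
Lemma jac_comm (v : V) w1 w2 (m : int) (s : K) (N : nat) :
  (forall i : nat, (N <= i)%N -> gbinom R m i = 0 \/ a1 v i w1 = 0) ->
  a3 v m (Y w1 s w2) = Y w1 s (a2 v m w2) +
    \sum_(i < N) gbinom R m i *: Y (a1 v i w1) (m%:~R + s - i%:R) w2.
Proof.
move=> h; have := jac v w1 w2 0 m s.
rewrite (@fsum_nat _ _ N); last first.
  by move=> i /h[->|]; rewrite ?scale0r// add0r => ->; rewrite Y0 scaler0.
rewrite (@fsum_one _ _ _ 0%N); last first.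
  by case=> // i _; rewrite (gbinom_nat R 0) bin_small// mulr0 scale0r.
rewrite gbinom0 expr0 mulr1 scale1r expr0z scale1r !addr0 !subr0 => E.
under eq_bigr do rewrite -[X in a1 v X _]add0r.
by rewrite E addrC subrK.
Qed.

(** The iterate formula for the mode [-1] is the case [l = -1], [m = 0].  With
    the conformal vector for [v] it expresses the insertion of [L(-2) w1]. *)
Lemma jac_iter (v : V) w1 w2 (s : K) (N : nat) : (forall m, a3 v m 0 = 0) ->
  (forall i : nat, (N <= i)%N -> Y w1 (s + i%:R) w2 = 0) ->
  (forall i : nat, (N <= i)%N -> Y w1 (s - 1 - i%:R) (a2 v i w2) = 0) ->
  Y (a1 v (-1) w1) s w2 =
  \sum_(i < N) (a3 v (- i.+1%:Z) (Y w1 (s + i%:R) w2)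
                + Y w1 (s - 1 - i%:R) (a2 v i w2)).
Proof.
move=> a30 h1 h2; have := jac v w1 w2 (-1) 0 s.
rewrite (@fsum_one _ _ _ 0%N); last first.
  by case=> // i _; rewrite (gbinom_nat R 0) bin_small// scale0r.
rewrite gbinom0 scale1r addr0 add0r subr0 => ->.
have E i : ((-1) ^+ i * gbinom R (-1) i) *:
   (a3 v (0 + -1 - i%:Z) (Y w1 (s + i%:R) w2) -
    (-1) ^ (-1) *: Y w1 (s + (-1)%:~R - i%:R) (a2 v (0 + i%:Z) w2)) =
   a3 v (- i.+1%:Z) (Y w1 (s + i%:R) w2) + Y w1 (s - 1 - i%:R) (a2 v i w2).
  rewrite gbinom_m1 -expr2 sqrr_sign scale1r !add0r exprN1 invrN1 scaleN1r opprK.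
  by rewrite mulrN1z; congr (a3 v _ _ + _); lia.
under eq_fsbigr do rewrite E.
by apply: fsum_nat => i Ni; rewrite h1// h2// a30 addr0.
Qed.
End Jacobi.

Section VOAFacts.
Variables (R : realType) (V : VOA R).
Local Notation C := R[i].

Lemma vmode_linr (a : V) n : linear (vmode a n).
Proof. exact: (vmode_bilin V n).2. Qed.

Lemma vmode_linl (b : V) n : linear (fun a => vmode a n b).
Proof. exact: (vmode_bilin V n).1. Qed.

Lemma vL_lin n : linear (@vL R V n).
Proof. exact: vmode_linr. Qed.

Lemma vL_vac n : -1 <= n -> vL n (vac V) = 0.
Proof. by move=> n1; apply: vmode_creation0; rewrite -subr_ge0 opprK in n1. Qed.

Lemma vL_Nvac : vL (-2) (vac V) = conf V.
Proof. exact: vmode_creation. Qed.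

Lemma vL_conf n : -1 < n -> vL n (conf V) =
  (n + 2)%:~R *: vL (n - 2) (vac V) +
  (if n - 2 == 0 then (n ^+ 3 - n)%:~R / 12%:R * ccharge V else 0) *: vac V.
Proof.
move=> n1; have := vmode_virasoro n (-2) (vac V).
rewrite (vL_vac (n := n)) ?(ltW n1)// vL_Nvac opprK => <-.
by rewrite (lin0 (vL_lin (-2))) subr0.
Qed.

Lemma vL0_conf : vL 0 (conf V) = 2%:R *: conf V.
Proof. by rewrite vL_conf// sub0r vL_Nvac scale0r addr0. Qed.

Lemma vL1_conf : vL 1 (conf V) = 0.
Proof. by rewrite vL_conf// vL_vac// scaler0 scale0r addr0. Qed.

Lemma vL2_conf : vL 2 (conf V) = (ccharge V / 2%:R) *: vac V.
Proof.
rewrite vL_conf// vL_vac// scaler0 add0r/=; congr (_ *: _).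
have -> : ((2 : int) ^+ 3 - 2)%:~R = 6%:R :> C by [].
by field.
Qed.

Lemma vL_conf0 n : 2 < n -> vL n (conf V) = 0.
Proof.
move=> n2; rewrite vL_conf; last by lia.
rewrite vL_vac; last by lia.
by rewrite scaler0 ifF ?scale0r ?addr0//; apply/eqP; lia.
Qed.
End VOAFacts.

Section ModuleFacts.
Variables (R : realType) (V : VOA R) (W : vmodule V).
Local Notation C := R[i].
Implicit Types (v : V) (w : W).

Lemma mact_linr v n : linear (@mact R V W v n).
Proof. exact: (wm_bilin (m_weak W) n).2. Qed.

Lemma mact_linl w n : linear (fun v => @mact R V W v n w).
Proof. exact: (wm_bilin (m_weak W) n).1. Qed.

Lemma mL_lin n : linear (@mL R V W n).
Proof. exact: mact_linr. Qed.

Lemma mact0 n w : mact 0 n w = 0.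
Proof. exact: (lin0 (@mact_linl w n)). Qed.

Lemma mL_Nmode v (n : int) w :
  mL (-1) (mact v n w) = mact v n (mL (-1) w) - n%:~R *: mact v (n - 1) w.
Proof.
rewrite {1}/mL (jac_comm (wm_jacobi (m_weak W)) (fun s w2 => mact0 s w2)
  _ _ (N := 1)); last by case=> // i _; left; rewrite -[-1 + 1]/(0%:Z) gbinom_nat bin_small.
rewrite big_ord1 gbinom0 scale1r -[-1 + 1]/(0%:Z) subr0 add0r.
by rewrite -[vmode _ _ _]/(vL (-1) v) m_deriv scaleNr.
Qed.

Lemma mL0_mode v (n : int) w : mL 0 (mact v n w) =
  mact v n (mL 0 w) + mact (vL 0 v) n w - (n + 1)%:~R *: mact v n w.
Proof.
rewrite {1}/mL (jac_comm (wm_jacobi (m_weak W)) (fun s w2 => mact0 s w2)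
  _ _ (N := 2)); last first.
  by move=> i i2; left; rewrite -[0 + 1]/(1%:Z) gbinom_nat bin_small.
rewrite big_ord_recl big_ord1/= gbinom0 -[0 + 1]/(1%:Z) gbinom_nat !scale1r.
rewrite -[vmode _ 0 _]/(vL (-1) v) -[vmode _ 1 _]/(vL 0 v) m_deriv.
rewrite subr0 !intz -[1 + n - 1]addrAC subrr add0r.
by rewrite scaleNr [1 + n]addrC [in RHS]addrAC addrA.
Qed.

Lemma mL0_mL (n : int) w : mL 0 (mL n w) = mL n (mL 0 w) - n%:~R *: mL n w.
Proof.
rewrite {2}/mL mL0_mode -/(mL _ _) vL0_conf (linZ (@mact_linl _ _)) -/(mL n w).
rewrite -addrA -scalerBl; congr (_ + _); rewrite -scaleNr; congr (_ *: _).
by rewrite !intrD; ring.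
Qed.

Lemma mL_wt (n : int) (h : R) w :
  mL 0 w = h%:C *: w -> mL 0 (mL n w) = (h - n%:~R)%:C *: mL n w.
Proof.
move=> hw; rewrite mL0_mL hw (linZ (@mL_lin n)) -scalerBl; congr (_ *: _).
by rewrite rmorphB/= rmorph_int.
Qed.
End ModuleFacts.

Section IntertwinerFacts.
Variables (R : realType) (V : VOA R) (W1 W2 W3 : vmodule V).
Local Notation C := R[i].
Variable Y : W1 -> R -> W2 -> W3.
Hypothesis hY : is_intertwining Y.

Lemma io_linr w1 s : linear (Y w1 s).
Proof. exact: (io_bilin hY s).2. Qed.

Lemma io_linl w2 s : linear (fun w1 => Y w1 s w2).
Proof. exact: (io_bilin hY s).1. Qed.

Lemma io_0l s w2 : Y 0 s w2 = 0.
Proof. exact: (lin0 (@io_linl w2 s)). Qed.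

Lemma io_L0 w1 s w2 : mL 0 (Y w1 s w2) =
  Y w1 s (mL 0 w2) + Y (mL 0 w1) s w2 - (s + 1)%:C *: Y w1 s w2.
Proof.
rewrite {1}/mL (jac_comm (io_jacobi hY) io_0l _ _ (N := 2)); last first.
  by move=> i i2; left; rewrite -[0 + 1]/(1%:Z) gbinom_nat bin_small.
rewrite big_ord_recl big_ord1/= gbinom0 -[0 + 1]/(1%:Z) gbinom_nat !scale1r.
rewrite -[mact _ 0 w1]/(mL (-1) w1) -[mact _ 1 w1]/(mL 0 w1) (io_deriv hY).
rewrite subr0 -[1%:~R]/(1 : R) -[1 + s - 1]addrAC subrr add0r.
by rewrite scaleNr [1 + s]addrC [in RHS]addrAC addrA.
Qed.

Lemma io_wt w1 s w2 (h1 h2 : R) :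
  mL 0 w1 = h1%:C *: w1 -> mL 0 w2 = h2%:C *: w2 ->
  mL 0 (Y w1 s w2) = (h1 + h2 - s - 1)%:C *: Y w1 s w2.
Proof.
move=> e1 e2; rewrite io_L0 e1 e2 (linZ (@io_linr _ _)) (linZ (@io_linl _ _)).
rewrite -scalerDl -scalerBl; congr (_ *: _).
by rewrite -rmorphD -rmorphB; congr (_%:C); ring.
Qed.

(** On homogeneous vectors a single mode contributes to each weight. *)
Lemma io_eval_homog w1 w2 (h1 h2 : R) (l : C) (p : R) :
  mL 0 w1 = h1%:C *: w1 -> mL 0 w2 = h2%:C *: w2 ->
  io_eval (@mpr R V W3) Y w1 l w2 p =
  Cexp ((p - h1 - h2)%:C * l) *: Y w1 (h1 + h2 - 1 - p) w2.
Proof.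
move=> e1 e2; rewrite /io_eval (@fsum_one _ _ _ (h1 + h2 - 1 - p)).
  have /(gradE_pr (m_grading W3)) -> :
      eigenvectors (mL 0) p%:C (Y w1 (h1 + h2 - 1 - p) w2).
    by rewrite /eigenvectors/= (io_wt _ e1 e2); congr (_%:C *: _); ring.
  by rewrite (_ : - (h1 + h2 - 1 - p) - 1 = p - h1 - h2)//; ring.
move=> s sp; rewrite (grad_pr (m_grading W3) p (j := h1 + h2 - s - 1)).
  rewrite ifF ?scaler0//; apply/negP => /eqP pE; move/negP: sp; apply.
  by apply/eqP; rewrite pE; ring.
exact: io_wt.
Qed.
End IntertwinerFacts.

(** * Ward identities for products of two intertwining operators *)

Section ChiralProduct.
Variables (R : realType) (V : VOA R) (W1 W2 M A : vmodule V).
Local Notation C := R[i].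
Variables (Y1 : W1 -> R -> M -> A) (Y2 : W2 -> R -> A -> M).
Hypotheses (hY1 : is_intertwining Y1) (hY2 : is_intertwining Y2).
Variable one : A.
Hypothesis mact_one : forall i : nat, mact (conf V) i one = 0.
Variable f : A -> C.
Hypothesis hf : linear (f : A -> C^o).
Hypothesis f_mL : forall (n : int) x, n <= 1 -> f (mL n x) = 0.
Variables l l' : C.
Local Notation z := (Cexp l).
Local Notation zeta := (Cexp l').

Definition expo (x y : R) : C := Cexp (x%:C * l + y%:C * l').

(** The contribution of the intermediate weight [q] to the value of [f] on the
    component of weight 0 of [Y1 a Y2 b one], for [a] and [b] of weights [ha] and
    [hb]. *)
Definition channel (a : W1) (ha : R) (b : W2) (hb q : R) : C :=
  expo (- ha - q) (q - hb) * f (Y1 a (ha + q - 1) (Y2 b (hb - 1 - q) one)).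

Lemma expoD x y x' y' (n m : nat) : x' = x + n%:R -> y' = y + m%:R ->
  expo x' y' = z ^+ n * zeta ^+ m * expo x y.
Proof.
move=> -> ->; rewrite /expo -!Cexp_nat -!CexpD; congr Cexp.
by rewrite !rmorphD/= !rmorph_nat; ring.
Qed.

Lemma expoB x y x' y' (n m : nat) : x' = x - n%:R -> y' = y + m%:R ->
  expo x' y' = zeta ^+ m * z ^- n * expo x y.
Proof.
move=> xE yE; have -> : expo x y = z ^+ n * expo x' y.
  by rewrite (@expoD x' y _ _ n 0) ?expr0 ?mulr1 ?addr0// xE subrK.
rewrite (@expoD x' y _ y' 0 m) ?expr0 ?mul1r ?addr0//.
by rewrite -[RHS]mulrA mulKf// expf_neq0// Cexp_neq0.
Qed.

Lemma channelE a b ha hb (q : R) : mL 0 a = ha%:C *: a -> mL 0 b = hb%:C *: b ->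
  f (io_eval (@mpr R V A) Y1 a l (io_eval (@mpr R V M) Y2 b l' one q) 0) =
  channel a ha b hb q.
Proof.
move=> ea eb; have e1 : mL 0 one = (0 : R)%:C *: one.
  by rewrite scale0r; exact: (mact_one 1).
rewrite (io_eval_homog hY2 l' q eb e1).
set c := Y2 _ _ _.
have ec : mL 0 c = q%:C *: c.
  by rewrite (io_wt hY2 _ eb e1); congr (_%:C *: _); ring.
rewrite (io_eval_homog hY1 l 0 ea (h2 := q)); last first.
  by rewrite (linZ (@mL_lin _ _ _ _)) ec !scalerA mulrC.
rewrite (linZ (io_linr hY1 _ _)) !(linZ hf) /channel /expo CexpD.
by rewrite /c sub0r addr0 !subr0 -mulrA.
Qed.

Lemma channel0 a ha b hb (q : R) :
  exists N0 : nat, forall j, (N0 <= j)%N -> channel a ha b hb (q - j%:R) = 0.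
Proof.
have [N hN] := io_trunc hY2 b one (hb - 1 - q).
exists N => j /hN E; rewrite /channel.
rewrite (_ : hb - 1 - (q - j%:R) = hb - 1 - q + j%:R); last by ring.
by rewrite E (lin0 (io_linr hY1 _ _)) (lin0 hf) mulr0.
Qed.

Section Homogeneous.
Variables (a : W1) (b : W2) (ha hb : R).

(** [f] annihilates the image of [L n], so that moving [L n] to the left
    through [Y1] leaves only the commutator. *)
Lemma f_comm (n : int) s s' (K : nat) : n <= 1 ->
  (forall i : nat, (K <= i)%N -> gbinom R (n + 1) i = 0 \/ mact (conf V) i a = 0) ->
  f (Y1 a s (mL n (Y2 b s' one))) =
  - \sum_(k < K) gbinom R (n + 1) k *
       f (Y1 (mact (conf V) k a) ((n + 1)%:~R + s - k%:R) (Y2 b s' one)).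
Proof.
move=> n1 hK; have := f_mL (Y1 a s (Y2 b s' one)) n1.
rewrite {1}/mL (jac_comm (io_jacobi hY1) (io_0l hY1) _ _ hK) (linD hf).
move=> /eqP; rewrite addr_eq0 => /eqP ->; rewrite (lin_sum hf).
by congr (- _); apply: eq_bigr => k _; rewrite (linZ hf).
Qed.

Lemma one_comm (n : int) s' (K : nat) : -1 <= n ->
  (forall i : nat, (K <= i)%N -> gbinom R (n + 1) i = 0 \/ mact (conf V) i b = 0) ->
  mL n (Y2 b s' one) =
  \sum_(k < K) gbinom R (n + 1) k *:
     Y2 (mact (conf V) k b) ((n + 1)%:~R + s' - k%:R) one.
Proof.
move=> n1 hK; rewrite {1}/mL (jac_comm (io_jacobi hY2) (io_0l hY2) _ _ hK).
have [m ->] : exists m : nat, n + 1 = m%:Z by exists `|(n + 1)%R|%N; lia.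
by rewrite mact_one (lin0 (io_linr hY2 _ _)) add0r.
Qed.

(** The Ward identity of the vector field [x^2 d/dx], which is regular at
    infinity: [f] annihilates the image of [L 1].  The two sums come from the
    expansions of the field at [z] and at [zeta]; the commutator with [Y2]
    shifts the intermediate weight by one. *)
Lemma channel_L1 q :
  \sum_(k < 3) 'C(2, k)%:R * z ^+ (2 - k) *
     channel (mact (conf V) k a) (ha + 1 - k%:R) b hb q +
  \sum_(k < 3) 'C(2, k)%:R * zeta ^+ (2 - k) *
     channel a ha (mact (conf V) k b) (hb + 1 - k%:R) (q - 1) = 0.
Proof.
have bin0' i : (3 <= i)%N -> gbinom R (1 + 1) i = 0.
  by move=> i3; rewrite -[1 + 1]/(2%:Z) gbinom_nat bin_small.
have := @f_comm 1 (ha + q - 2) (hb - 1 - q) 3 isT (fun i h => or_introl (bin0' i h)).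
rewrite (@one_comm 1 _ 3 isT (fun i h => or_introl (bin0' i h))).
rewrite (lin_sum (io_linr hY1 _ _)) (lin_sum hf) => /eqP; rewrite -addr_eq0 addrC.
move=> /eqP/(congr1 (fun x => expo (- ha + 1 - q) (q - hb) * x)).
rewrite mulr0 mulrDr !mulr_sumr => E; rewrite -[RHS]E.
congr (_ + _); apply: eq_bigr => k _.
- rewrite /channel -[1 + 1]/(2%:Z) gbinom_nat.
  have k2 : (k <= 2)%N by rewrite -ltnS.
  rewrite [expo (- ha + 1 - q) _](@expoD (- (ha + 1 - k%:R) - q) (q - hb)
    _ _ (2 - k) 0); first last.
  - by rewrite addr0.
  - by rewrite natrB//; ring.
  rewrite expr0 mulr1 (_ : (2%:~R + (ha + q - 2) - k%:R) = ha + 1 - k%:R + q - 1); last first.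
    by rewrite -[_%:~R]/(2%:R); ring.
  by ring.
- rewrite (linZ (io_linr hY1 _ _)) (linZ hf) /channel -[1 + 1]/(2%:Z) gbinom_nat.
  have k2 : (k <= 2)%N by rewrite -ltnS.
  rewrite [expo (- ha + 1 - q) _](@expoD (- ha - (q - 1)) (q - 1 - (hb + 1 - k%:R))
    _ _ 0 (2 - k)); first last.
  - by rewrite natrB//; ring.
  - by ring.
  rewrite expr0 mul1r (_ : (2%:~R + (hb - 1 - q) - k%:R) = hb + 1 - k%:R - 1 - (q - 1)); last first.
    by rewrite -[_%:~R]/(2%:R); ring.
  rewrite (_ : ha + (q - 1) - 1 = ha + q - 2); last by ring.
  by rewrite -[_ *: _]/(_ * _); ring.
Qed.

(** The vector field [1 / (x - z)] acts on the first insertion through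
    [L (-2)].  Expanding it in powers of [x / z] lets the modes [L (i - 1)]
    act on [Y2 b one]; in turn these expand at [zeta] with coefficients
    [C(i, k)], and [i = j + k] runs over the terms of the expansion of
    [(z - zeta)^(- k - 1)]. *)
Lemma channel_Lm2_left (K : nat) q :
  (forall i : nat, (K <= i)%N -> mact (conf V) i b = 0) ->
  exists N0 : nat, forall N, (N0 <= N)%N ->
  channel (mact (conf V) (-1) a) (ha + 2) b hb q =
  \sum_(k < K) \sum_(j < N) ('C(j + k, k)%:R * zeta ^+ j * z ^- (j + k).+1) *
     channel a ha (mact (conf V) k b) (hb + 1 - k%:R) (q + 1 - k%:R - j%:R).
Proof.
move=> hK; set s := ha + q + 1; set s' := hb - 1 - q.
set c := Y2 b s' one.
have [N1 hN1] := io_trunc hY1 a c s.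
have [N2 hN2] := wm_trunc (m_weak M) (conf V) c.
have [N3 hN3] := unif_bound K (fun k =>
  io_trunc hY2 (mact (conf V) k b) one (s' - k%:R)).
pose D (i k : nat) := 'C(i, k)%:R *
  f (Y1 a (s - 1 - i%:R) (Y2 (mact (conf V) k b) (i%:R + s' - k%:R) one)).
have DN3 i k : (k < K)%N -> (N3 <= i)%N -> D i k = 0.
  move=> kK Ni; rewrite /D.
  rewrite (_ : i%:R + s' - k%:R = s' - k%:R + i%:R); last by ring.
  by rewrite hN3// (lin0 (io_linr hY1 _ _)) (lin0 hf) mulr0.
exists (maxn N3 (maxn N1 `|N2|%N)) => N; rewrite !geq_max => /and3P[N3N N1N N2N].
have step : f (Y1 (mact (conf V) (-1) a) s c) = \sum_(i < N) \sum_(k < K) D i k.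
  rewrite (jac_iter (io_jacobi hY1) (N := N)); first last.
  - by move=> i Ni; rewrite hN2 ?(lin0 (io_linr hY1 _ _))//; lia.
  - by move=> i Ni; rewrite hN1//; exact: leq_trans Ni.
  - by move=> m; exact: (lin0 (@mact_linr _ _ _ _ _)).
  rewrite (lin_sum hf); apply: eq_bigr => i _; rewrite (linD hf).
  rewrite (_ : - i.+1%:Z = - i.+2%:Z + 1); last by lia.
  rewrite -[mact _ _ (Y1 _ _ _)]/(mL (- i.+2%:Z) _) f_mL; last by lia.
  have ii : (i%:Z - 1 + 1 = i) by lia.
  rewrite add0r -{1}ii -[mact _ _ c]/(mL (i%:Z - 1) c).
  rewrite (@one_comm _ _ K); [|lia|by move=> k /hK ->; right].
  rewrite ii (lin_sum (io_linr hY1 _ _)) (lin_sum hf); apply: eq_bigr => k _.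
  by rewrite (linZ (io_linr hY1 _ _)) (linZ hf) gbinom_nat.
rewrite /channel -/s' -/c (_ : ha + 2 + q - 1 = s); last by rewrite /s; ring.
rewrite step exchange_big/= mulr_sumr; apply: eq_bigr => k _.
have -> : \sum_(i < N) D i k = \sum_(i < k + N) D i k.
  apply: esym; apply: (sum_ord_widen (F := D^~ k)); first exact: leq_addl.
  by move=> i Ni; apply: DN3 => //; exact: leq_trans Ni.
rewrite (sum_ord_drop (F := D^~ k)); last first.
  by move=> i ik; rewrite /D bin_small// mul0r.
rewrite mulr_sumr; apply: eq_bigr => j _; rewrite /D.
rewrite [expo (- (ha + 2) - q) _](@expoB (- ha - (q + 1 - k%:R - j%:R))
  (q + 1 - k%:R - j%:R - (hb + 1 - k%:R)) _ _ (j + k).+1 j); first last.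
- by ring.
- by rewrite -[(j + k).+1]addn1 !natrD; ring.
rewrite (_ : s - 1 - (j + k)%:R = ha + (q + 1 - k%:R - j%:R) - 1); last first.
  by rewrite /s natrD; ring.
rewrite (_ : (j + k)%:R + s' - k%:R =
  hb + 1 - k%:R - 1 - (q + 1 - k%:R - j%:R)); last by rewrite /s' natrD; ring.
by ring.
Qed.

(** The same for [1 / (x - zeta)], which acts on the second insertion through
    [L (-2)]; here the modes are moved to the left through [Y1], towards [f]. *)
Lemma channel_Lm2_right (K : nat) q :
  (forall i : nat, (K <= i)%N -> mact (conf V) i a = 0) ->
  exists N0 : nat, forall N, (N0 <= N)%N ->
  channel a ha (mact (conf V) (-1) b) (hb + 2) q =
  \sum_(k < K) - (-1) ^+ k *
   \sum_(j < N) ('C(j + k, k)%:R * zeta ^+ j * z ^- (j + k).+1) *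
     channel (mact (conf V) k a) (ha + 1 - k%:R) b hb (q - 2 - j%:R).
Proof.
move=> hK; set s := ha + q - 1; set s' := hb + 1 - q.
have [N0 hN0] := io_trunc hY2 b one s'.
exists N0 => N N0N.
have step : f (Y1 a s (Y2 (mact (conf V) (-1) b) s' one)) =
  \sum_(j < N) - \sum_(k < K) ((-1) ^+ k * 'C(j + k, k)%:R) *
     f (Y1 (mact (conf V) k a) (- j.+1%:R + s - k%:R) (Y2 b (s' + j%:R) one)).
  rewrite (jac_iter (io_jacobi hY2) (N := N)); first last.
  - by move=> i Ni; rewrite mact_one (lin0 (io_linr hY2 _ _)).
  - by move=> i Ni; rewrite hN0//; exact: leq_trans Ni.
  - by move=> m; exact: (lin0 (@mact_linr _ _ _ _ _)).
  rewrite (lin_sum (io_linr hY1 _ _)) (lin_sum hf); apply: eq_bigr => j _.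
  rewrite mact_one (lin0 (io_linr hY2 _ _)) addr0.
  have jj : - j.+1%:Z = - j.+2%:Z + 1 by lia.
  rewrite jj -[mact _ _ (Y2 _ _ _)]/(mL (- j.+2%:Z) _).
  rewrite (@f_comm _ _ _ K); [|lia|by move=> k /hK ->; right].
  congr (- _); apply: eq_bigr => k _; rewrite -jj gbinom_neg.
  by congr (_ * f (Y1 _ (_ + _ - _) _)); rewrite mulrNz.
rewrite /channel -/s (_ : hb + 2 - 1 - q = s'); last by rewrite /s'; ring.
rewrite step sumrN exchange_big/= mulrN mulr_sumr -sumrN; apply: eq_bigr => k _.
rewrite mulNr; congr (- _); rewrite !mulr_sumr; apply: eq_bigr => j _.
rewrite [expo _ (q - (hb + 2))](@expoB (- (ha + 1 - k%:R) - (q - 2 - j%:R)) (q - 2 - j%:R - hb)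
  _ _ (j + k).+1 j); first last.
- by ring.
- by rewrite -[(j + k).+1]addn1 !natrD; ring.
rewrite (_ : - j.+1%:R + s - k%:R = ha + 1 - k%:R + (q - 2 - j%:R) - 1); last first.
  by rewrite /s -natr1; ring.
rewrite (_ : s' + j%:R = hb - 1 - (q - 2 - j%:R)); last by rewrite /s'; ring.
by ring.
Qed.

Hypothesis zz : Cnorm zeta < Cnorm z.

Lemma ward_L1 (PA PB : nat -> C) :
  (forall k : nat, net_sum (channel (mact (conf V) k a) (ha + 1 - k%:R) b hb) (PA k)) ->
  (forall k : nat, net_sum (channel a ha (mact (conf V) k b) (hb + 1 - k%:R)) (PB k)) ->
  \sum_(k < 3) 'C(2, k)%:R * z ^+ (2 - k) * PA k +
  \sum_(k < 3) 'C(2, k)%:R * zeta ^+ (2 - k) * PB k = 0.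
Proof.
move=> hA hB; apply: (net_sum_uniq (I := R)) (@net_sum0 R R).
rewrite (_ : (fun _ : R => 0) = fun q =>
  \sum_(k < 3) 'C(2, k)%:R * z ^+ (2 - k) *
     channel (mact (conf V) k a) (ha + 1 - k%:R) b hb q +
  \sum_(k < 3) 'C(2, k)%:R * zeta ^+ (2 - k) *
     channel a ha (mact (conf V) k b) (hb + 1 - k%:R) (q - 1)).
  apply: net_sumD; apply: net_sum_sum => k; apply: net_sumZ; first exact: hA.
  exact: net_sum_shift.
by apply/funext => q; rewrite channel_L1.
Qed.

Lemma ward_Lm2_left (K : nat) (P : C) (PB : nat -> C) :
  (forall i : nat, (K <= i)%N -> mact (conf V) i b = 0) ->
  net_sum (channel (mact (conf V) (-1) a) (ha + 2) b hb) P ->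
  (forall k : nat, net_sum (channel a ha (mact (conf V) k b) (hb + 1 - k%:R)) (PB k)) ->
  P = \sum_(k < K) (z - zeta) ^- k.+1 * PB k.
Proof.
move=> hK hP hB; apply: (net_sum_uniq hP).
pose F (k : nat) q j := ('C(j + k, k)%:R * zeta ^+ j * z ^- (j + k).+1) *
     channel a ha (mact (conf V) k b) (hb + 1 - k%:R) (q + 1 - k%:R - j%:R).
have F0 k q : exists N0 : nat, forall j, (N0 <= j)%N -> F k q j = 0.
  have [N0 h0] := channel0 a ha (mact (conf V) k b) (hb + 1 - k%:R) (q + 1 - k%:R).
  by exists N0 => j /h0 E; rewrite /F E mulr0.
pose al k q := \sum_(j \in [set: nat]) F k q j.
rewrite (_ : channel _ _ _ _ = fun q => \sum_(k < K) al k q); last first.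
  apply/funext => q; have [N1 h1] := channel_Lm2_left q hK.
  have [N2 h2] := unif_bound K (F0^~ q).
  rewrite (h1 (maxn N1 N2) (leq_maxl _ _)); apply: eq_bigr => k _.
  rewrite /al (@fsum_nat _ _ (maxn N1 N2))// => i.
  by rewrite geq_max => /andP[_ /h2]; exact.
apply: net_sum_sum => k; apply: (net_sum_binom (c := 1 - k%:R) zz (hB k)) => q.
have [N0 h0] := F0 k q; exists N0 => N NN; rewrite /al (@fsum_nat _ _ N).
  by apply: eq_bigr => j _; rewrite /F addrA.
by move=> i Ni; apply: h0; exact: leq_trans Ni.
Qed.

Lemma ward_Lm2_right (K : nat) (P : C) (PA : nat -> C) :
  (forall i : nat, (K <= i)%N -> mact (conf V) i a = 0) ->
  net_sum (channel a ha (mact (conf V) (-1) b) (hb + 2)) P ->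
  (forall k : nat, net_sum (channel (mact (conf V) k a) (ha + 1 - k%:R) b hb) (PA k)) ->
  P = \sum_(k < K) (zeta - z) ^- k.+1 * PA k.
Proof.
move=> hK hP hA; apply: (net_sum_uniq hP).
pose F (k : nat) q j := ('C(j + k, k)%:R * zeta ^+ j * z ^- (j + k).+1) *
     channel (mact (conf V) k a) (ha + 1 - k%:R) b hb (q - 2 - j%:R).
have F0 k q : exists N0 : nat, forall j, (N0 <= j)%N -> F k q j = 0.
  have [N0 h0] := channel0 (mact (conf V) k a) (ha + 1 - k%:R) b hb (q - 2).
  by exists N0 => j /h0 E; rewrite /F E mulr0.
pose al k q := \sum_(j \in [set: nat]) F k q j.
rewrite (_ : channel _ _ _ _ = fun q => \sum_(k < K) - (-1) ^+ k * al k q); last first.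
  apply/funext => q; have [N1 h1] := channel_Lm2_right q hK.
  have [N2 h2] := unif_bound K (F0^~ q).
  rewrite (h1 (maxn N1 N2) (leq_maxl _ _)); apply: eq_bigr => k _.
  rewrite /al (@fsum_nat _ _ (maxn N1 N2))// => i.
  by rewrite geq_max => /andP[_ /h2]; exact.
rewrite (_ : \sum_(k < K) (zeta - z) ^- k.+1 * PA k =
  \sum_(k < K) - (-1) ^+ k * ((z - zeta) ^- k.+1 * PA k)); last first.
  apply: eq_bigr => k _; rewrite mulrA; congr (_ * _).
  rewrite -(opprB z zeta) [(- (z - zeta)) ^+ _]exprNn invfM; congr (_ * _).
  by rewrite exprS mulN1r invrN -exprVn invrN1.
apply: net_sum_sum => k; apply: net_sumZ.
apply: (net_sum_binom (c := - 2) zz (hA k)) => q.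
have [N0 h0] := F0 k q; exists N0 => N NN; rewrite /al (@fsum_nat _ _ N)//.
by move=> i Ni; apply: h0; exact: leq_trans Ni.
Qed.
End Homogeneous.
End ChiralProduct.

(** * Vacuum-like vectors in the open sector *)

Section VacuumLike.
Variables (R : realType) (V : VOA R).
Local Notation C := R[i].

(** Since [n v_(n-1) u = - L(-1) v_n u], the vanishing of [v_n u] for large [n]
    propagates down to [n = 0]. *)
Lemma vacuum_like (W : vmodule V) (u : W) (v : V) (n : int) :
  mL (-1) u = 0 -> 0 <= n -> mact v n u = 0.
Proof.
move=> hu n0; have [N hN] := wm_trunc (m_weak W) v u.
suff H : forall (k : nat) (n : int), 0 <= n -> N - k%:Z <= n -> mact v n u = 0.
  by apply: (H `|N|%N) => //; lia.
elim=> [|k IHk] {n0}n n0 hn; first by apply: hN; lia.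
have := mL_Nmode v (n + 1) u; rewrite (IHk (n + 1)); [|lia|lia].
rewrite (lin0 (@mL_lin _ _ _ _)) hu (lin0 (@mact_linr _ _ _ _ _)) sub0r addrK.
move=> /esym/eqP; rewrite oppr_eq0 scaler_eq0 intr_eq0 => /orP[/eqP|/eqP//].
by lia.
Qed.

Lemma mL0_vacuum_like (W : vmodule V) (u : W) : mL (-1) u = 0 -> mL 0 u = 0.
Proof. by move=> hu; exact: vacuum_like. Qed.

Section Form.
Variables (A : open_string_VOA V) (B : A -> A -> C).
Hypothesis hB : invariant_form_op B.

Lemma Bop_linr x : linear (B x : A -> C^o).
Proof. exact: form_linr (opf_form hB) x. Qed.

Lemma Bop_linl y : linear (B^~ y : A -> C^o).
Proof. exact: form_linl (opf_form hB) y. Qed.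

Lemma Bop_orth (h g : R) x y :
  mL 0 x = h%:C *: x -> mL 0 y = g%:C *: y -> h != g -> B x y = 0.
Proof.
move=> hx gy hg; have /(gradE_pr (m_grading A)) <- : eigenvectors (mL 0) h%:C x by [].
have /(gradE_pr (m_grading A)) <- : eigenvectors (mL 0) g%:C y by [].
exact: form_graded (opf_form hB) _ _ _ _ hg.
Qed.

Lemma op_iotaE n v : mact v n (op_one A) = op_iota A (vmode v n (vac V)).
Proof. by rewrite op_iota_mod. Qed.

Lemma mact_op_one v (i : nat) : mact v i (op_one A) = 0.
Proof. by rewrite op_iotaE vmode_creation0// (lin0 (op_iota_lin A)). Qed.

Lemma mL_op_omega n : mL n (op_omega A) = op_iota A (vL n (conf V)).
Proof. by rewrite /mL -op_iota_mod. Qed.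

Lemma op_omega_wt : mL 0 (op_omega A) = 2%:C *: op_omega A.
Proof.
by rewrite mL_op_omega vL0_conf (linZ (op_iota_lin A)) rmorph_nat.
Qed.

Lemma op_flip_omega : op_flip 1 (op_omega A) = op_omega A.
Proof.
rewrite /op_flip ln1 mulr0 /exp_L0 (@fsum_one _ _ _ 2); last first.
  move=> h h2; rewrite (grad_pr (m_grading A) h (j := 2)) ?(negPf h2) ?scaler0//.
  exact: op_omega_wt.
rewrite mulr0 Cexp0 scale1r (grad_pr (m_grading A) 2 (j := 2)) ?eqxx; last first.
  exact: op_omega_wt.
rewrite /exp_L1 (@fsum_one _ _ _ 0%N) ?expr0 ?fact0 ?divr1 ?scale1r//.
case=> // k _; rewrite iterSr mL_op_omega vL1_conf (lin0 (op_iota_lin A)).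
by rewrite (iter_lin0 _ (@mL_lin _ _ _ _)) scaler0.
Qed.

Lemma iter_mLm1_wt (k : nat) (h : R) (x : A) : mL 0 x = h%:C *: x ->
  mL 0 (iter k (mL (-1)) x) = (h + k%:R)%:C *: iter k (mL (-1)) x.
Proof.
move=> hx; elim: k => [|k IHk]; first by rewrite addr0.
rewrite iterS (mL_wt _ IHk); congr (_%:C *: _).
by rewrite -natr1 mulrN1z opprK addrA.
Qed.

(** For a vacuum-like [u] the operator [Y(u, x)] is independent of [x], so
    that [Y(u, s) omega] is homogeneous of weight 2.  By invariance
    [(u, Y(omega, 1) x)] pairs [x] with [exp(- L(-1)) Y(u, 1) omega], the
    components of which have weights at least 2; hence it vanishes when the
    weight of [x] is at most 1. *)
Lemma vacuum_like_orth (u : A) (n : int) x :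
  mL (-1) u = 0 -> n <= 1 -> B u (mL n x) = 0.
Proof.
move=> hu n1; have u0 : mL 0 u = (0 : R)%:C *: u.
  by rewrite scale0r mL0_vacuum_like.
have Yu s w : s != -1 -> op_Yf u s w = 0.
  move=> s1; have := io_deriv (op_io A) u (s + 1) w.
  rewrite hu (io_0l (op_io A)) addrK => /esym/eqP; rewrite scaler_eq0 oppr_eq0.
  rewrite -[0]/((0 : R)%:C) (inj_eq (@complexI R)) addr_eq0 (negPf s1) => /eqP.
  by rewrite /=.
move: x; apply: (grad_ind (m_grading A)).
- by rewrite (lin0 (@mL_lin _ _ _ _)) (lin0 (Bop_linr u)).
- by move=> x y hx hy; rewrite (linD (@mL_lin _ _ _ _)) (linD (Bop_linr u)) hx hy addr0.
move=> h x hx; have [hn|hn] := eqVneq h n%:~R; last first.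
  by apply: (Bop_orth u0 (mL_wt n hx)); rewrite eq_sym subr_eq0.
have := opf_inv1 hB (op_omega A) x u ltr01.
rewrite invr1 op_flip_omega /pair_right (@fsum_one _ _ _ 0); last first.
  move=> p p0; rewrite /Yop /Yop_of (io_eval_homog (op_io A) _ p op_omega_wt hx).
  rewrite (linZ (Bop_linr u)) (@Bop_orth 0 p) ?scaler0 1?eq_sym//.
  by rewrite (io_wt (op_io A) _ op_omega_wt hx); congr (_%:C *: _); ring.
rewrite /Yop /Yop_of (io_eval_homog (op_io A) _ 0 op_omega_wt hx) ln1 mulr0 Cexp0.
rewrite scale1r (_ : 2 + h - 1 - 0 = (n + 1)%:~R); last first.
  by rewrite hn intrD; ring.
rewrite op_Yf_iota_int -/(mL n x) => ->; apply: fsum_zero => p.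
set y := op_Yf u (-1) (op_omega A).
have y2 : mL 0 y = 2%:C *: y.
  by rewrite (io_wt (op_io A) _ u0 op_omega_wt); congr (_%:C *: _); ring.
have Yop2 q : q != 2 -> Yop_of (@op_Yf R V A) u 1 (op_omega A) q = 0.
  move=> q2; rewrite /Yop_of (io_eval_homog (op_io A) _ q u0 op_omega_wt) Yu ?scaler0//.
  by apply/eqP => E; move/eqP: q2; apply; lra.
rewrite /Yopneg_of /exp_Lm1.
have [[k pk]|hk] := pselect (exists k : nat, p = 2 + k%:R); last first.
  rewrite fsum_zero ?(lin0 (Bop_linl x))// => k; rewrite Yop2; last first.
    by apply/eqP => E; apply: hk; exists k; rewrite -E subrK.
  by rewrite (iter_lin0 _ (@mL_lin _ _ _ _)) scaler0.
rewrite (@fsum_one _ _ _ k); last first.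
  move=> j jk; rewrite Yop2 ?(iter_lin0 _ (@mL_lin _ _ _ _)) ?scaler0//.
  apply: contra jk => /eqP; rewrite pk => E; apply/eqP.
  by apply/(mulrIn (oner_neq0 R))/esym; lra.
rewrite (linZ (Bop_linl x)) (@Bop_orth p h) ?scaler0//.
  rewrite pk addrK; apply: iter_mLm1_wt; rewrite /Yop_of.
  rewrite (io_eval_homog (op_io A) _ 2 u0 op_omega_wt) (linZ (@mL_lin _ _ _ _)).
  rewrite (io_wt (op_io A) _ u0 op_omega_wt) !scalerA mulrC.
  by congr ((_%:C * _) *: _); ring.
rewrite pk hn; apply/eqP => E.
have : (n%:~R : R) <= 1 by rewrite -[1]/(1%:~R) ler_int.
by rewrite -E; have := ler0n R k; lra.
Qed.
End Form.
End VacuumLike.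

(** * Ward identities in the open-closed algebra *)

Lemma Cexp_Clogbar (R : realType) (zeta : R[i]) :
  zeta != 0 -> Cexp (Clogbar zeta) = zeta.
Proof.
move=> z0; rewrite /Clogbar Cexp_conj Cexp_Clog; first exact: conjcK.
by apply: contra z0; rewrite -!Cnorm_eq0 CnormJ.
Qed.

Section Continuity.
Variables (R : realType) (z0 : R[i]^o).
Local Notation C := R[i].
Implicit Types F G : C -> C.

Definition cts F := {for z0, continuous (F : C^o -> C^o)}.

Lemma cts_cst c : cts (fun=> c).
Proof. exact: cst_continuous. Qed.

Lemma ctsD F G : cts F -> cts G -> cts (fun z => F z + G z).
Proof. exact: continuousD. Qed.

Lemma ctsB F G : cts F -> cts G -> cts (fun z => F z - G z).
Proof. exact: continuousB. Qed.

Lemma ctsM F G : cts F -> cts G -> cts (fun z => F z * G z).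
Proof. exact: continuousM. Qed.

Lemma ctsX F n : cts F -> cts (fun z => F z ^+ n).
Proof.
move=> hF; elim: n => [|n IHn]; first exact: cts_cst.
by under [X in cts X]eq_fun do rewrite exprS; exact: ctsM.
Qed.

Lemma ctsVX F n : F z0 != 0 -> cts F -> cts (fun z => F z ^- n).
Proof.
by move=> F0 hF; apply: continuousV; [exact: expf_neq0|exact: ctsX].
Qed.

Lemma cts_sum (I : Type) (r : seq I) (F : I -> C -> C) :
  (forall i, cts (F i)) -> cts (fun z => \sum_(i <- r) F i z).
Proof.
move=> hF; elim: r => [|i r IHr].
  by under [X in cts X]eq_fun do rewrite big_nil; exact: cts_cst.
have -> : (fun z => \sum_(j <- i :: r) F j z) =
    (fun z => F i z + \sum_(j <- r) F j z) by apply/funext => z; rewrite big_cons.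
exact: (ctsD (hF i) IHr).
Qed.
End Continuity.

(** The points [(1 + t) z0] with [t > 0] have larger modulus than [z0] and
    tend to it. *)
Lemma cts_eq0_outer (R : realType) (H : R[i] -> R[i]) (z0 : R[i]) :
  upper_half z0 -> cts z0 H ->
  (forall z, upper_half z -> Cnorm z0 < Cnorm z -> H z = 0) -> H z0 = 0.
Proof.
move=> hz0 /cvgrPdist_lt cH H0; apply/eqP/negPn/negP => d0.
have := cH `|H z0|; rewrite normr_gt0 => /(_ d0)/nbhs_ballP[e /= e0 he].
have [r r0 re] : exists2 r : R, 0 < r & r%:C = e.
  exists (complex.Re e); first by move: e0; rewrite ltcE => /andP[].
  by move: e0; rewrite ltcE => /andP[/eqP/= + _]; case: (e) => a b /= ->.
have n0 : 0 < Cnorm z0.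
  by rewrite Cnorm_gt0; apply/eqP => E; move: hz0; rewrite /upper_half/= E ltxx.
pose t := r / 2 / Cnorm z0.
have t0 : 0 < t by rewrite !divr_gt0.
pose z := (1 + t)%:C * z0.
have zz : Cnorm z0 < Cnorm z.
  have -> : Cnorm z = (1 + t) * Cnorm z0.
    rewrite CnormM; congr (_ * _); apply: (@complexI R).
    by rewrite -normCE ger0_norm// ler0c addr_ge0// ltW.
  by rewrite ltr_pMl// ltrDl.
have hz : upper_half z.
  move: hz0; rewrite /upper_half/= /z; case: (z0) => a b /=.
  by rewrite mul0r addr0 => b0; rewrite mulr_gt0// addr_gt0.
have bz : ball (z0 : R[i]^o) e (z : R[i]^o).
  rewrite -ball_normE/= -re (_ : z0 - z = - (t%:C * z0)); last first.
    by rewrite /z rmorphD/= rmorph1; ring.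
  rewrite normrN normrM ger0_norm ?ler0c ?(ltW t0)// normCE -rmorphM/= ltcR.
  by rewrite /t divfK ?gt_eqF//; lra.
by have := he z bz; rewrite (H0 z hz zz) subr0 ltxx.
Qed.

Lemma cts_eq_outer (R : realType) (F G : R[i] -> R[i]) (z0 : R[i]) :
  upper_half z0 -> cts z0 F -> cts z0 G ->
  (forall z, upper_half z -> Cnorm z0 < Cnorm z -> F z = G z) -> F z0 = G z0.
Proof.
move=> hz0 cF cG FG; apply/eqP; rewrite -subr_eq0; apply/eqP.
apply: (cts_eq0_outer hz0 (ctsB cF cG)) => z hz zz.
by rewrite FG// subrr.
Qed.

Section OpenClosedWard.
Variables (R : realType) (V T : VOA R) (tau : V -> V -> T).
Local Notation C := R[i].
Variables (A : open_closed_field_algebra tau) (Bop : oc_op A -> oc_op A -> C).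
Hypothesis hBop : invariant_form_op Bop.
Variable u : oc_op A.
Hypothesis hu : mL (-1) u = 0.
Local Notation one := (op_one (oc_op A)).

(** The matrix coefficient [(u, Y(w; z, zeta) 1)]: since [u] has weight 0, only
    the component of weight 0 pairs with it. *)
Definition bdry (z zeta : C) (w : oc_cl A) : C := Bop u (Yco w z zeta one 0).

Definition Lmode (n : int) (w : oc_cl A) := mact (tau (conf V) (vac V)) n w.
Definition Rmode (n : int) (w : oc_cl A) := mact (tau (vac V) (conf V)) n w.

Lemma Lmode_lin n : linear (Lmode n).
Proof. exact: mact_linr. Qed.

Lemma Rmode_lin n : linear (Rmode n).
Proof. exact: mact_linr. Qed.

Lemma bdry_lin z zeta : upper_half z -> lower_half zeta ->
  linear (bdry z zeta : oc_cl A -> C^o).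
Proof.
move=> hz hzeta c x y; rewrite /bdry (oc_bilin A 0 hz hzeta).1.
exact: (Bop_linr hBop).
Qed.

(** The three families of Ward identities, for the vector fields [x^2],
    [1 / (x - z)] and [1 / (x - zeta)].  The bounds of the sums are existential
    for the set of such [w] to be closed under addition. *)
Definition ward (z zeta : C) (w : oc_cl A) : Prop :=
  [/\ \sum_(k < 3) 'C(2, k)%:R * z ^+ (2 - k) * bdry z zeta (Lmode k w) +
      \sum_(k < 3) 'C(2, k)%:R * zeta ^+ (2 - k) * bdry z zeta (Rmode k w) = 0,
      exists K0 : nat, forall K, (K0 <= K)%N -> bdry z zeta (Lmode (-1) w) =
        \sum_(k < K) (z - zeta) ^- k.+1 * bdry z zeta (Rmode k w)
    & exists K0 : nat, forall K, (K0 <= K)%N -> bdry z zeta (Rmode (-1) w) =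
        \sum_(k < K) (zeta - z) ^- k.+1 * bdry z zeta (Lmode k w)].

Section Ward.
Variables (z zeta : C).
Hypotheses (hz : upper_half z) (hzeta : lower_half zeta).
Let lin := bdry_lin hz hzeta.

Lemma ward0 : ward z zeta 0.
Proof.
have E n : bdry z zeta (Lmode n 0) = 0 by rewrite (lin0 (Lmode_lin n)) (lin0 lin).
have F n : bdry z zeta (Rmode n 0) = 0 by rewrite (lin0 (Rmode_lin n)) (lin0 lin).
split; [|exists 0%N => K _; rewrite E|exists 0%N => K _; rewrite F].
- by rewrite !big1 ?addr0// => k _; rewrite ?E ?F mulr0.
- by rewrite big1// => k _; rewrite F mulr0.
- by rewrite big1// => k _; rewrite E mulr0.
Qed.

Lemma wardD x y : ward z zeta x -> ward z zeta y -> ward z zeta (x + y).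
Proof.
have E n : bdry z zeta (Lmode n (x + y)) =
    bdry z zeta (Lmode n x) + bdry z zeta (Lmode n y).
  by rewrite (linD (Lmode_lin n)) (linD lin).
have F n : bdry z zeta (Rmode n (x + y)) =
    bdry z zeta (Rmode n x) + bdry z zeta (Rmode n y).
  by rewrite (linD (Rmode_lin n)) (linD lin).
move=> [x1 [Kx hx] [Kx' hx']] [y1 [Ky hy] [Ky' hy']]; split.
- under eq_bigr do rewrite E mulrDr.
  under [X in _ + X]eq_bigr do rewrite F mulrDr.
  by rewrite !big_split/= addrACA x1 y1 addr0.
- exists (maxn Kx Ky) => K; rewrite geq_max => /andP[/hx ex /hy ey].
  under eq_bigr do rewrite F mulrDr.
  by rewrite E big_split/= -ex -ey.
- exists (maxn Kx' Ky') => K; rewrite geq_max => /andP[/hx' ex /hy' ey].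
  under eq_bigr do rewrite E mulrDr.
  by rewrite F big_split/= -ex -ey.
Qed.

Hypothesis zz : Cnorm zeta < Cnorm z.

(** The closed sector is spanned by tensors of homogeneous vectors, on which
    [bdry] is the sum of the channels. *)
Lemma ward_chiral (w : oc_cl A) : ward z zeta w.
Proof.
have [k [WL [WR [M [t [Y1 [Y2 [tB tM tS tI tE]]]]]]]] := oc_chiral A.
have [s ->] := tS w; apply: big_ind; [exact: ward0|exact: wardD|] => -[i [a b]] _ /=.
have [hY1 hY2] := tI i.
have Lt n x y : Lmode n (t i x y) = t i (mact (conf V) n x) y by have [] := tM i (conf V) n x y.
have Rt n x y : Rmode n (t i x y) = t i x (mact (conf V) n y) by have [] := tM i (conf V) n x y.
move: a; apply: (grad_ind (m_grading (WL i))).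
- by rewrite (lin0 ((tB i).1 b)); exact: ward0.
- by move=> x y hx hy; rewrite (linD ((tB i).1 b)); exact: wardD.
move=> ha a ea; move: b; apply: (grad_ind (m_grading (WR i))).
- by rewrite (lin0 ((tB i).2 a)); exact: ward0.
- by move=> x y hx hy; rewrite (linD ((tB i).2 a)); exact: wardD.
move=> hb b eb.
have z0 : z != 0 by apply/eqP => E; move: hz; rewrite /upper_half/= E ltxx.
have zeta0 : zeta != 0 by apply/eqP => E; move: hzeta; rewrite /lower_half/= E ltxx.
pose l := Clog z; pose l' := Clogbar zeta.
have zE : Cexp l = z by exact: Cexp_Clog.
have zetaE : Cexp l' = zeta by exact: Cexp_Clogbar.
have hf := Bop_linr hBop u.
have f_mL n x : n <= 1 -> Bop u (mL n x) = 0 by exact: vacuum_like_orth.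
pose fS : {scalar oc_op A} := HB.pack (Bop u)
  (GRing.isLinear.Build C (oc_op A) C^o *:%R (Bop u) hf).
have net a' b' ga gb : mL 0 a' = ga%:C *: a' -> mL 0 b' = gb%:C *: b' ->
  net_sum (channel (Y1 i) (Y2 i) one (Bop u) l l' a' ga b' gb)
    (bdry z zeta (t i a' b')).
  move=> ea' eb'.
  rewrite (_ : channel _ _ _ _ _ _ _ _ _ _ = fun q => Bop u
    (io_eval (@mpr R V (oc_op A)) (Y1 i) a' l
      (io_eval (@mpr R V (M i)) (Y2 i) b' l' one q) 0)).
    exact: (tE i a' b' one z zeta fS 0 hz hzeta zz).2.
  apply/funext => q; apply: esym.
  by apply: channelE => //; exact: mact_op_one.
have wtm (W : vmodule V) (x : W) (g : R) (n : int) : mL 0 x = g%:C *: x ->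
    mL 0 (mact (conf V) n x) = (g + 1 - n%:~R)%:C *: mact (conf V) n x.
  move=> ex; have := mL_wt (n - 1) ex; rewrite /mL subrK => ->.
  by congr (_%:C *: _); rewrite intrB; ring.
have zz' : Cnorm (Cexp l') < Cnorm (Cexp l) by rewrite zE zetaE.
have netA (n : nat) : net_sum (channel (Y1 i) (Y2 i) one (Bop u) l l'
    (mact (conf V) n a) (ha + 1 - n%:R) b hb) (bdry z zeta (Lmode n (t i a b))).
  by rewrite Lt; apply: net => //; exact: wtm.
have netB (n : nat) : net_sum (channel (Y1 i) (Y2 i) one (Bop u) l l'
    a ha (mact (conf V) n b) (hb + 1 - n%:R)) (bdry z zeta (Rmode n (t i a b))).
  by rewrite Rt; apply: net => //; exact: wtm.
have netL : net_sum (channel (Y1 i) (Y2 i) one (Bop u) l l'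
    (mact (conf V) (-1) a) (ha + 2) b hb) (bdry z zeta (Lmode (-1) (t i a b))).
  rewrite Lt; apply: net => //; rewrite (wtm _ _ ha)//.
  by rewrite (_ : ha + 1 - (-1)%:~R = ha + 2)//; rewrite mulrN1z; ring.
have netR : net_sum (channel (Y1 i) (Y2 i) one (Bop u) l l'
    a ha (mact (conf V) (-1) b) (hb + 2)) (bdry z zeta (Rmode (-1) (t i a b))).
  rewrite Rt; apply: net => //; rewrite (wtm _ _ hb)//.
  by rewrite (_ : hb + 1 - (-1)%:~R = hb + 2)//; rewrite mulrN1z; ring.
have one0 (j : nat) : mact (conf V) j one = 0 by exact: mact_op_one.
split.
- have := ward_L1 hY1 hY2 one0 hf f_mL netA netB.
  by rewrite zE zetaE.
- have [K hK] := wm_trunc (m_weak (WR i)) (conf V) b.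
  exists `|K|%N => K' KK.
  have hK' (j : nat) : (K' <= j)%N -> mact (conf V) j b = 0.
    by move=> Kj; apply: hK; lia.
  have := ward_Lm2_left hY1 hY2 one0 hf f_mL zz' hK' netL netB.
  by rewrite zE zetaE.
- have [K hK] := wm_trunc (m_weak (WL i)) (conf V) a.
  exists `|K|%N => K' KK.
  have hK' (j : nat) : (K' <= j)%N -> mact (conf V) j a = 0.
    by move=> Kj; apply: hK; lia.
  have := ward_Lm2_right hY1 hY2 one0 hf f_mL zz' hK' netR netA.
  by rewrite zE zetaE.
Qed.
End Ward.

Section AtConjugatePoints.
Variable z0 : C.
Hypothesis hz0 : upper_half z0.
Local Notation zeta := (z0^*).
Local Notation phi := (bdry z0 zeta).
Implicit Type w : oc_cl A.

Lemma conj_lower : lower_half zeta.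
Proof. by move: hz0; rewrite /upper_half /lower_half/=; case: z0 => a b /= ?; rewrite oppr_lt0. Qed.

Lemma conj_neq : z0 - zeta != 0.
Proof.
apply/eqP => /(congr1 (@complex.Im R)); move: hz0; rewrite /upper_half/=.
by case: z0 => a b /= b0; rewrite opprK => E; move: b0; rewrite ltNge; lra.
Qed.

Lemma cts_bdry w : cts z0 (fun z => bdry z zeta w).
Proof.
pose fS : {scalar oc_op A} := HB.pack (Bop u)
  (GRing.isLinear.Build C (oc_op A) C^o *:%R (Bop u) (Bop_linr hBop u)).
have [d _] := oc_deriv_z w one fS 0 hz0 conj_lower.
by move/derivable1_diffP/differentiable_continuous: d.
Qed.

(** The conjugate of [z0] has the same modulus as [z0], so [z0] itself lies on
    the boundary of the region in which the chiral products converge; the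
    identities reach it by continuity in [z] with [zeta] fixed. *)
Lemma outer_ward z w : upper_half z -> Cnorm z0 < Cnorm z -> ward z zeta w.
Proof. by move=> hz zz; apply: ward_chiral => //; [exact: conj_lower|rewrite CnormJ]. Qed.

Lemma bdry_L1 w :
  \sum_(k < 3) 'C(2, k)%:R * z0 ^+ (2 - k) * phi (Lmode k w) +
  \sum_(k < 3) 'C(2, k)%:R * zeta ^+ (2 - k) * phi (Rmode k w) = 0.
Proof.
pose F z := \sum_(k < 3) 'C(2, k)%:R * z ^+ (2 - k) * bdry z zeta (Lmode k w) +
  \sum_(k < 3) 'C(2, k)%:R * zeta ^+ (2 - k) * bdry z zeta (Rmode k w).
apply: (@cts_eq_outer _ F (fun=> 0) z0 hz0); last first.
- by move=> z hz zz; have [] := outer_ward w hz zz.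
- exact: cts_cst.
apply: ctsD; apply: cts_sum => k; apply: ctsM; try exact: cts_bdry.
- by apply: ctsM; [exact: cts_cst|apply: ctsX; exact: cvg_id].
- exact: cts_cst.
Qed.

Lemma sum_ord_trunc (F : nat -> C) (K : nat) :
  (forall k, (K <= k)%N -> F k = 0) -> forall y,
  (exists K0 : nat, forall K', (K0 <= K')%N -> y = \sum_(k < K') F k) ->
  y = \sum_(k < K) F k.
Proof.
move=> F0 y [K0 /(_ _ (leq_maxl K0 K)) ->].
by apply: sum_ord_widen => //; exact: leq_maxr.
Qed.

Lemma bdry_Lm2 w (K : nat) : (forall k : nat, (K <= k)%N -> Rmode k w = 0) ->
  phi (Lmode (-1) w) = \sum_(k < K) (z0 - zeta) ^- k.+1 * phi (Rmode k w).
Proof.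
move=> hK; pose G z := \sum_(k < K) (z - zeta) ^- k.+1 * bdry z zeta (Rmode k w).
apply: (@cts_eq_outer _ (fun z => bdry z zeta (Lmode (-1) w)) G z0 hz0).
- exact: cts_bdry.
- apply: cts_sum => k; apply: ctsM; last exact: cts_bdry.
  apply: ctsVX; first exact: conj_neq.
  by apply: ctsD; [exact: cvg_id|exact: cts_cst].
- move=> z hz zz; have [_ h _] := outer_ward w hz zz.
  apply: (@sum_ord_trunc (fun k : nat => (z - zeta) ^- k.+1 * bdry z zeta (Rmode k w))
    _ _ _ h) => k /hK ->.
  by rewrite (lin0 (bdry_lin hz conj_lower)) mulr0.
Qed.

Lemma bdry_Rm2 w (K : nat) : (forall k : nat, (K <= k)%N -> Lmode k w = 0) ->
  phi (Rmode (-1) w) = \sum_(k < K) (zeta - z0) ^- k.+1 * phi (Lmode k w).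
Proof.
move=> hK; pose G z := \sum_(k < K) (zeta - z) ^- k.+1 * bdry z zeta (Lmode k w).
apply: (@cts_eq_outer _ (fun z => bdry z zeta (Rmode (-1) w)) G z0 hz0).
- exact: cts_bdry.
- apply: cts_sum => k; apply: ctsM; last exact: cts_bdry.
  apply: ctsVX; first by rewrite -opprB oppr_eq0 conj_neq.
  by apply: ctsB; [exact: cts_cst|exact: cvg_id].
- move=> z hz zz; have [_ _ h] := outer_ward w hz zz.
  apply: (@sum_ord_trunc (fun k : nat => (zeta - z) ^- k.+1 * bdry z zeta (Lmode k w))
    _ _ _ h) => k /hK ->.
  by rewrite (lin0 (bdry_lin hz conj_lower)) mulr0.
Qed.

Lemma bdry_Lm1 w : phi (Lmode 0 w) + phi (Rmode 0 w) = 0.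
Proof.
have lin := bdry_lin hz0 conj_lower.
have := oc_Lm1_bracket w one 0 hz0 conj_lower => /(congr1 (Bop u)).
rewrite (_ : mL (-1) one = 0); last exact: (mact_op_one _ _ 0).
rewrite (lin0 ((oc_bilin A 0 hz0 conj_lower).2 w)) subr0.
rewrite vacuum_like_orth// (linD (Bop_linr hBop u)) => /esym.
by rewrite /bdry /LL /LR.
Qed.

Lemma bdry_L0 w :
  phi (Lmode 1 w) + phi (Rmode 1 w) + z0 * phi (Lmode 0 w) + zeta * phi (Rmode 0 w) = 0.
Proof.
have lin := bdry_lin hz0 conj_lower.
have := oc_L0_bracket w one 0 hz0 conj_lower => /(congr1 (Bop u)).
rewrite (_ : mL 0 one = 0); last exact: (mact_op_one _ _ 1).
rewrite (lin0 ((oc_bilin A 0 hz0 conj_lower).2 w)) subr0.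
rewrite vacuum_like_orth// => /esym; rewrite -/(bdry z0 zeta _).
by rewrite !(linD lin) !(linZ lin).
Qed.
End AtConjugatePoints.
End OpenClosedWard.

(** * The two Virasoro actions on the closed sector *)

Section TensorSquare.
Variables (R : realType) (V T : VOA R) (tau : V -> V -> T).
Local Notation C := R[i].
Hypothesis hT : is_tensor_square tau.

Lemma tau_0l b : tau 0 b = 0.
Proof. exact: (lin0 ((ts_bilin hT).1 b)). Qed.

Lemma tau_0r a : tau a 0 = 0.
Proof. exact: (lin0 ((ts_bilin hT).2 a)). Qed.

Lemma vmode_tauL a n a' b' :
  vmode (tau a (vac V)) n (tau a' b') = tau (vmode a n a') b'.
Proof.
rewrite (ts_mode hT) (@fsum_one _ _ _ n) => [|i ni]; rewrite vmode_vac.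
  by rewrite (_ : n - 1 - n = -1)//; lia.
by rewrite ifF ?tau_0r//; apply/eqP => E; move/eqP: ni; apply; lia.
Qed.

Lemma vmode_tauR b n a' b' :
  vmode (tau (vac V) b) n (tau a' b') = tau a' (vmode b n b').
Proof.
rewrite (ts_mode hT) (@fsum_one _ _ _ (-1)) => [|i ni]; rewrite vmode_vac.
  by rewrite eqxx (_ : n - 1 - -1 = n)//; lia.
by rewrite (negPf ni) tau_0l.
Qed.

(** The two embeddings of [V] into its tensor square are treated together: [j]
    is a homomorphism for the modes and for [L(-1)]. *)
Record chiral_embedding (j : V -> T) : Prop := {
  ce_lin : linear j ;
  ce_vac : j (vac V) = vac T ;
  ce_mode : forall a n b, vmode (j a) n (j b) = j (vmode a n b) ;
  ce_deriv : forall a, vL (-1) (j a) = j (vL (-1) a) }.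

Lemma vL_tau n a b : vL n (tau a b) = tau (vL n a) b + tau a (vL n b).
Proof.
by rewrite {1}/vL (ts_conf hT) (linD (@vmode_linl _ _ _ _)) vmode_tauL vmode_tauR.
Qed.

Lemma embL : chiral_embedding (tau^~ (vac V)).
Proof.
split=> [||a n b|a].
- exact: (ts_bilin hT).1.
- by rewrite (ts_vac hT).
- by rewrite vmode_tauL.
- by rewrite vL_tau vL_vac// tau_0r addr0.
Qed.

Lemma embR : chiral_embedding (tau (vac V)).
Proof.
split=> [||a n b|a].
- exact: (ts_bilin hT).2.
- by rewrite (ts_vac hT).
- by rewrite vmode_tauR.
- by rewrite vL_tau vL_vac// tau_0l add0r.
Qed.

Variable W : vmodule T.
Local Notation biw := (@biweight R V T tau W).

Definition Vir (j : V -> T) (n : int) (w : W) : W := mact (j (conf V)) (n + 1) w.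


(** The central term is kept as a binomial coefficient; its oddness
    [gbinom (1 - m) 3 = - gbinom (1 + m) 3] makes the central terms of the two
    chiralities cancel in [balancedD]. *)
Lemma Vir_comm j (m n : int) w : chiral_embedding j ->
  Vir j m (Vir j n w) = Vir j n (Vir j m w) + (m - n)%:~R *: Vir j (m + n) w +
    (if m + n == 0 then gbinom R (m + 1) 3 * (ccharge V / 2%:R) else 0) *: w.
Proof.
move=> hj; rewrite {1}/Vir (jac_comm (wm_jacobi (m_weak W))
  (fun s w2 => mact0 s w2) _ _ (N := 4)); last first.
  move=> i i4; right; rewrite (ce_mode hj) (_ : i%:Z = i%:Z - 1 + 1); last by lia.
  by rewrite -[vmode _ _ _]/(vL (i%:Z - 1) _) vL_conf0 ?(lin0 (ce_lin hj))//; lia.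
rewrite -/(Vir j m _) -/(Vir j n _) -addrA; congr (_ + _).
rewrite !big_ord_recl big_ord0/= addr0 !(ce_mode hj).
rewrite -[vmode _ 0 _]/(vL (-1) (conf V)) -[vmode _ 1 _]/(vL 0 (conf V)).
rewrite -[vmode _ (bump 0 1) _]/(vL 1 (conf V)).
rewrite -[vmode _ (bump 0 (bump 0 1)) _]/(vL 2 (conf V)).
rewrite vL1_conf (lin0 (ce_lin hj)) mact0 scaler0 add0r -(ce_deriv hj) m_deriv.
rewrite vL0_conf vL2_conf !(linZ (ce_lin hj)) !(linZ (@mact_linl _ _ _ _ _)).
rewrite (ce_vac hj) (wm_vac (m_weak W)) !intz !scalerA addrA; congr (_ + _).
  rewrite -[bump 0 0]/1%N (_ : m + 1 + (n + 1) - 1 = m + n + 1); last by lia.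
  rewrite -/(Vir j _ _) -scalerDl; congr (_ *: _).
  by rewrite !gbinomS gbinom0 !intrD mulrNz; field.
rewrite -[bump 0 (bump 0 (bump 0 0))]/3%N addr0.
rewrite (_ : (m + 1 + (n + 1) - _ == -1) = (m + n == 0)); last first.
  by apply/eqP/eqP; lia.
by case: ifP; rewrite ?scaler0 ?scale0r.
Qed.

Lemma LL_comm (m n : int) (w : W) :
  LL tau m (LL tau n w) = LL tau n (LL tau m w) + (m - n)%:~R *: LL tau (m + n) w +
    (if m + n == 0 then gbinom R (m + 1) 3 * (ccharge V / 2%:R) else 0) *: w.
Proof. exact: (Vir_comm _ _ _ embL). Qed.

Lemma LR_comm (m n : int) (w : W) :
  LR tau m (LR tau n w) = LR tau n (LR tau m w) + (m - n)%:~R *: LR tau (m + n) w +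
    (if m + n == 0 then gbinom R (m + 1) 3 * (ccharge V / 2%:R) else 0) *: w.
Proof. exact: (Vir_comm _ _ _ embR). Qed.

Lemma LL_LR (m n : int) (w : W) : LL tau m (LR tau n w) = LR tau n (LL tau m w).
Proof.
rewrite {1}/LL (jac_comm (wm_jacobi (m_weak W))
  (fun s w2 => mact0 s w2) _ _ (N := 0)) ?big_ord0 ?addr0//.
by move=> i _; right; rewrite vmode_tauL vmode_creation0// tau_0l.
Qed.

Lemma LL_lin n : linear (@LL R V T tau W n).
Proof. exact: mact_linr. Qed.

Lemma LR_lin n : linear (@LR R V T tau W n).
Proof. exact: mact_linr. Qed.

Lemma LL_wt (n : int) (p : R * R) w :
  biw p w -> biw (p.1 - n%:~R, p.2) (LL tau n w).
Proof.
move=> [/= e1 e2]; split=> /=; last by rewrite /eigenvectors/= -LL_LR e2 (linZ (LL_lin n)).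
rewrite /eigenvectors/= LL_comm e1 (linZ (LL_lin n)) !add0r gbinomS (gbinom_nat R 1).
rewrite bin_small// mul0r mul0r if_same scale0r addr0 -scalerDl.
by congr (_ *: _); rewrite mulrNz rmorphB/= rmorph_int.
Qed.

Lemma LR_wt (n : int) (p : R * R) w :
  biw p w -> biw (p.1, p.2 - n%:~R) (LR tau n w).
Proof.
move=> [/= e1 e2]; split=> /=; first by rewrite /eigenvectors/= LL_LR e1 (linZ (LR_lin n)).
rewrite /eigenvectors/= LR_comm e2 (linZ (LR_lin n)) !add0r gbinomS (gbinom_nat R 1).
rewrite bin_small// mul0r mul0r if_same scale0r addr0 -scalerDl.
by congr (_ *: _); rewrite mulrNz rmorphB/= rmorph_int.
Qed.

Lemma mL0_biweight (p : R * R) w : biw p w ->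
  mL 0 w = (p.1 + p.2)%:C *: w.
Proof.
move=> [/= e1 e2]; rewrite rmorphD scalerDl -e1 -e2 /mL (ts_conf hT).
by rewrite (linD (@mact_linl _ _ _ _ _)).
Qed.
End TensorSquare.

(** * Invariant forms on the closed sector *)

Section ClosedForm.
Variables (R : realType) (V T : VOA R) (tau : V -> V -> T).
Local Notation C := R[i].
Hypothesis hT : is_tensor_square tau.
Variable A : full_field_algebra tau.
Local Notation biw := (@biweight R V T tau A).
Local Notation pr := (@cl_pr R V T tau A).

Lemma exp_LL0_LR0_homog (l l' : C) p (w : A) : biw p w ->
  exp_LL0_LR0 pr l l' w = Cexp (p.1%:C * l + p.2%:C * l') *: w.
Proof.
move=> hw; rewrite /exp_LL0_LR0 (@fsum_one _ _ _ p).
  by rewrite (grad_pr (cl_grading A) p hw) eqxx.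
by move=> q qp; rewrite (grad_pr (cl_grading A) q hw) (negPf qp) scaler0.
Qed.

Lemma cl_pr_wt0 (p : R * R) (mu : R) (w : A) :
  mL 0 w = mu%:C *: w -> p.1 + p.2 != mu -> pr p w = 0.
Proof.
move=> ew pmu.
apply: (grad_eig_pr0 (cl_grading A) (chi := fun p => (p.1 + p.2)%:C)
  (@mL_lin _ _ _ 0) _ ew).
- by move=> q x hx; exact: (mL0_biweight hT).
- by rewrite (inj_eq (@complexI R)).
Qed.

Lemma cl_iotaE n (v : T) (w : T) : mact v n (cl_iota A w) = cl_iota A (vmode v n w).
Proof. by rewrite cl_iota_mod. Qed.

Lemma cl_one_wt : biw (0, 0) (cl_one A).
Proof.
split; rewrite /eigenvectors/= /LL /LR cl_iotaE scale0r.
  by rewrite (ts_vac hT) (vmode_tauL hT) vmode_creation0// (tau_0l hT) (lin0 (cl_iota_lin A)).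
by rewrite (ts_vac hT) (vmode_tauR hT) vmode_creation0// (tau_0r hT) (lin0 (cl_iota_lin A)).
Qed.

(** On a vector of total weight [h] the mode [s] of the identity field has total
    weight [h - s - 1], so each component of [Y(1, x) w = w] isolates a single
    mode. *)
Lemma cl_Y_one s w : cl_Y (cl_one A) s w = if s == -1 then w else 0.
Proof.
move: w; apply: (grad_ind (cl_grading A)).
- by rewrite (lin0 (io_linr (cl_io A) _ _)) if_same.
- move=> x y hx hy; rewrite (linD (io_linr (cl_io A) _ _)) hx hy.
  by case: ifP => // _; rewrite addr0.
move=> h w hw.
have wt s' : mL 0 (cl_Y (cl_one A) s' w) =
    (h.1 + h.2 - s' - 1)%:C *: cl_Y (cl_one A) s' w.
  have := io_wt (cl_io A) s' (mL0_biweight hT cl_one_wt) (mL0_biweight hT hw).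
  by rewrite !add0r.
have key p : pr p (cl_Y (cl_one A) (h.1 + h.2 - 1 - (p.1 + p.2)) w) = pr p w.
  have := cl_identity 0 0 w p; rewrite /YYlog /YY_of.
  rewrite !oppr0 (exp_LL0_LR0_homog _ _ cl_one_wt) (exp_LL0_LR0_homog _ _ hw).
  rewrite !mulr0 !addr0 Cexp0 !scale1r /io_eval.
  rewrite (@fsum_one _ _ _ (h.1 + h.2 - 1 - (p.1 + p.2))).
    by rewrite mulr0 Cexp0 scale1r.
  move=> s' s'p; rewrite (cl_pr_wt0 (wt s')) ?scaler0//.
  by apply: contra s'p => /eqP ->; apply/eqP; ring.
apply: (grad_eq (cl_grading A)) => p.
have [sp|sp] := eqVneq s (h.1 + h.2 - 1 - (p.1 + p.2)).
  rewrite {1}sp key; case: ifP => // /eqP s1; rewrite (lin0 (grad_lin (cl_grading A) p)).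
  rewrite (grad_pr (cl_grading A) p hw) ifF//; apply/eqP => ph; apply: s1.
  by rewrite sp ph; ring.
rewrite (cl_pr_wt0 (wt s)); last first.
  by apply: contra sp => /eqP ->; apply/eqP; ring.
case: ifP => [/eqP s1|]; last by rewrite (lin0 (grad_lin (cl_grading A) p)).
rewrite (grad_pr (cl_grading A) p hw) ifF//; apply/eqP => ph.
by move/eqP: sp; apply; rewrite s1 ph; ring.
Qed.

(** The iterate formula for [v = v_(-1) 1], with the modes of the identity
    field inserted. *)
Lemma cl_Y_iota_sum v s w : exists N0 : nat, forall N, (N0 <= N)%N ->
  cl_Y (cl_iota A v) s w =
  \sum_(i < N) (mact v (- i.+1%:Z) (if s + i%:R == -1 then w else 0) +
                if s - 1 - i%:R == -1 then mact v i w else 0).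
Proof.
have -> : cl_iota A v = mact v (-1) (cl_one A).
  by rewrite cl_iotaE vmode_creation.
have [M hM] := wm_trunc (m_weak A) v w.
have b0 : 0 <= `|s| + 1 by rewrite addr_ge0.
exists (maxn `|M|%N (Num.bound (`|s| + 1))) => N.
rewrite geq_max => /andP[MN bN].
rewrite (jac_iter (io_jacobi (cl_io A)) (N := N)).
- by apply: eq_bigr => i _; rewrite !cl_Y_one.
- by move=> m; exact: (lin0 (@mact_linr _ _ _ _ _)).
- move=> i Ni; rewrite cl_Y_one ifF//; apply/eqP => E.
  have := archi_boundP b0; rewrite ltNge => /negP; apply.
  have := ler_norm (- s); rewrite normrN.
  have : (Num.bound (`|s| + 1))%:R <= i%:R :> R.
    by rewrite ler_nat; exact: leq_trans Ni.
  by move: E; lra.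
- by move=> i Ni; rewrite cl_Y_one hM ?if_same//; lia.
Qed.

Lemma cl_Y_iota_int v (n : int) w : cl_Y (cl_iota A v) n%:~R w = mact v n w.
Proof.
have [N0 h0] := cl_Y_iota_sum v n%:~R w.
have m0 m : mact v m (0 : A) = 0 by exact: (lin0 (@mact_linr _ _ _ _ _)).
rewrite (h0 (maxn N0 (`|n|%N.+1)) (leq_maxl _ _)).
have E1 (i : nat) : ((n%:~R : R) + i%:R == -1) = (n + i%:Z == -1).
  by rewrite -[RHS](eqr_int R) intrD mulrN1z.
have E2 (i : nat) : ((n%:~R : R) - 1 - i%:R == -1) = (n == i%:Z).
  by rewrite -[RHS](eqr_int R) addrAC -[X in _ == X]add0r (inj_eq (addIr _)) subr_eq0.
pose k := if 0 <= n then `|n|%N else `|n|%N.-1.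
have kN : (k < maxn N0 `|n|%N.+1)%N by rewrite /k; case: ifP => n0; lia.
rewrite (bigD1 (Ordinal kN))//= big1 ?addr0 => [|i /eqP ik].
  rewrite E1 E2 /k; case: ifP => n0.
    by rewrite ifF ?m0 ?add0r ?ifT//; [f_equal; lia|lia|lia].
  by rewrite ifT ?[X in _ + X]ifF ?addr0//; [congr (mact _ _ _); lia|lia|lia].
have {ik} : nat_of_ord i <> k.
  by move=> E; apply: ik; exact: val_inj.
by rewrite E1 E2 /k; case: (ifP (0 <= n)) => n0 ik; rewrite !ifF ?m0 ?addr0//; lia.
Qed.

Lemma cl_Y_iota_nonint v s w :
  (forall n : int, s <> n%:~R) -> cl_Y (cl_iota A v) s w = 0.
Proof.
move=> hs; have [N0 /(_ _ (leqnn _)) ->] := cl_Y_iota_sum v s w.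
apply: big1 => i _; rewrite !ifF ?(lin0 (@mact_linr _ _ _ _ _)) ?addr0//.
  apply/eqP => E; apply: (hs i%:Z); rewrite -[_%:~R]/(i%:R : R); lra.
apply/eqP => E; apply: (hs (- i.+1%:Z)).
by rewrite mulrNz -[_%:~R]/(i.+1%:R : R) -natr1; lra.
Qed.

Section Adjoint.
Variables (B : A -> A -> C) (hB : invariant_form_cl B).

Lemma Bcl_linr x : linear (B x : A -> C^o).
Proof. exact: form_linr (clf_form hB) x. Qed.

Lemma Bcl_linl y : linear (B^~ y : A -> C^o).
Proof. exact: form_linl (clf_form hB) y. Qed.

Lemma Bcl_orth p q x y : biw p x -> biw q y -> p != q -> B x y = 0.
Proof.
move=> /(gradE_pr (cl_grading A)) <- /(gradE_pr (cl_grading A)) <-.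
exact: form_graded (clf_form hB) _ _ _ _.
Qed.

(* The vector [v] stands for one of the two conformal vectors; [e] is the
   direction in which its modes shift the two weights. *)
Variables (v : T) (e : R * R).
Hypothesis e1 : e.1 + e.2 = 1.
Hypothesis e_sign : Cexp (e.1%:C * pi_i R - e.2%:C * pi_i R) = -1.
Hypothesis v_wt : forall (m : int) h (w : A), biw h w ->
  biw (h.1 - m%:~R * e.1, h.2 - m%:~R * e.2) (mact v (m + 1) w).
Hypothesis iota_wt : biw (2 * e.1, 2 * e.2) (cl_iota A v).
Hypothesis LL1_iota : LL tau 1 (cl_iota A v) = 0.
Hypothesis LR1_iota : LR tau 1 (cl_iota A v) = 0.

Let shift (h : R * R) (m : int) := (h.1 - m%:~R * e.1, h.2 - m%:~R * e.2).

Lemma shift_inj h m m' : shift h m = shift h m' -> m = m'.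
Proof.
move=> [E1 E2]; have : (m%:~R : R) * (e.1 + e.2) = m'%:~R * (e.1 + e.2) by lra.
by rewrite e1 !mulr1 => /eqP; rewrite eqr_int => /eqP.
Qed.

Lemma cl_flip_iota : cl_flip (A := A) 0 0 (cl_iota A v) = cl_iota A v.
Proof.
rewrite /cl_flip !mulr0 (exp_LL0_LR0_homog _ _ iota_wt) !mulr0 addr0 !Cexp0 scale1r.
rewrite /exp_LL1_LR1 (@fsum_one _ _ _ (0, 0)%N)/=.
  by rewrite !expr0 fact0 !divr1 mulr1 scale1r.
move=> [j k] jk; case: k jk => [|k] jk /=.
  by case: j jk => // j _; rewrite iterSr LL1_iota (iter_lin0 _ (LL_lin _ _)) scaler0.
rewrite -iterS iterSr LR1_iota (iter_lin0 _ (LR_lin _ _)) (iter_lin0 _ (LL_lin _ _)).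
by rewrite scaler0.
Qed.

Lemma YYlog_iota (l l' : C) h w (m : int) : biw h w ->
  YYlog (cl_iota A v) l l' w (shift h m) =
  Cexp (- (m + 2)%:~R * (e.1%:C * l + e.2%:C * l')) *: mact v (m + 1) w.
Proof.
move=> hw; rewrite /YYlog /YY_of (exp_LL0_LR0_homog _ _ iota_wt).
rewrite (exp_LL0_LR0_homog _ _ hw) /io_eval (@fsum_one _ _ _ (m + 1)%:~R).
  rewrite mulr0 Cexp0 scale1r (linZ (io_linr (cl_io A) _ _)).
  rewrite (linZ (io_linl (cl_io A) _ _)) cl_Y_iota_int.
  rewrite !(linZ (grad_lin (cl_grading A) _)).
  rewrite (grad_pr (cl_grading A) _ (v_wt m hw)) eqxx !scalerA -!CexpD.
  congr (Cexp _ *: _); rewrite /shift/= !rmorphB/= !rmorphM/= rmorph_int intrD.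
  by rewrite !rmorph_nat; ring.
move=> s sm; rewrite (linZ (io_linr (cl_io A) _ _)) (linZ (io_linl (cl_io A) _ _)).
rewrite !(linZ (grad_lin (cl_grading A) _)).
have [[n sn]|hs] := pselect (exists n : int, s = n%:~R); last first.
  rewrite cl_Y_iota_nonint ?(lin0 (grad_lin (cl_grading A) _)) ?scaler0//.
  by move=> n sn; apply: hs; exists n.
rewrite sn cl_Y_iota_int -[n](subrK 1) (grad_pr (cl_grading A) _ (v_wt (n - 1) hw)).
rewrite ifF ?scaler0//; apply/eqP => /shift_inj E; move/eqP: sm; apply.
by rewrite sn E subrK.
Qed.

Lemma YYlog_iota0 (l l' : C) h w p : biw h w -> (forall m, p <> shift h m) ->
  YYlog (cl_iota A v) l l' w p = 0.
Proof.
move=> hw hp; rewrite /YYlog /YY_of (exp_LL0_LR0_homog _ _ iota_wt).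
rewrite (exp_LL0_LR0_homog _ _ hw) /io_eval fsum_zero ?scaler0// => s.
rewrite (linZ (io_linr (cl_io A) _ _)) (linZ (io_linl (cl_io A) _ _)).
rewrite !(linZ (grad_lin (cl_grading A) _)).
have [[n ->]|hs] := pselect (exists n : int, s = n%:~R); last first.
  rewrite cl_Y_iota_nonint ?(lin0 (grad_lin (cl_grading A) _)) ?scaler0//.
  by move=> n sn; apply: hs; exists n.
rewrite cl_Y_iota_int -[n](subrK 1) (grad_pr (cl_grading A) _ (v_wt (n - 1) hw)).
by rewrite ifF ?scaler0//; apply/eqP; exact: hp.
Qed.

Lemma YYlog_iota_wt (l l' : C) h w p : biw h w ->
  biw p (YYlog (cl_iota A v) l l' w p).
Proof.
move=> hw; apply/(gradE_pr (cl_grading A)).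
have [[m ->]|hp] := pselect (exists m, p = shift h m).
  rewrite YYlog_iota// (linZ (grad_lin (cl_grading A) _)).
  by rewrite (grad_pr (cl_grading A) _ (v_wt m hw)) eqxx.
rewrite (YYlog_iota0 _ _ hw) ?(lin0 (grad_lin (cl_grading A) _))// => m pm.
by apply: hp; exists m.
Qed.

(** The sign comes from the branch [e^(i pi) x^-1] in the definition of
    invariance: [(- 1/x)^(- m - 2)] contributes [(-1)^m]. *)
Lemma Bcl_adjoint (m : int) x y :
  B x (mact v (m + 1) y) = (-1) ^ m * B (mact v (- m + 1) x) y.
Proof.
move: y; apply: (grad_ind (cl_grading A)).
- by rewrite (lin0 (@mact_linr _ _ _ _ _)) !(lin0 (Bcl_linr _)) mulr0.
- move=> y y' hy hy'; rewrite (linD (@mact_linr _ _ _ _ _)) !(linD (Bcl_linr _)).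
  by rewrite hy hy' mulrDr.
move=> h y hy; move: x; apply: (grad_ind (cl_grading A)).
- by rewrite (lin0 (@mact_linr _ _ _ _ _)) !(lin0 (Bcl_linl _)) mulr0.
- move=> x x' hx hx'; rewrite (linD (@mact_linr _ _ _ _ _)) !(linD (Bcl_linl _)).
  by rewrite hx hx' mulrDr.
move=> g x hx; have [gh|gh] := eqVneq g (shift h m); last first.
  rewrite (Bcl_orth hx (v_wt m hy))// (Bcl_orth (v_wt (- m) hx) hy) ?mulr0//.
  apply: contra gh; case: (g) (h) => [g1 g2] [h1 h2]; rewrite /shift/=.
  move=> /eqP[<- <-]; apply/eqP; congr pair; rewrite mulrNz; ring.
have hg : h = shift g (- m).
  by rewrite gh /shift/= mulrNz; case: (h) => h1 h2/=; congr pair; ring.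
have := clf_inv hB 0 0 (cl_iota A v) y x.
rewrite cl_flip_iota !subr0 /pair_right /pair_left (@fsum_one _ _ _ g); last first.
  by move=> p pg; apply: (Bcl_orth hx (YYlog_iota_wt _ _ _ hy)); rewrite eq_sym.
rewrite (@fsum_one _ _ _ h); last first.
  by move=> p pg; apply: (Bcl_orth (YYlog_iota_wt _ _ _ hx) hy).
have -> : YYlog (cl_iota A v) 0 0 y g = mact v (m + 1) y.
  by rewrite gh YYlog_iota// !mulr0 addr0 mulr0 Cexp0 scale1r.
rewrite hg YYlog_iota// => ->.
rewrite (linZ (Bcl_linl y)); congr (_ * _).
rewrite (_ : _ * _ = (m + - 2)%:~R * (e.1%:C * pi_i R - e.2%:C * pi_i R)); last first.
  by rewrite !intrD mulrNz; ring.
rewrite Cexp_int e_sign expfzDr ?oppr_eq0 ?oner_eq0//.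
by rewrite -[(-1) ^ (- 2)]/(((-1) ^+ 2)^-1) sqrrN expr1n invr1 mulr1.
Qed.
End Adjoint.

Lemma Cexp_pi_i : Cexp (pi_i R) = -1.
Proof. by rewrite /Cexp/= expR0 cospi sinpi mulr0 mulrN1; congr (_ +i* _); rewrite oppr0. Qed.

Lemma LL_iota n v : LL tau n (cl_iota A v) = cl_iota A (vmode (tau (conf V) (vac V)) (n + 1) v).
Proof. exact: cl_iotaE. Qed.

Lemma LR_iota n v : LR tau n (cl_iota A v) = cl_iota A (vmode (tau (vac V) (conf V)) (n + 1) v).
Proof. exact: cl_iotaE. Qed.

Section BothAdjoints.
Variables (B : A -> A -> C) (hB : invariant_form_cl B).

Lemma Bcl_LL (m : int) x y : B x (LL tau m y) = (-1) ^ m * B (LL tau (- m) x) y.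
Proof.
have i0 := lin0 (cl_iota_lin A).
apply: (@Bcl_adjoint B hB (tau (conf V) (vac V)) (1, 0)) => /=.
- by rewrite addr0.
- by rewrite mul1r mul0r subr0 Cexp_pi_i.
- by move=> n h w /(LL_wt hT n); rewrite mulr1 mulr0 subr0.
- split; rewrite /eigenvectors/= ?LL_iota ?LR_iota ?(vmode_tauL hT) ?(vmode_tauR hT).
    rewrite -[vmode _ _ _]/(vL 0 (conf V)) vL0_conf (linZ ((ts_bilin hT).1 _)).
    by rewrite (linZ (cl_iota_lin A)) mulr1 rmorph_nat.
  by rewrite vmode_creation0// (tau_0r hT) i0 mulr0 scale0r.
- rewrite LL_iota (vmode_tauL hT) -[vmode _ _ _]/(vL 1 (conf V)) vL1_conf.
  by rewrite (tau_0l hT) i0.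
- by rewrite LR_iota (vmode_tauR hT) vmode_creation0// (tau_0r hT) i0.
Qed.

Lemma Bcl_LR (m : int) x y : B x (LR tau m y) = (-1) ^ m * B (LR tau (- m) x) y.
Proof.
have i0 := lin0 (cl_iota_lin A).
apply: (@Bcl_adjoint B hB (tau (vac V) (conf V)) (0, 1)) => /=.
- by rewrite add0r.
- by rewrite mul1r mul0r sub0r CexpN Cexp_pi_i invrN1.
- by move=> n h w /(LR_wt hT n); rewrite mulr1 mulr0 subr0.
- split; rewrite /eigenvectors/= ?LL_iota ?LR_iota ?(vmode_tauL hT) ?(vmode_tauR hT).
    by rewrite vmode_creation0// (tau_0l hT) i0 mulr0 scale0r.
  rewrite -[vmode _ _ _]/(vL 0 (conf V)) vL0_conf (linZ ((ts_bilin hT).2 _)).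
  by rewrite (linZ (cl_iota_lin A)) mulr1 rmorph_nat.
- by rewrite LL_iota (vmode_tauL hT) vmode_creation0// (tau_0l hT) i0.
- rewrite LR_iota (vmode_tauR hT) -[vmode _ _ _]/(vL 1 (conf V)) vL1_conf.
  by rewrite (tau_0r hT) i0.
Qed.
End BothAdjoints.
End ClosedForm.

(** * Conjugation by exponentials of [L(1)] *)

Section DividedPowers.
Variables (R : realType) (W : lmodType R[i]).
Local Notation C := R[i].
Implicit Types T : W -> W.

(** The [j]-th term of [exp(- T)]. *)
Definition dpow T (j : nat) (y : W) : W := ((-1) ^+ j / j`!%:R) *: iter j T y.

Lemma dpow0 T y : dpow T 0 y = y.
Proof. by rewrite /dpow expr0 fact0 divr1 scale1r. Qed.

Lemma dpowS T j y : linear T -> T (dpow T j y) = - j.+1%:R *: dpow T j.+1 y.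
Proof.
move=> hT; rewrite /dpow (linZ hT) scalerA iterS; congr (_ *: _).
have h1 : j.+1%:R != 0 :> C by rewrite pnatr_eq0.
by rewrite factS natrM exprS mulN1r invfM !mulNr mulrN opprK mulrCA mulVKf.
Qed.

Lemma dpow_lin T j : linear T -> linear (dpow T j).
Proof.
move=> hT a x y; rewrite /dpow (iter_lin j hT).
by rewrite scalerDr !scalerA mulrC.
Qed.

Lemma dpow_commute T X j y : linear X -> (forall x, T (X x) = X (T x)) ->
  dpow T j (X y) = X (dpow T j y).
Proof.
move=> hX hc; rewrite /dpow (linZ hX); congr (_ *: _).
by elim: j => //= j ->; exact: hc.
Qed.

(** Leibniz rule; [X k] plays the role of [(- ad T)^k (X 0) / k!]. *)
Lemma dpow_leibniz T (X : nat -> W -> W) j y : linear T ->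
  (forall k, linear (X k)) ->
  (forall k x, T (X k x) = X k (T x) - k.+1%:R *: X k.+1 x) ->
  dpow T j (X 0%N y) = \sum_(k < j.+1) X k (dpow T (j - k) y).
Proof.
move=> hT hX hc; elim: j => [|j IHj]; first by rewrite big_ord1 !dpow0.
have j0 : - j.+1%:R != 0 :> C by rewrite oppr_eq0 pnatr_eq0.
apply: (scalerI j0); rewrite -dpowS// IHj (lin_sum hT) scaler_sumr.
pose F (k : nat) : W := - (j.+1 - k)%:R *: X k (dpow T (j.+1 - k) y).
pose G (k : nat) : W := - k%:R *: X k (dpow T (j.+1 - k) y).
transitivity (\sum_(k < j.+1) F k + \sum_(k < j.+1) G k.+1).
  rewrite -big_split; apply: eq_bigr => k _ /=; rewrite hc dpowS// (linZ (hX k)).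
  have kj : (k <= j)%N by rewrite -ltnS.
  by rewrite /F /G (subSn kj) subSS !scaleNr.
transitivity (\sum_(k < j.+2) F k + \sum_(k < j.+2) G k).
  rewrite [X in _ = X + _]big_ord_recr [X in _ = _ + X]big_ord_recl /=.
  by rewrite /F /G subnn oppr0 !scale0r addr0 add0r.
rewrite -big_split; apply: eq_bigr => k _ /=; rewrite /F /G -scalerDl -opprD -natrD.
by rewrite subnK// -ltnS.
Qed.

(** The Leibniz rules of all orders add up to the conjugation by [exp(- T)]; the
    terms of total degree at least [N] vanish, which turns the triangular sum
    into a product. *)
Lemma exp_conj T (X : nat -> W -> W) y (N : nat) : linear T ->
  (forall k, linear (X k)) ->
  (forall k x, T (X k x) = X k (T x) - k.+1%:R *: X k.+1 x) ->
  (forall i j, (N <= i + j)%N -> X i (iter j T y) = 0) ->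
  \sum_(j < N) dpow T j (X 0%N y) = \sum_(i < N) X i (\sum_(j < N) dpow T j y).
Proof.
move=> hT hX hc h0; under eq_bigr do rewrite (dpow_leibniz _ _ hT hX hc).
under [RHS]eq_bigr do rewrite (lin_sum (hX _)).
pose F (k j : nat) : W := if (k <= j)%N then X k (dpow T (j - k) y) else 0.
transitivity (\sum_(j < N) \sum_(k < N) F k j).
  apply: eq_bigr => j _; rewrite (sum_ord_widen (F := F^~ j) (ltn_ord j)).
    by apply: eq_bigr => k _; rewrite /F ifT // -ltnS.
  by move=> k jk; rewrite /F leqNgt jk.
rewrite exchange_big/=; apply: eq_bigr => k _.
have kN : (k <= N)%N by exact: ltnW.
have -> : \sum_(i < N) F k i = \sum_(i < k + (N - k)) F k i by rewrite subnKC.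
rewrite (sum_ord_drop (F := F k)); last first.
  by move=> i ik; rewrite /F leqNgt ik.
rewrite (sum_ord_widen (F := fun i => X k (dpow T i y)) (leq_subr k N)).
  by apply: eq_bigr => i _; rewrite /F leq_addl addnK.
move=> i Ni; rewrite /dpow (linZ (hX k)) h0 ?scaler0//.
by rewrite -leq_subLR.
Qed.
End DividedPowers.

Section ExpL1R1.
Variables (R : realType) (W : lmodType R[i]).
Local Notation C := R[i].
Variables (L M : int -> W -> W).
Hypothesis L_lin : forall n, linear (L n).
Hypothesis L1_comm : forall n x,
  L 1 (L n x) = L n (L 1 x) + (1 - n)%:~R *: L (n + 1) x.
Hypothesis LM : forall m n x, L m (M n x) = M n (L m x).
Hypothesis L_trunc : forall m y, exists N0 : nat, forall i j k : nat,
  (N0 <= i + j)%N -> L (m + i%:Z) (iter j (L 1) (iter k (M 1) y)) = 0.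

(** Truncation of [exp(- L 1) exp(- M 1)]. *)
Definition expLM (N : nat) (y : W) : W :=
  \sum_(j < N) \sum_(k < N) dpow (L 1) j (dpow (M 1) k y).

(** The coefficients are those of the expansion of the vector field
    [x^(m + 1) (1 - x)^(1 - m)], the image of [x^(m + 1)] under the flow of
    [x^2]. *)
Lemma expLM_L m y : exists N0 : nat, forall N, (N0 <= N)%N ->
  expLM N (L m y) =
  \sum_(i < N) ((-1) ^+ i * gbinom R (1 - m) i) *: L (m + i%:Z) (expLM N y).
Proof.
have [N0 h0] := L_trunc m y; exists N0 => N N0N.
pose X (i : nat) x := ((-1) ^+ i * gbinom R (1 - m) i) *: L (m + i%:Z) x.
have X_lin i : linear (X i).
  by move=> a x z; rewrite /X L_lin scalerDr !scalerA mulrC.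
have X0 x : L m x = X 0%N x by rewrite /X gbinom0 expr0 mulr1 scale1r addr0.
have Xc i x : L 1 (X i x) = X i (L 1 x) - i.+1%:R *: X i.+1 x.
  rewrite /X (linZ (L_lin 1)) L1_comm scalerDr; congr (_ + _).
  rewrite -scaleNr !scalerA (_ : m + i.+1%:Z = m + i%:Z + 1); last by lia.
  congr (_ *: _); rewrite gbinomS exprS.
  have h1 : i.+1%:R != 0 :> C by rewrite pnatr_eq0.
  have -> : (1 - (m + i%:Z))%:~R = (1 - m)%:~R - i%:R :> C.
    by rewrite opprD addrA intrD mulrNz.
  move: (i.+1%:R : C) h1 ((1 - m)%:~R - i%:R : C) (gbinom R (1 - m) i) => c c0 a b.
  by field.
rewrite /expLM exchange_big/=.
have E (k : 'I_N) : \sum_(j < N) dpow (L 1) j (dpow (M 1) k (L m y)) =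
    \sum_(i < N) X i (\sum_(j < N) dpow (L 1) j (dpow (M 1) k y)).
  rewrite dpow_commute//.
  under eq_bigr do rewrite X0.
  apply: exp_conj => // i j Nij; rewrite /X /dpow.
  rewrite (linZ (iter_lin j (L_lin 1))) (linZ (L_lin _)) h0 ?scaler0//; exact: leq_trans Nij.
under eq_bigr do rewrite E.
rewrite exchange_big/=; apply: eq_bigr => i _.
by rewrite -/(X i _) [in RHS]exchange_big/= (lin_sum (X_lin i)).
Qed.
End ExpL1R1.

Section Gluing.
Variables (R : realType) (W : lmodType R[i]).
Local Notation C := R[i].

Lemma expLM_sym (L M : int -> W -> W) N y :
  (forall n, linear (L n)) -> (forall n, linear (M n)) ->
  (forall m n x, L m (M n x) = M n (L m x)) -> expLM M L N y = expLM L M N y.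
Proof.
move=> L_lin M_lin LM; rewrite /expLM exchange_big/=.
apply: eq_bigr => j _; apply: eq_bigr => k _.
apply: dpow_commute; first exact: dpow_lin.
by move=> x; rewrite -dpow_commute.
Qed.

(** The Ward identities of two insertion points at distance 1 from each other,
    in local coordinates that are 0 at one point and 1 at the other.  This choice
    makes the relations symmetric in [L] and [M]. *)
Record glued (L M : int -> W -> W) (psi : W -> C) : Prop := {
  gl_linL : forall n, linear (L n) ;
  gl_linM : forall n, linear (M n) ;
  gl_commL : forall n x, L 1 (L n x) = L n (L 1 x) + (1 - n)%:~R *: L (n + 1) x ;
  gl_commM : forall n x, M 1 (M n x) = M n (M 1 x) + (1 - n)%:~R *: M (n + 1) x ;
  gl_LM : forall m n x, L m (M n x) = M n (L m x) ;
  gl_truncL : forall m y, exists N0 : nat, forall i j k : nat, (N0 <= i + j)%N ->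
    L (m + i%:Z) (iter j (L 1) (iter k (M 1) y)) = 0 ;
  gl_truncM : forall m y, exists N0 : nat, forall i j k : nat, (N0 <= i + j)%N ->
    M (m + i%:Z) (iter j (M 1) (iter k (L 1) y)) = 0 ;
  gl_exp : forall y, exists y', exists N0 : nat, forall N, (N0 <= N)%N ->
    expLM L M N y = y' ;
  gl_psi : linear (psi : W -> C^o) ;
  gl_m1 : forall y, psi (L (-1) y) = psi (M (-1) y) ;
  gl_0 : forall y, psi (L 0 y) + psi (M 0 y) = psi (M (-1) y) ;
  gl_1 : forall y, psi (L 1 y) - psi (L 0 y) = psi (M 1 y) - psi (M 0 y) ;
  gl_L : forall y, exists K0 : nat, forall K, (K0 <= K)%N ->
    psi (L (-2) y) = \sum_(k < K) psi (M (k%:Z - 1) y) ;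
  gl_M : forall y, exists K0 : nat, forall K, (K0 <= K)%N ->
    psi (M (-2) y) = \sum_(k < K) psi (L (k%:Z - 1) y) }.

Lemma glued_sym L M psi : glued L M psi -> glued M L psi.
Proof.
move=> [lL lM cL cM LM tL tM hE hp m1 h0 h1 hL hM]; split=> //.
- by move=> y; have [y' [N0 h]] := hE y; exists y', N0 => N /h <-; exact: expLM_sym.
- by move=> y; rewrite addrC h0 m1.
Qed.

Section Glued.
Variables (L M : int -> W -> W) (psi beta : W -> C).
Hypothesis h : glued L M psi.
Hypothesis hbeta : forall y, exists N0 : nat, forall N, (N0 <= N)%N ->
  beta y = psi (expLM L M N y).

Lemma glued_expand (m : int) y : exists y' N0, forall N, (N0 <= N)%N ->
  [/\ expLM L M N y = y',
      beta (L m y) = \sum_(i < N) ((-1) ^+ i * gbinom R (1 - m) i) * psi (L (m + i%:Z) y')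
    & beta (M (- m) y) =
      \sum_(i < N) ((-1) ^+ i * gbinom R (1 + m) i) * psi (M (- m + i%:Z) y')].
Proof.
have [y' hy'] := gl_exp h y; exists y'.
have e1 := expLM_L (gl_linL h) (gl_commL h) (gl_LM h) (gl_truncL h) m y.
have h' := glued_sym h.
have e2 := expLM_L (gl_linL h') (gl_commL h') (gl_LM h') (gl_truncL h') (- m) y.
have [N0 hN0] := near_and hy' (near_and (near_and e1 e2)
  (near_and (hbeta (L m y)) (hbeta (M (- m) y)))).
exists N0 => N /hN0 [E [[E1 E2] [-> ->]]]; split=> //.
- rewrite E1 E (lin_sum (gl_psi h)); apply: eq_bigr => i _.
  by rewrite (linZ (gl_psi h)).
- rewrite -(expLM_sym _ _ (gl_linL h) (gl_linM h) (gl_LM h)) E2.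
  rewrite (expLM_sym _ _ (gl_linL h) (gl_linM h) (gl_LM h)) E opprK.
  by rewrite (lin_sum (gl_psi h)); apply: eq_bigr => i _; rewrite (linZ (gl_psi h)).
Qed.

Lemma sum3 (F : nat -> C) N : (3 <= N)%N -> (forall i, (3 <= i)%N -> F i = 0) ->
  \sum_(i < N) F i = F 0%N + F 1%N + F 2%N.
Proof. by move=> h3 F0; rewrite (sum_ord_widen h3 F0) !big_ord_recr big_ord0/= add0r. Qed.

Lemma sum4 (F : nat -> C) N : (4 <= N)%N -> (forall i, (4 <= i)%N -> F i = 0) ->
  \sum_(i < N) F i = F 0%N + F 1%N + F 2%N + F 3%N.
Proof. by move=> h4 F0; rewrite (sum_ord_widen h4 F0) !big_ord_recr big_ord0/= add0r. Qed.

(** Under conjugation by the exponentials [L 1] is unchanged and [M (-1)]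
    becomes [M (-1) - 2 M 0 + M 1]. *)
Lemma glued_1 y : beta (L 1 y) = beta (M (-1) y).
Proof.
have [y' [N0 /(_ (maxn N0 3) (leq_maxl _ _)) [_ -> ->]]] := glued_expand 1 y.
have b0 i : (3 <= i)%N -> gbinom R (1 + 1) i = 0.
  by move=> i3; rewrite -[1 + 1]/(2%:Z) gbinom_nat bin_small.
rewrite (sum3 (F := fun i : nat => (-1) ^+ i * gbinom R (1 - 1) i * psi (L (1 + i%:Z) y'))
  (leq_maxr _ _)); last first.
  by move=> i i3; rewrite subrr (gbinom_nat R 0) bin_small ?mulr0 ?mul0r//; lia.
rewrite (sum3 (F := fun i : nat => (-1) ^+ i * gbinom R (1 + 1) i * psi (M (- 1 + i%:Z) y'))
  (leq_maxr _ _)); last by move=> i /b0 ->; rewrite mulr0 mul0r.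
rewrite subrr -[1 + 1]/(2%:Z) !(gbinom_nat R 0) !(gbinom_nat R 2).
rewrite -['C(0, 0)]/1%N -['C(0, 1)]/0%N -['C(0, 2)]/0%N.
rewrite -['C(2, 0)]/1%N -['C(2, 1)]/2%N -['C(2, 2)]/1%N !addr0.
rewrite -[- 1 + 1%:Z]/(0 : int) -[- 1 + 2%:Z]/(1 : int).
have e1 := gl_1 h y'; have e0 := gl_0 h y'.
have -> : psi (L 1 y') = psi (M 1 y') - psi (M 0 y') + psi (L 0 y') by rewrite -e1 subrK.
have -> : psi (L 0 y') = psi (M (-1) y') - psi (M 0 y') by rewrite -e0 addrK.
ring.
Qed.

(** Under conjugation by the exponentials [L (-2)] becomes
    [L (-2) - 3 L (-1) + 3 L 0 - L 1], and [M 2] becomes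
    [M 2 + M 3 + M 4 + ...], which is the part of the expansion of the pole
    left over by [M (-1) + M 0 + M 1]. *)
Lemma glued_m2 y : beta (L (-2) y) = beta (M 2 y).
Proof.
have [y' [N0 hN]] := glued_expand (-2) y; have [K0 hK] := gl_L h y'.
pose N := maxn N0 (maxn 4 K0).
have [|_ -> ] := hN N; first exact: leq_maxl.
rewrite opprK => ->.
have N4 : (4 <= N)%N by rewrite /N !leq_max leqnn orbT.
have K0N : (K0 <= 3 + N)%N by rewrite /N; lia.
rewrite (sum4 (F := fun i : nat => (-1) ^+ i * gbinom R (1 - -2) i * psi (L (-2 + i%:Z) y'))
  N4); last first.
  move=> i i4; rewrite -[1 - -2]/(3%:Z) gbinom_nat bin_small ?mulr0 ?mul0r//.
have := hK _ K0N; rewrite big_split_ord/= !big_ord_recr big_ord0/= add0r.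
set S := \sum_(i < N) _ => E.
have -> : \sum_(i < N) (-1) ^+ i * gbinom R (1 - 2) i * psi (M (2 + i%:Z) y') = S.
  apply: eq_bigr => i _; rewrite -[1 - 2]/(-1 : int) gbinom_m1 -expr2 sqrr_sign mul1r.
  by congr (psi (M _ y')); lia.
rewrite -[1 - -2]/(3%:Z) !(gbinom_nat R 3) -['C(3, 0)]/1%N -['C(3, 1)]/3%N.
rewrite -['C(3, 2)]/3%N -['C(3, 3)]/1%N.
move: E; rewrite -[0%N%:Z - 1]/(-1 : int) -[1%N%:Z - 1]/(0 : int) -[2%N%:Z - 1]/(1 : int).
rewrite -[-2 + 1%N%:Z]/(-1 : int) -[-2 + 2%N%:Z]/(0 : int) -[-2 + 3%N%:Z]/(1 : int) addr0.
have e1 := gl_1 h y'; have e0 := gl_0 h y'; have em := gl_m1 h y'.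
move=> ->.
have -> : psi (L 1 y') = psi (M 1 y') - psi (M 0 y') + psi (L 0 y') by rewrite -e1 subrK.
have -> : psi (L 0 y') = psi (M (-1) y') - psi (M 0 y') by rewrite -e0 addrK.
rewrite em; ring.
Qed.
End Glued.
End Gluing.

(** * Ishibashi conditions as a Lie algebra of constraints *)

Lemma commutator_solve (K : comRingType) (a b d P Q k k' X Y : K) :
  a + d * P + k - b = X - (Y + - d * Q + k') -> a - X = b - Y -> k + k' = 0 ->
  d * P = d * Q.
Proof.
move=> E1 E2 E3; apply/eqP; rewrite -subr_eq0; apply/eqP.
have -> : d * P - d * Q = (a + d * P + k - b - (X - (Y + - d * Q + k')))
    - (a - X - (b - Y)) - (k + k') by ring.
by rewrite E1 E2 E3 !subrr.
Qed.

Section WittClosure.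
Variables (R : realType) (W : lmodType R[i]).
Local Notation C := R[i].
Variables (L M : int -> W -> W) (c : C) (beta : W -> C).
Local Notation kappa m n := (if m + n == 0 then gbinom R (m + 1) 3 * c else 0).
Hypothesis virL : forall m n x,
  L m (L n x) = L n (L m x) + (m - n)%:~R *: L (m + n) x + kappa m n *: x.
Hypothesis virM : forall m n x,
  M m (M n x) = M n (M m x) + (m - n)%:~R *: M (m + n) x + kappa m n *: x.
Hypothesis comm_LM : forall m n x, L m (M n x) = M n (L m x).
Hypothesis hbeta : linear (beta : W -> C^o).

Definition balanced (m : int) := forall y, beta (L m y) = beta (M (- m) y).

(** The central terms of [L] and [M] cancel. *)
Lemma balancedD m n : m != n -> balanced m -> balanced n -> balanced (m + n).
Proof.
move=> mn hm hn y.
have E1 : beta (L m (L n y)) - beta (L m (M (- n) y)) =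
          beta (M (- m) (L n y)) - beta (M (- m) (M (- n) y)) by rewrite !hm.
have E2 : beta (L n (L m y)) - beta (L n (M (- m) y)) =
          beta (M (- n) (L m y)) - beta (M (- n) (M (- m) y)) by rewrite !hn.
have d0 : (m - n)%:~R != 0 :> C by rewrite intr_eq0 subr_eq0.
have Ek : kappa m n * beta y + kappa (- m) (- n) * beta y = 0.
  rewrite -opprD oppr_eq0 -mulrDl; case: ifP => _; last by rewrite addr0 mul0r.
  rewrite -mulrDl (_ : gbinom R (m + 1) 3 + _ = 0) ?mul0r// !gbinomS !gbinom0.
  by rewrite !intrD mulrNz; field.
apply: (mulfI d0); move: E1 E2 Ek.
rewrite (virL m n) (virM (- m) (- n)) !comm_LM !(linD hbeta) !(linZ hbeta) -!opprD.
rewrite mulrNz; exact: commutator_solve.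
Qed.

(** The elements 1, 2 and -2 generate the Witt algebra. *)
Lemma balanced_all n : balanced 1 -> balanced 2 -> balanced (-2) -> balanced n.
Proof.
move=> b1 b2 bm2.
have bm1 : balanced (-1) by apply: (@balancedD 1 (-2)).
have b0 : balanced 0 by apply: (@balancedD 1 (-1)).
case: n => [n|n]; last (rewrite NegzE; elim: n => // n IHn).
  elim: n => // -[|[|n]] // IHn.
  by rewrite (_ : n.+3%:Z = 1 + n.+2%:Z); [apply: balancedD => //; exact: IHn|lia].
case: n IHn => // n IHn.
by rewrite (_ : - n.+3%:Z = - 1 - n.+2%:Z); [apply: balancedD => //; exact: IHn|lia].
Qed.
End WittClosure.

(** * Boundary states *)

Section BoundaryState.
Variables (R : realType) (V T : VOA R) (tau : V -> V -> T).
Local Notation C := R[i].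
Hypothesis hT : is_tensor_square tau.

Section ClosedExponentials.
Variable D : full_field_algebra tau.
Local Notation biw := (@biweight R V T tau D).
Local Notation L := (@LL R V T tau D).
Local Notation M := (@LR R V T tau D).

Lemma iter_LL1_wt j p w : biw p w -> biw (p.1 - j%:R, p.2) (iter j (L 1) w).
Proof.
move=> hw; elim: j => [|j /(LL_wt hT 1)/= IHj]; first by rewrite subr0; case: p hw.
by rewrite -natr1 opprD addrA.
Qed.

Lemma iter_LR1_wt k p w : biw p w -> biw (p.1, p.2 - k%:R) (iter k (M 1) w).
Proof.
move=> hw; elim: k => [|k /(LR_wt hT 1)/= IHk]; first by rewrite subr0; case: p hw.
by rewrite -natr1 opprD addrA.
Qed.

Lemma biw_low : exists N : R, forall p w, p.1 < N \/ p.2 < N -> biw p w -> w = 0.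
Proof.
have [N hN] := cl_bounded D; exists N => p w pN /(gradE_pr (cl_grading D)) <-.
exact: hN.
Qed.

Lemma nat_above (x : R) : exists N0 : nat, forall n : nat, (N0 <= n)%N -> x < n%:R.
Proof.
exists (Num.bound `|x|) => n hn; apply: (le_lt_trans (ler_norm x)).
by apply: (lt_le_trans (archi_boundP (normr_ge0 x))); rewrite ler_nat.
Qed.

Lemma LL_trunc m (y : D) : exists N0 : nat, forall i j k : nat,
  (N0 <= i + j)%N -> L (m + i%:Z) (iter j (L 1) (iter k (M 1) y)) = 0.
Proof.
have [N hN] := biw_low.
have [||N0 h0] := @grad_near _ _ _ _ _ (cl_grading D) (nat * nat * nat)
  (fun t => t.1.1 + t.1.2)%N
  (fun t x => L (m + t.1.1%:Z) (iter t.1.2 (L 1) (iter t.2 (M 1) x))) _ _ y.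
- move=> [[i j] k] a x z /=.
  by rewrite (iter_lin k (LR_lin _ _)) (iter_lin j (LL_lin _ _)) (LL_lin _ _).
- move=> p x hx; have [N0 h0] := nat_above (p.1 - m%:~R - N).
  exists N0 => -[[i j] k] /h0 /= hij.
  apply: hN (LL_wt hT _ (iter_LL1_wt j (iter_LR1_wt k hx))); left => /=.
  by move: hij; rewrite natrD intrD -[(i%:Z)%:~R]/(i%:R : R); lra.
- by exists N0 => i j k hij; exact: (h0 (i, j, k)).
Qed.

Lemma LR_trunc m (y : D) : exists N0 : nat, forall i j k : nat,
  (N0 <= i + j)%N -> M (m + i%:Z) (iter j (M 1) (iter k (L 1) y)) = 0.
Proof.
have [N hN] := biw_low.
have [||N0 h0] := @grad_near _ _ _ _ _ (cl_grading D) (nat * nat * nat)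
  (fun t => t.1.1 + t.1.2)%N
  (fun t x => M (m + t.1.1%:Z) (iter t.1.2 (M 1) (iter t.2 (L 1) x))) _ _ y.
- move=> [[i j] k] a x z /=.
  by rewrite (iter_lin k (LL_lin _ _)) (iter_lin j (LR_lin _ _)) (LR_lin _ _).
- move=> p x hx; have [N0 h0] := nat_above (p.2 - m%:~R - N).
  exists N0 => -[[i j] k] /h0 /= hij.
  apply: hN (LR_wt hT _ (iter_LR1_wt j (iter_LL1_wt k hx))); right => /=.
  by move: hij; rewrite natrD intrD -[(i%:Z)%:~R]/(i%:R : R); lra.
- by exists N0 => i j k hij; exact: (h0 (i, j, k)).
Qed.

Lemma L1M1_nilp (y : D) : exists N0 : nat, forall j k : nat,
  (N0 <= j)%N \/ (N0 <= k)%N -> iter j (L 1) (iter k (M 1) y) = 0.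
Proof.
have [N hN] := biw_low.
have [||N0 h0] := @grad_near _ _ _ _ _ (cl_grading D) (nat * nat)
  (fun t => maxn t.1 t.2) (fun t x => iter t.1 (L 1) (iter t.2 (M 1) x)) _ _ y.
- move=> [j k] a x z /=.
  by rewrite (iter_lin k (LR_lin _ _)) (iter_lin j (LL_lin _ _)).
- move=> p x hx; have [N1 h1] := nat_above (p.1 - N).
  have [N2 h2] := nat_above (p.2 - N).
  exists (maxn N1 N2) => -[j k] /=; rewrite leq_max !geq_max => hjk.
  apply: hN (iter_LL1_wt j (iter_LR1_wt k hx)) => /=.
  case/orP: hjk => /andP[a b]; first by left; have := h1 _ a; lra.
  by right; have := h2 _ b; lra.
- by exists N0 => j k hjk; apply: (h0 (j, k)); rewrite leq_max; exact/orP.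
Qed.

Lemma expLM_exp (y : D) : exists N0 : nat, forall N, (N0 <= N)%N ->
  expLM L M N y = exp_LL1_LR1 tau (-1) (-1) y.
Proof.
have [N0 h0] := L1M1_nilp y; exists N0 => N N0N; rewrite /exp_LL1_LR1.
rewrite (@fsum_nat2 _ _ N); last first.
  move=> j k jk; rewrite h0 ?scaler0//.
  by case: jk => /(leq_trans N0N); [left|right].
apply: eq_bigr => j _; apply: eq_bigr => k _.
by rewrite /dpow (linZ (iter_lin j (LL_lin _ _))) scalerA.
Qed.

Lemma exp_LL0_LR0_lin (l l' : C) : linear (exp_LL0_LR0 (@cl_pr R V T tau D) l l').
Proof.
move=> a x y; rewrite /exp_LL0_LR0.
have [sx [_ ex]] := grad_sum (cl_grading D) x.
have [sy [_ ey]] := grad_sum (cl_grading D) y.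
pose s := undup (sx ++ sy).
have x0 p : p \notin s -> cl_pr p x = 0.
  rewrite mem_undup mem_cat negb_or => /andP[px _].
  exact: grad_supp (cl_grading D) _ _ _ ex px.
have y0 p : p \notin s -> cl_pr p y = 0.
  rewrite mem_undup mem_cat negb_or => /andP[_ py].
  exact: grad_supp (cl_grading D) _ _ _ ey py.
rewrite !(@fsum_seq _ _ _ s) ?undup_uniq//.
- rewrite scaler_sumr -big_split; apply: eq_bigr => p _ /=.
  by rewrite (grad_lin (cl_grading D) p) scalerDr !scalerA mulrC.
- by move=> p /y0 ->; rewrite scaler0.
- by move=> p /x0 ->; rewrite scaler0.
- move=> p ps; rewrite (grad_lin (cl_grading D) p) x0// y0//.
  by rewrite scaler0 addr0 scaler0.
Qed.
End ClosedExponentials.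

Section IshibashiState.
Variable A : open_closed_field_algebra tau.
Variables (Bop : oc_op A -> oc_op A -> C) (hBop : invariant_form_op Bop).
Variables (Bcl : oc_cl A -> oc_cl A -> C) (hBcl : invariant_form_cl Bcl).
Variable istar : C -> oc_op A -> R * R -> oc_cl A.
Hypothesis histar : is_iota_clop_adjoint Bop Bcl istar.
Variables (u : oc_op A) (hu : mL (-1) u = 0) (z0 : C) (hz0 : upper_half z0).
Local Notation biw := (@biweight R V T tau (oc_cl A)).
Local Notation L := (@LL R V T tau (oc_cl A)).
Local Notation M := (@LR R V T tau (oc_cl A)).
Local Notation zeta := (z0^*).
Local Notation phi := (bdry Bop u z0 zeta).
Local Notation lam := (zeta - z0).
Local Notation l := (Clog lam).

Let phi_lin : linear (phi : oc_cl A -> C^o) := bdry_lin hBop u hz0 (conj_lower hz0).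

Lemma phi_istar p w : biw p w -> phi w = Bcl (istar z0 u p) w.
Proof.
move=> hw; have [hc /(_ w)] := histar u hz0.
have hb q : biw q (istar z0 u q) by apply/(gradE_pr (cl_grading _)).
rewrite /pair_left (@fsum_one _ _ _ p); last first.
  by move=> q; exact: Bcl_orth hBcl _ _ _ _ (hb q) hw.
move=> ->; rewrite /pair_right (@fsum_one _ _ _ 0)// => q q0.
have u0 : mL 0 u = (0 : R)%:C *: u by rewrite scale0r mL0_vacuum_like.
apply: (Bop_orth hBop u0 (g := q)); last by rewrite eq_sym.
apply/(gradE_pr (m_grading (oc_op A))).
exact: (oc_compl w (op_one _) hz0 (conj_lower hz0)).
Qed.

Lemma lam_neq0 : lam != 0.
Proof. by rewrite -opprB oppr_eq0 conj_neq. Qed.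

Lemma Cexp_l : Cexp l = lam.
Proof. exact: Cexp_Clog lam_neq0. Qed.

Lemma Cexp_lJ : Cexp l^* = - lam.
Proof. by rewrite Cexp_conj Cexp_l rmorphB opprB; congr (_ - _); exact: conjcK. Qed.

(** The boundary functional rescaled so that the insertion points [z0] and [zeta]
    are moved to distance 1 from each other. *)
Definition psi (y : oc_cl A) : C :=
  phi (exp_LL0_LR0 (@cl_pr R V T tau (oc_cl A)) l l^* y).

Lemma psi_lin : linear (psi : oc_cl A -> C^o).
Proof. by move=> a x y; rewrite /psi exp_LL0_LR0_lin phi_lin. Qed.

Let scale (p : R * R) : C := Cexp (p.1%:C * l + p.2%:C * l^*).

Lemma psiE p y : biw p y -> psi y = scale p * phi y.
Proof. by move=> hy; rewrite /psi (exp_LL0_LR0_homog _ _ hy) (linZ phi_lin). Qed.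

Lemma psi_L p (m : int) y : biw p y -> psi (L m y) = scale p * lam ^ (- m) * phi (L m y).
Proof.
move=> hy; rewrite (psiE (LL_wt hT m hy)) -Cexp_l -Cexp_int /scale -CexpD/=.
congr (Cexp _ * _); rewrite rmorphB/= rmorph_int mulrNz; ring.
Qed.

Lemma psi_M p (m : int) y : biw p y ->
  psi (M m y) = scale p * (- lam) ^ (- m) * phi (M m y).
Proof.
move=> hy; rewrite (psiE (LR_wt hT m hy)) -Cexp_lJ -Cexp_int /scale -CexpD/=.
congr (Cexp _ * _); rewrite rmorphB/= rmorph_int mulrNz; ring.
Qed.

Let psi_ward (y : oc_cl A) : Prop :=
  [/\ psi (L (-1) y) = psi (M (-1) y),
      psi (L 0 y) + psi (M 0 y) = psi (M (-1) y),
      psi (L 1 y) - psi (L 0 y) = psi (M 1 y) - psi (M 0 y),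
      exists K0 : nat, forall K, (K0 <= K)%N ->
        psi (L (-2) y) = \sum_(k < K) psi (M (k%:Z - 1) y)
    & exists K0 : nat, forall K, (K0 <= K)%N ->
        psi (M (-2) y) = \sum_(k < K) psi (L (k%:Z - 1) y)].

Lemma psi_wardP y : psi_ward y.
Proof.
have psiL n x z : psi (L n (x + z)) = psi (L n x) + psi (L n z).
  by rewrite (linD (LL_lin tau n)) (linD psi_lin).
have psiM n x z : psi (M n (x + z)) = psi (M n x) + psi (M n z).
  by rewrite (linD (LR_lin tau n)) (linD psi_lin).
have psiL0 n : psi (L n 0) = 0 by rewrite (lin0 (LL_lin tau n)) (lin0 psi_lin).
have psiM0 n : psi (M n 0) = 0 by rewrite (lin0 (LR_lin tau n)) (lin0 psi_lin).
move: y; apply: (grad_ind (cl_grading (oc_cl A))).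
- split; rewrite ?psiL0 ?psiM0 ?addr0//; exists 0%N => K _; rewrite ?psiL0 ?psiM0 big1//.
- move=> x y [x1 x2 x3 [Kx x4] [Kx' x5]] [y1 y2 y3 [Ky y4] [Ky' y5]]; split.
  + by rewrite psiL psiM x1 y1.
  + by rewrite psiL !psiM addrACA x2 y2.
  + by rewrite !psiL !psiM !opprD addrACA x3 y3 addrACA.
  + exists (maxn Kx Ky) => K; rewrite geq_max => /andP[/x4 ex /y4 ey].
    by rewrite psiL ex ey -big_split; apply: eq_bigr => k _; rewrite psiM.
  + exists (maxn Kx' Ky') => K; rewrite geq_max => /andP[/x5 ex /y5 ey].
    by rewrite psiM ex ey -big_split; apply: eq_bigr => k _; rewrite psiL.
move=> p y hy; have lam0 := lam_neq0.
have nlam0 : - lam != 0 by rewrite oppr_eq0.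
have Lk (k : nat) : Lmode k y = L (k%:Z - 1) y by rewrite /LL subrK.
have Mk (k : nat) : Rmode k y = M (k%:Z - 1) y by rewrite /LR subrK.
have em : phi (L (-1) y) = - phi (M (-1) y).
  by apply/eqP; rewrite -addr_eq0; apply/eqP; exact: (bdry_Lm1 hBop hu hz0 y).
have e0 : phi (L 0 y) = - phi (M 0 y) - lam * phi (M (-1) y).
  have := bdry_L0 hBop hu hz0 y; rewrite -/(L 0 y) -/(M 0 y) -/(L (-1) y) -/(M (-1) y) em.
  by move=> E; apply/eqP; rewrite -subr_eq0; apply/eqP; rewrite -E; ring.
have e1 : phi (L 1 y) = - phi (M 1 y) - 2 * lam * phi (M 0 y)
    - lam ^+ 2 * phi (M (-1) y).
  have := bdry_L1 hBop hu hz0 y; rewrite !big_ord_recr !big_ord0/= !Lk !Mk !add0r.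
  rewrite -[1%N%:Z - 1]/(0 : int) -[2%N%:Z - 1]/(1 : int).
  rewrite -['C(2, 0)]/1%N -['C(2, 1)]/2%N -['C(2, 2)]/1%N em e0.
  by move=> E; apply/eqP; rewrite -subr_eq0; apply/eqP; rewrite -E; ring.
split.
- rewrite (psi_L _ hy) (psi_M _ hy) opprK !expr1z em; ring.
- rewrite (psi_L _ hy) !(psi_M _ hy) oppr0 !expr0z opprK !expr1z e0; ring.
- rewrite !(psi_L _ hy) !(psi_M _ hy) oppr0 !expr0z !exprN1 e0 e1.
  by field.
- have [K0 hK0] := wm_trunc (m_weak (oc_cl A)) (tau (vac V) (conf V)) y.
  exists `|K0|%N => K KK.
  have hK (k : nat) : (K <= k)%N -> Rmode k y = 0.
    by move=> Kk; apply: hK0; lia.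
  rewrite (psi_L _ hy) opprK (bdry_Lm2 hBop hu hz0 hK : phi (L (-2) y) = _) mulr_sumr.
  apply: eq_bigr => k _; rewrite Mk (psi_M _ hy) -(opprB 1 k%:Z) opprK mulrA; congr (_ * _).
  rewrite -mulrA; congr (_ * _); rewrite -(opprB zeta z0).
  rewrite -[lam ^ 2]/(lam ^+ 2) -sqrrN.
  by rewrite -[X in X / _]/((- lam) ^ 2) exprnN -expfzDr//; congr (_ ^ _); lia.
- have [K0 hK0] := wm_trunc (m_weak (oc_cl A)) (tau (conf V) (vac V)) y.
  exists `|K0|%N => K KK.
  have hK (k : nat) : (K <= k)%N -> Lmode k y = 0.
    by move=> Kk; apply: hK0; lia.
  rewrite (psi_M _ hy) opprK (bdry_Rm2 hBop hu hz0 hK : phi (M (-2) y) = _) mulr_sumr.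
  apply: eq_bigr => k _; rewrite Lk (psi_L _ hy) -(opprB 1 k%:Z) opprK mulrA; congr (_ * _).
  rewrite -mulrA; congr (_ * _).
  rewrite -[(- lam) ^ 2]/((- lam) ^+ 2) sqrrN.
  by rewrite -[X in X / _]/(lam ^ 2) exprnN -expfzDr//; congr (_ ^ _); lia.
Qed.

Lemma gbinom23 (m n : int) (x : oc_cl A) :
  (if m + n == 0 then gbinom R (1 + 1) 3 * (ccharge V / 2%:R) else 0) *: x = 0.
Proof. by rewrite (gbinom_nat R 2) bin_small// mul0r if_same scale0r. Qed.

Lemma boundary_glued : glued L M psi.
Proof.
split.
- exact: LL_lin.
- exact: LR_lin.
- by move=> n x; rewrite (LL_comm hT) gbinom23 addr0 [1 + n]addrC.
- by move=> n x; rewrite (LR_comm hT) gbinom23 addr0 [1 + n]addrC.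
- exact: (LL_LR hT).
- exact: LL_trunc.
- exact: LR_trunc.
- by move=> y; exists (exp_LL1_LR1 tau (-1) (-1) y); exact: expLM_exp.
- exact: psi_lin.
- by move=> y; have [] := psi_wardP y.
- by move=> y; have [] := psi_wardP y.
- by move=> y; have [] := psi_wardP y.
- by move=> y; have [] := psi_wardP y.
- by move=> y; have [] := psi_wardP y.
Qed.

(** The pairing of [y] with the transported boundary state; see
    [boundary_beta]. *)
Definition beta (y : oc_cl A) : C := psi (exp_LL1_LR1 tau (-1) (-1) y).

Lemma beta_near y : exists N0 : nat, forall N, (N0 <= N)%N ->
  beta y = psi (expLM L M N y).
Proof. by have [N0 h0] := expLM_exp y; exists N0 => N /h0 E; rewrite /beta E. Qed.

Lemma beta_lin : linear (beta : oc_cl A -> C^o).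
Proof.
move=> a x y; have [N0 h0] := near_and (beta_near (a *: x + y))
  (near_and (beta_near x) (beta_near y)).
have [-> [-> ->]] := h0 N0 (leqnn _); rewrite -psi_lin; congr psi.
rewrite /expLM scaler_sumr -big_split; apply: eq_bigr => j _ /=.
rewrite scaler_sumr -big_split; apply: eq_bigr => k _ /=.
by rewrite (dpow_lin k (LR_lin tau 1)) (dpow_lin j (LL_lin tau 1)).
Qed.

Lemma beta_balanced n y : beta (L n y) = beta (M (- n) y).
Proof.
move: y; apply: (balanced_all (LL_comm hT (W := oc_cl A)) (LR_comm hT (W := oc_cl A))
  (LL_LR hT (W := oc_cl A)) beta_lin).
- exact: glued_1 boundary_glued beta_near.
- move=> y; apply: esym; apply: (glued_m2 (glued_sym boundary_glued)) => x.
  have [N0 h0] := beta_near x; exists N0 => N /h0 ->.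
  by rewrite (expLM_sym _ _ (@LL_lin _ _ _ tau _) (@LR_lin _ _ _ tau _) (LL_LR hT (W := oc_cl A))).
- exact: glued_m2 boundary_glued beta_near.
Qed.

Local Notation b := (istar z0 u).
Local Notation bstate := (boundary_transport z0 b).

Lemma istar_wt q : biw q (b q).
Proof.
by apply/(gradE_pr (cl_grading _)); have [hc _] := histar u hz0; exact: hc.
Qed.

Lemma iter_LLm1_wt j p w : biw p w -> biw (p.1 + j%:R, p.2) (iter j (L (-1)) w).
Proof.
move=> hw; elim: j => [|j /(LL_wt hT (-1))/= IHj]; first by rewrite addr0; case: p hw.
by rewrite mulrN1z opprK -addrA natr1 in IHj.
Qed.

Lemma iter_LRm1_wt k p w : biw p w -> biw (p.1, p.2 + k%:R) (iter k (M (-1)) w).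
Proof.
move=> hw; elim: k => [|k /(LR_wt hT (-1))/= IHk]; first by rewrite addr0; case: p hw.
by rewrite mulrN1z opprK -addrA natr1 in IHk.
Qed.

Let term (p : R * R) (jk : nat * nat) : oc_cl A :=
  iter jk.1 (L (-1)) (iter jk.2 (M (-1))
    (scale (p.1 - jk.1%:R, p.2 - jk.2%:R) *: b (p.1 - jk.1%:R, p.2 - jk.2%:R))).

Lemma term_wt p jk : biw p (term p jk).
Proof.
have h : biw (p.1 - jk.1%:R, p.2 - jk.2%:R)
    (scale (p.1 - jk.1%:R, p.2 - jk.2%:R) *: b (p.1 - jk.1%:R, p.2 - jk.2%:R)).
  apply/(gradE_pr (cl_grading _)); rewrite (linZ (grad_lin (cl_grading _) _)).
  by congr (_ *: _); apply/(gradE_pr (cl_grading _)); exact: istar_wt.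
have := iter_LLm1_wt jk.1 (iter_LRm1_wt jk.2 h); rewrite /= !subrK.
by case: (p).
Qed.

Lemma boundary_near p : exists N0 : nat, forall N, (N0 <= N)%N -> bstate p =
  \sum_(j < N) \sum_(k < N) (j`!%:R^-1 * k`!%:R^-1) *: term p (nat_of_ord j, nat_of_ord k).
Proof.
have [m hm] := biw_low (oc_cl A).
have [N1 h1] := nat_above (p.1 - m); have [N2 h2] := nat_above (p.2 - m).
exists (maxn N1 N2) => N; rewrite geq_max => /andP[N1N N2N].
rewrite /boundary_transport /exp_LLm1_LRm1 (@fsum_nat2 _ _ N).
  apply: eq_bigr => j _; apply: eq_bigr => k _.
  by rewrite !expr1n !mul1r.
move=> j k jk; rewrite (hm _ _ _ (istar_wt _)); last first.
  case: jk => /= [/(leq_trans N1N)/h1|/(leq_trans N2N)/h2] h; [left|right]; lra.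
by rewrite scaler0 (iter_lin0 _ (LR_lin _ _)) (iter_lin0 _ (LL_lin _ _)) scaler0.
Qed.

Lemma boundary_wt p : biw p (bstate p).
Proof.
have [N0 /(_ _ (leqnn _)) ->] := boundary_near p.
apply/(gradE_pr (cl_grading _)); rewrite (lin_sum (grad_lin (cl_grading _) _)).
apply: eq_bigr => j _; rewrite (lin_sum (grad_lin (cl_grading _) _)).
apply: eq_bigr => k _; rewrite (linZ (grad_lin (cl_grading _) _)).
by congr (_ *: _); apply/(gradE_pr (cl_grading _)); exact: term_wt.
Qed.

Lemma Bcl_iterL j x y : Bcl (iter j (L (-1)) x) y = (-1) ^+ j * Bcl x (iter j (L 1) y).
Proof.
elim: j x y => [|j IHj] x y; first by rewrite mul1r.
rewrite iterSr IHj exprSr -mulrA iterS (Bcl_LL hT hBcl 1) expr1z.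
by rewrite mulN1r mulN1r opprK.
Qed.

Lemma Bcl_iterM k x y : Bcl (iter k (M (-1)) x) y = (-1) ^+ k * Bcl x (iter k (M 1) y).
Proof.
elim: k x y => [|k IHk] x y; first by rewrite mul1r.
rewrite iterSr IHk exprSr -mulrA iterS (Bcl_LR hT hBcl 1) expr1z.
by rewrite mulN1r mulN1r opprK.
Qed.

(** The adjoint of [L(-1)] is [- L(1)], so the exponentials in the definition of
    the boundary state act on [y] as [exp(- L(1))] in both chiralities. *)
Lemma boundary_beta p y : biw p y -> Bcl (bstate p) y = beta y.
Proof.
move=> hy; have [N0 h0] := near_and (boundary_near p) (beta_near y).
have [-> ->] := h0 N0 (leqnn _).
rewrite (lin_sum (Bcl_linl hBcl y)) /expLM (lin_sum psi_lin).
apply: eq_bigr => j _; rewrite (lin_sum (Bcl_linl hBcl y)) (lin_sum psi_lin).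
apply: eq_bigr => k _; rewrite (linZ (Bcl_linl hBcl y)) /term Bcl_iterL Bcl_iterM.
have hy' := iter_LR1_wt k (iter_LL1_wt j hy).
have -> : Bcl (scale (p.1 - j%:R, p.2 - k%:R) *: b (p.1 - j%:R, p.2 - k%:R))
    (iter k (M 1) (iter j (L 1) y)) = psi (iter k (M 1) (iter j (L 1) y)).
  by rewrite (psiE hy') (phi_istar hy') (linZ (Bcl_linl hBcl _)).
rewrite /dpow (linZ (iter_lin j (LL_lin tau 1))) !(linZ psi_lin).
have -> : iter j (L 1) (iter k (M 1) y) = iter k (M 1) (iter j (L 1) y).
  elim: (nat_of_ord j) => //= j' ->.
  by elim: (nat_of_ord k) => //= k' <-; rewrite (LL_LR hT).
rewrite -[_ *: _]/(_ * _) -[X in _ = X]/(_ * (_ * _)).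
ring.
Qed.

Lemma boundary_ishibashi : ishibashi bstate.
Proof.
move=> n p; have linp := grad_lin (cl_grading (oc_cl A)) p.
rewrite /LLhat /LRhat; set x1 := bstate _; set x2 := bstate _.
have w1 : biw p (L n x1).
  by have := LL_wt hT n (boundary_wt (p.1 + n%:~R, p.2)); rewrite /= addrK -surjective_pairing.
have w2 : biw p (M (- n) x2).
  have := LR_wt hT (- n) (boundary_wt (p.1, p.2 + (- n)%:~R)).
  by rewrite /= addrK -surjective_pairing.
have wx : biw p (L n x1 - M (- n) x2).
  apply/(gradE_pr (cl_grading _)); rewrite (linB linp).
  by congr (_ - _); apply/(gradE_pr (cl_grading _)).
apply: (form_ndl (clf_form hBcl)); apply: (grad_ind (cl_grading (oc_cl A))).
- exact: (lin0 (Bcl_linr hBcl _)).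
- by move=> y y' hy hy'; rewrite (linD (Bcl_linr hBcl _)) hy hy' addr0.
move=> q y hy; have [qp|qp] := eqVneq p q; last exact: (Bcl_orth hBcl wx hy).
rewrite -qp in hy; rewrite (linB (Bcl_linl hBcl y)).
have s0 : (-1) ^ n != 0 :> C by rewrite expfz_neq0// oppr_eq0 oner_eq0.
apply: (mulfI s0); rewrite mulr0 mulrBr -(Bcl_LR hT hBcl n).
have := Bcl_LL hT hBcl (- n) x1 y; rewrite opprK => E.
have -> : (-1) ^ n * Bcl (L n x1) y = Bcl x1 (L (- n) y).
  by rewrite E -exprz_inv invrN1.
rewrite /x1 /x2 !(boundary_beta (p := _)).
- by rewrite beta_balanced opprK subrr.
- by have := LR_wt hT n hy; rewrite /= mulrNz.
- by have := LL_wt hT (- n) hy; rewrite /= mulrNz opprK.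
Qed.
End IshibashiState.
End BoundaryState.

Theorem proposition3p18 (R : realType)
  (V : VOA R) (hV : standing_assumption V)
  (T : VOA R) (tau : V -> V -> T) (hT : is_tensor_square tau)
  (A : open_closed_field_algebra tau)
  (Bop : oc_op A -> oc_op A -> R[i]) (hBop : invariant_form_op Bop)
  (Bcl : oc_cl A -> oc_cl A -> R[i]) (hBcl : invariant_form_cl Bcl)
  (istar : R[i] -> oc_op A -> R * R -> oc_cl A)
  (histar : is_iota_clop_adjoint Bop Bcl istar)
  (u : oc_op A) (hu : mL (-1) u = 0)
  (z0 : R[i]) (hz0 : upper_half z0) :
  ishibashi (boundary_transport z0 (istar z0 u)).
Proof. exact: (boundary_ishibashi hT hBop hBcl histar hu hz0). Qed.
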